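(* Every simple finite-dimensional $YQ(1)$-module is isomorphic to $V(\mathbf s)\otimes\Gamma_f$ or to $\Pi V(\mathbf s)\otimes\Gamma_f$ for some $n$, some regular typical $\mathbf s\in\mathbb C^n$ and some $f(u)=1+\sum_{k>0}f_{2k}u^{-2k}$ ($f_{2k}\in\mathbb C$). Furthermore, $V(\mathbf s)\otimes\Gamma_f$ and $V(\mathbf s')\otimes\Gamma_g$ are isomorphic up to change of parity if and only if $\mathbf s'$ is obtained from $\mathbf s$ by a permutation of coordinates and $f(u)=g(u)$.
   Context: $YQ(1)$ is the associative unital superalgebra over $\mathbb C$ generated by $T_{i,j}^{(m)}$, $m\geq1$, $i,j\in\{1,-1\}$, of parity $p(i)+p(j)$ where $p(1)=0$, $p(-1)=1$. With $T_{i,j}(u)=\delta_{ij}+\sum_{m\ge1}T^{(m)}_{i,j}u^{-m}$, the defining relations are, for all $i,j,k,l$: $(u^2-v^2)[T_{i,j}(u),T_{k,l}(v)](-1)^{p(i)p(k)+p(i)p(l)+p(k)p(l)}=(u+v)(T_{k,j}(u)T_{i,l}(v)-T_{k,j}(v)T_{i,l}(u))-(u-v)(T_{-k,j}(u)T_{-i,l}(v)-T_{k,-j}(v)T_{i,-l}(u))(-1)^{p(k)+p(l)}$ (brackets are supercommutators), and $T_{i,j}(-u)=T_{-i,-j}(u)$. It is a Hopf superalgebra with $\Delta(T^{(r)}_{i,j})=\sum_{s=0}^r\sum_k(-1)^{(p(i)+p(k))(p(j)+p(k))}T^{(s)}_{i,k}\otimes T^{(r-s)}_{k,j}$ ($T^{(0)}_{i,j}=\delta_{ij}$);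 tensor products of modules are defined via $\Delta$. Let $U(\mathfrak h_n)$ be the superalgebra generated by odd $\xi_1,\dots,\xi_n$ with $\xi_i\xi_j+\xi_j\xi_i=0$ ($i\ne j$), $x_i=\xi_i^2$. There is a surjective homomorphism $\varphi_n$ from $YQ(1)$ onto the principal finite $W$-algebra $W^n\subset U(\mathfrak h_n)$ of $Q(n)$ with $\varphi_n(T^{(k)}_{1,1})=(-1)^k[\Sigma_k]_{even}$, $\varphi_n(T^{(k)}_{-1,1})=(-1)^k[\Sigma_k]_{odd}$, where $\Sigma_k=\sum_{1\le i_1<\dots<i_k\le n}\prod_{j=1}^k(x_{i_j}+(-1)^{k-j}\xi_{i_j})$ (ordered product), and $\Sigma_k=0$ for $k>n$. For $\mathbf s\in\mathbb C^n$, $V(\mathbf s)$ is a simple $\mathbb Z_2$-graded $U(\mathfrak h_n)$-module on which $x_i$ acts by $s_i$ (unique up to isomorphism and parity change), made a $YQ(1)$-module by restriction to $W^n$ and pullback via $\varphi_n$. $\mathbf s$ is regular if all $s_i\ne0$, typical if $s_i+s_j\neq0$ for $i\ne j$. For $n=0$, $V(\mathbf s)$ is the trivial one-dimensional module. For $f(u)=1+\sum_{k>0}f_{2k}u^{-2k}$, $\Gamma_f$ is the one-dimensional even $YQ(1)$-module on which all odd generators and all $T^{(2k+1)}_{1,1}$ act by $0$ and $T^{(2k)}_{1,1}$ acts by $f_{2k}$ (this is a well-defined module). *)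

(* Defs.v *)
From mathcomp Require Import all_boot all_order all_algebra.
From mathcomp Require Import Rstruct.
From mathcomp Require Import complex.

Import GRing.Theory.
Local Open Scope ring_scope.

Definition CC : fieldType := complex Rdefinitions.R.

(* Linear maps between finite-dimensional spaces with a fixed basis,
   written as matrices  A : B1 -> B2 -> CC  (A x y = entry in row x,
   column y; maps act on column vectors  v : B2 -> CC).                *)
Definition mx (B1 B2 : finType) := B1 -> B2 -> CC.

Definition mmul {B1 B2 B3 : finType} (A : mx B1 B2) (A' : mx B2 B3) : mx B1 B3 :=
  fun x z => \sum_y A x y * A' y z.
Definition mid {B : finType} : mx B B := fun x y => (x == y)%:R.
Definition mzero {B1 B2 : finType} : mx B1 B2 := fun _ _ => 0.
Definition madd {B1 B2 : finType} (A A' : mx B1 B2) : mx B1 B2 :=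
  fun x y => A x y + A' x y.
Definition msub {B1 B2 : finType} (A A' : mx B1 B2) : mx B1 B2 :=
  fun x y => A x y - A' x y.
Definition mscale {B1 B2 : finType} (c : CC) (A : mx B1 B2) : mx B1 B2 :=
  fun x y => c * A x y.
Definition mapp {B1 B2 : finType} (A : mx B1 B2) (v : B2 -> CC) : B1 -> CC :=
  fun x => \sum_y A x y * v y.
Definition meq {B1 B2 : finType} (A A' : mx B1 B2) : Prop :=
  forall x y, A x y = A' x y.

Definition sgn (b : bool) : CC := if b then -1 else 1.

(* Z2-graded (super) vector spaces with a homogeneous basis B; par x is the
   parity of the basis vector x (false = even, true = odd).            *)

Definition homog {B : finType} (par : B -> bool) (b : bool) (A : mx B B) : Prop :=
  forall x y, par x (+) par y != b -> A x y = 0.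

Definition even_part {B : finType} (par : B -> bool) (A : mx B B) : mx B B :=
  fun x y => if par x == par y then A x y else 0.
Definition odd_part {B : finType} (par : B -> bool) (A : mx B B) : mx B B :=
  fun x y => if par x == par y then 0 else A x y.

Definition graded_stable_subspace {B : finType} (par : B -> bool)
    {I : Type} (ops : I -> mx B B) (U : (B -> CC) -> Prop) : Prop :=
  [/\ U (fun _ => 0),
      (forall v w, U v -> U w -> U (fun x => v x + w x)),
      (forall (c : CC) v, U v -> U (fun x => c * v x)),
      (forall v, U v -> U (fun x => if par x then 0 else v x))
    & (forall i v, U v -> U (mapp (ops i) v))].

Definition gr_simple {B : finType} (par : B -> bool) {I : Type}
    (ops : I -> mx B B) : Prop :=
  (0 < #|B|)%N /\
  forall U, graded_stable_subspace par ops U ->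
    (forall v, U v -> forall x, v x = 0) \/ (forall v, U v).

(* Finite-dimensional YQ(1)-modules.  Indices i,j in {1,-1} are encoded by
   bool: false = 1, true = -1, so that p(i) = i and -i = ~~ i.
   sT i j m  is the action of  T_{i,j}^{(m)}  for m >= 1 (the value at
   m = 0 is irrelevant: T^{(0)}_{i,j} = delta_{ij} is handled by Tn).  *)
Record smod := SMod {
  sbase : finType;
  spar : sbase -> bool;
  sT : bool -> bool -> nat -> mx sbase sbase }.

Definition Tn (V : smod) (i j : bool) (m : nat) : mx (sbase V) (sbase V) :=
  if m == 0%N then (if i == j then @mid (sbase V) else mzero)
  else sT V i j m.
Definition Tz (V : smod) (i j : bool) (m : int) : mx (sbase V) (sbase V) :=
  match m with Posz k => Tn V i j k | Negz _ => mzero end.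

Definition scomm {B : finType} (pa pb : bool) (A A' : mx B B) : mx B B :=
  msub (mmul A A') (mscale (sgn (pa && pb)) (mmul A' A)).

(* The defining relations of YQ(1), coefficientwise.  Writing X(u,v) =
   sum_{r,s} X_{r,s} u^-r v^-s, the coefficient of u^-r v^-s of
   (u^2 - v^2) X is X_{r+2,s} - X_{r,s+2}, of (u + v) X is
   X_{r+1,s} + X_{r,s+1}, of (u - v) X is X_{r+1,s} - X_{r,s+1}. *)
Definition YQ_rel (V : smod) (i j k l : bool) (r s : int) : Prop :=
  let T := Tz V in
  let C0 (a b : int) := scomm (i (+) j) (k (+) l) (T i j a) (T k l b) in
  let Y (a b : int) := msub (mmul (T k j a) (T i l b)) (mmul (T k j b) (T i l a)) in
  let Z (a b : int) := msub (mmul (T (~~ k) j a) (T (~~ i) l b))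
                            (mmul (T k (~~ j) b) (T i (~~ l) a)) in
  meq (mscale (sgn ((i && k) (+) (i && l) (+) (k && l)))
         (msub (C0 (r + 2) s) (C0 r (s + 2))))
      (msub (madd (Y (r + 1) s) (Y r (s + 1)))
            (mscale (sgn (k (+) l)) (msub (Z (r + 1) s) (Z r (s + 1))))).

Definition is_YQmod (V : smod) : Prop :=
  [/\ (forall i j m, (0 < m)%N -> homog (spar V) (i (+) j) (sT V i j m)),
      (* T_{i,j}(-u) = T_{-i,-j}(u) *)
      (forall i j m, (0 < m)%N ->
         meq (sT V (~~ i) (~~ j) m) (mscale ((-1) ^+ m) (sT V i j m)))
    & (forall i j k l r s, YQ_rel V i j k l r s)].

Definition YQ_simple (V : smod) : Prop :=
  gr_simple (spar V) (fun ijm : bool * bool * nat =>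
                         let: (i, j, m) := ijm in Tn V i j m).

Definition YQ_iso (V W : smod) : Prop :=
  exists (Phi : mx (sbase W) (sbase V)) (Psi : mx (sbase V) (sbase W)),
    [/\ (forall y x, spar W y != spar V x -> Phi y x = 0),
        meq (mmul Psi Phi) mid,
        meq (mmul Phi Psi) mid
      & forall i j m, meq (mmul Phi (Tn V i j m)) (mmul (Tn W i j m) Phi)].

Definition Pi (V : smod) : smod :=
  SMod (sbase V) (fun x => ~~ spar V x) (sT V).

(* tensor product via the coproduct
   Delta(T^{(r)}_{ij}) = sum_{s,k} (-1)^{(p(i)+p(k))(p(j)+p(k))} T^{(s)}_{ik} (x) T^{(r-s)}_{kj},
   with (a (x) b)(v (x) w) = (-1)^{p(b)p(v)} a v (x) b w. *)
Definition tens (V W : smod) : smod :=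
  SMod (sbase V * sbase W)%type
    (fun xy => spar V xy.1 (+) spar W xy.2)
    (fun i j m xy xy' =>
       \sum_(s < m.+1) \sum_(k : bool)
          sgn ((i (+) k) && (j (+) k)) * sgn ((k (+) j) && spar V xy'.1)
          * Tn V i k s xy.1 xy'.1 * Tn W k j (m - s) xy.2 xy'.2).

(* Gamma_f, f(u) = 1 + sum_{k>0} f_{2k} u^{-2k}, encoded by
   fc : nat -> CC with fc k = f_{2k} for k >= 1 (fc 0 is unused).
   Odd generators act by 0, T^{(2k+1)}_{1,1} by 0, T^{(2k)}_{1,1} by f_{2k};
   T^{(m)}_{-1,-1} = (-1)^m T^{(m)}_{1,1}. *)
Definition Gamma (fc : nat -> CC) : smod :=
  SMod unit (fun _ => false)
    (fun i j m _ _ =>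
       if i == j then (if odd m then 0 else fc m./2) else 0).

(* Z2-graded modules over U(h_n): odd operators xi_i, i < n. *)
Record hmod (n : nat) := HMod {
  hbase : finType;
  hpar : hbase -> bool;
  hxi : 'I_n -> mx hbase hbase }.

(* M is (a realization of) V(s): a simple Z2-graded U(h_n)-module on which
   x_i = xi_i^2 acts by s_i *)
Definition is_Vs {n : nat} (s : 'I_n -> CC) (M : hmod n) : Prop :=
  [/\ (forall i, homog (hpar n M) true (hxi n M i)),
      (forall i j, i != j ->
         meq (madd (mmul (hxi n M i) (hxi n M j)) (mmul (hxi n M j) (hxi n M i)))
             (mzero)),
      (forall i, meq (mmul (hxi n M i) (hxi n M i)) (mscale (s i) mid))
    & gr_simple (hpar n M) (hxi n M)].

(* ordered product  prod_{j=1}^{k} (x_{i_j} + (-1)^{k-j} xi_{i_j})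
   over the increasing list [i_1; ...; i_k]; k - j = number of later items *)
Fixpoint sigma_prod {n : nat} (s : 'I_n -> CC) (M : hmod n) (l : seq 'I_n)
    : mx (hbase n M) (hbase n M) :=
  match l with
  | [::] => @mid _
  | a :: l' =>
      mmul (madd (mscale (s a) mid) (mscale ((-1) ^+ size l') (hxi n M a)))
           (sigma_prod s M l')
  end.

Definition Sigma {n : nat} (s : 'I_n -> CC) (M : hmod n) (k : nat)
    : mx (hbase n M) (hbase n M) :=
  fun x y => \sum_(S : {set 'I_n} | #|S| == k) sigma_prod s M (enum S) x y.

Definition phi11 {n : nat} (s : 'I_n -> CC) (M : hmod n) (k : nat) :=
  mscale ((-1) ^+ k) (even_part (hpar n M) (Sigma s M k)).
Definition phim11 {n : nat} (s : 'I_n -> CC) (M : hmod n) (k : nat) :=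
  mscale ((-1) ^+ k) (odd_part (hpar n M) (Sigma s M k)).

(* V(s) viewed as a YQ(1)-module via phi_n; the remaining generators are
   determined by T^{(k)}_{-i,-j} = (-1)^k T^{(k)}_{i,j}. *)
Definition pullV {n : nat} (s : 'I_n -> CC) (M : hmod n) : smod :=
  SMod (hbase n M) (hpar n M)
    (fun i j k =>
       match i, j with
       | false, false => phi11 s M k
       | true, false => phim11 s M k
       | true, true => mscale ((-1) ^+ k) (phi11 s M k)
       | false, true => mscale ((-1) ^+ k) (phim11 s M k)
       end).

Definition regular {n : nat} (s : 'I_n -> CC) : Prop := forall i, s i != 0.
Definition typical {n : nat} (s : 'I_n -> CC) : Prop :=
  forall i j, i != j -> s i + s j != 0.

(* Main.v *)
(** Let [b = T_{-1,1}^(1)] and [eta_i = (1/2 ad T_{1,1}^(2))^i b].  Every generator is a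
    combination of products of the commuting elements [T_{1,1}^(2k)] and the [eta_i], and
    [eta_i eta_j + eta_j eta_i = (-1)^i C_(i+j)] with [C_m] central.  On a simple module the
    [C_m] are scalars, so the [eta_i] span a Clifford algebra with a form of Hankel type.  This
    form determines a monic polynomial [N = prod (t + s_i)] and, for [s] given by its roots,
    elements [xi_k = eta(p_k)], [p_k] a multiple of
    [prod_(i<k) (t - s_i) prod_(i>k) (t + s_i)], which satisfy the relations of [V(s)].  The
    even generators then agree with those of [V(s)] up to an even series [f] of scalars.
    Conversely the normalised trace of [T_{1,1}(u)] on [V(s) (x) Gamma_f] is
    [f(u) prod (1 - s_i / u)], which determines [f] and the [s_i] up to order because
    [prod (1 - s_i / u)] is coprime to its image under [u -> -u]. *)
From Stdlib Require Import Ncring Ncring_tac Classical FunctionalExtensionality.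
From HB Require Import structures.
Require Import Defs.
From mathcomp Require Import all_boot all_order all_algebra.
From mathcomp Require Import Rstruct complex ring zify perm.
Set Implicit Arguments.
Unset Strict Implicit.
Unset Printing Implicit Defensive.
Import GRing.Theory Num.Theory.
Local Open Scope ring_scope.

(** Let A(u) be the series of the [a (2k)]. Moving A(u) past eta(p) multiplies p by a fixed rational
    function g, and g(t) g(-t) = 1. As [b 1 * b 1] commutes with A(u), this kills the odd C_m and,
    degree by degree, forces the Hankel form. Since g does not depend on the module, two systems
    with the same eta differ by a series f that commutes with every eta. For the operators of V(s)
    only [qrel] is checked. That their [a (2k)] commute is recovered afterwards: a commutator that
    commutes with all generators is a scalar by Schur's lemma, and its trace is 0. Independence of
    the order of s is not shown by an explicit change of generators. N is found before an order of
    its roots is chosen, and every order gives Clifford generators on the same space; hence V(s)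
    itself also carries the structure of V(s') for a permuted s', the series f being 1 by comparison
    of traces. Uniqueness of simple Clifford modules then gives the isomorphism, up to parity. *)

Section NoncommutativeRing.
Variable R : pzRingType.

#[global] Instance nc_ring_ops :
  @Ring_ops R 0 1 (fun x y => x + y) (fun x y => x * y) (fun x y => x - y)
    (fun x => - x) (@eq R) := {}.

#[global] Instance nc_ring : @Ring R _ _ _ _ _ _ _ nc_ring_ops.
Proof.
split; try exact _; try (by move=> ? ? -> ? ? ->); try (by move=> ? ? ->);
  rewrite /=; [exact: add0r|exact: addrC|exact: addrA|exact: mul1r|exact: mulr1
    |exact: mulrA|exact: mulrDl|by move=> x y z; exact: mulrDr|by []|exact: subrr].
Qed.

End NoncommutativeRing.

(* Relations satisfied by [a m = T_{1,1}^(m)] and [b m = T_{-1,1}^(m)]; together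
   with commutativity of the [a (2k)] they are all that is used of [YQ(1)]. *)
Record qrel (R : pzRingType) (a b : nat -> R) : Prop := QRel {
  qrel_a0 : a 0%N = 1;
  qrel_b0 : b 0%N = 0;
  qrel_ba s : b 1%N * a s - a s * b 1%N = if odd s then 0 else b s + b s;
  qrel_bb s : b 1%N * b s + b s * b 1%N = if odd s then - (a s + a s) else 0;
  qrel_ab s : a 2%N * b s - b s * a 2%N =
    - (b s.+1 + b s.+1) + a s * b 1%N + (if odd s then - (b 1%N * a s) else b 1%N * a s);
  qrel_aa s : a 2%N * a s - a s * a 2%N =
    b s * b 1%N + (if odd s then - (b 1%N * b s) else b 1%N * b s) }.

Definition asgn (R : pzRingType) (s : nat) (x : R) : R := if odd s then - x else x.

(** * Adjoining one Clifford generator *)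

Section PullStep.
Variables (R : pzRingType) (a b : nat -> R) (x xi : R).
Hypothesis xi2 : xi * xi = x.
Hypothesis xia : forall s, a s * xi = xi * a s.
Hypothesis xib : forall s, b s * xi = - (xi * b s).

(** Splitting Sigma_k by its smallest index i gives the term (x_i + (-1)^(k-1) xi_i) Sigma_(k-1)
    over the later indices. [astep] and [bstep] are the even and odd parts of this recursion after
    multiplication by (-1)^k. *)
Definition astep k := if k is j.+1 then a j.+1 - x * a j + asgn k (xi * b j) else a 0%N.
Definition bstep k := if k is j.+1 then b j.+1 - x * b j + asgn k (xi * a j) else b 0%N.

Lemma qrel_step : qrel a b -> (forall s, a 1%N * b s = b s * a 1%N) ->
  (forall s, a 1%N * a s = a s * a 1%N) -> qrel astep bstep.
Proof.
case=> a0 b0 ba bb ab aa a1b a1a.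
have b1E : bstep 1%N = b 1%N - xi by rewrite /bstep /asgn /= a0 b0; non_commutative_ring.
have a2E : astep 2%N = a 2%N - xi * xi * a 1%N + xi * b 1%N by rewrite /astep /asgn /= xi2.
(* The relations are oriented as rewriting rules: [xi] moves to the left, [b 1] and [a 2] move to
   the right. What remains is an identity in the free algebra. *)
have xiaz s z : a s * (xi * z) = xi * (a s * z) by rewrite !mulrA xia.
have xibz s z : b s * (xi * z) = - (xi * (b s * z)) by rewrite !mulrA xib mulNr.
have ba' s : b 1%N * a s = a s * b 1%N + (if odd s then 0 else b s + b s).
  by rewrite -ba addrC subrK.
have bb' s : b 1%N * b s = - (b s * b 1%N) + (if odd s then - (a s + a s) else 0).
  by rewrite -bb; non_commutative_ring.
have ab' s : a 2%N * b s = b s * a 2%N + (- (b s.+1 + b s.+1) + a s * b 1%N +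
    (if odd s then - (b 1%N * a s) else b 1%N * a s)) by rewrite -ab addrC subrK.
have aa' s : a 2%N * a s = a s * a 2%N +
    (b s * b 1%N + (if odd s then - (b 1%N * b s) else b 1%N * b s)).
  by rewrite -aa addrC subrK.
split=> [| |[|s]|[|s]|[|s]|[|s]]; rewrite ?b1E ?a2E //; rewrite /astep /bstep ?a0 ?b0 /=;
  try by non_commutative_ring.
- rewrite /asgn -xi2 /=; have [os|os] := boolP (odd s); rewrite /= ?(mulrDl, mulrDr, mulrN, mulNr, opprK, opprD, =^~ mulrA, xia, xib, xiaz, xibz);
  rewrite ?(ba' s) ?(ba' s.+1) ?(bb' s) /= ?os ?(negbTE os) /= ; non_commutative_ring.
- rewrite /asgn -xi2 /=; have [os|os] := boolP (odd s); rewrite /= ?(mulrDl, mulrDr, mulrN, mulNr, opprK, opprD, =^~ mulrA, xia, xib, xiaz, xibz);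
  rewrite ?(bb' s) ?(bb' s.+1) ?(ba' s) /= ?os ?(negbTE os) /=; non_commutative_ring.
- rewrite /asgn -xi2 /=; have [os|os] := boolP (odd s); rewrite /= ?(mulrDl, mulrDr, mulrN, mulNr, opprK, opprD, =^~ mulrA, xia, xib, xiaz, xibz);
  rewrite ?a1b ?a1a ?(ab' s) ?(ab' s.+1) ?(aa' s) /= ?(negbTE os) ?os /= ?(mulrDl, mulrDr, mulrN, mulNr, opprK, opprD, =^~ mulrA, xia, xib, xiaz, xibz);
  rewrite ?(bb' s) ?(bb' s.+1) ?(ba' s) ?(ba' s.+1) /= ?(negbTE os) ?os /=; non_commutative_ring.
- rewrite /asgn -xi2 /=; have [os|os] := boolP (odd s); rewrite /= ?(mulrDl, mulrDr, mulrN, mulNr, opprK, opprD, =^~ mulrA, xia, xib, xiaz, xibz);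
  rewrite ?a1b ?a1a ?(aa' s) ?(ab' s) ?(aa' s.+1) /= ?(negbTE os) ?os /= ?(mulrDl, mulrDr, mulrN, mulNr, opprK, opprD, =^~ mulrA, xia, xib, xiaz, xibz);
  rewrite ?(bb' s) ?(bb' s.+1) ?(ba' s) ?(ba' s.+1) /= ?(negbTE os) ?os /=; non_commutative_ring.
Qed.
End PullStep.

(** * Formal power series over a noncommutative ring *)

Section Convolution.
Variable R : nzRingType.
Implicit Types f g h : nat -> R.

Definition conv f g k := \sum_(i < k.+1) f i * g (k - i)%N.

Lemma eq_conv f f' g g' : f =1 f' -> g =1 g' -> conv f g =1 conv f' g'.
Proof. by move=> ff' gg' k; apply: eq_bigr => i _; rewrite ff' gg'. Qed.

Lemma conv_coef f g k K : (k < K)%N ->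
  conv f g k = (\poly_(i < K) f i * \poly_(i < K) g i)`_k.
Proof.
move=> kK; rewrite coefM; apply: eq_bigr => i _.
by rewrite !coef_poly (leq_ltn_trans (leq_ord i) kK) (leq_ltn_trans (leq_subr _ _) kK).
Qed.

(** Up to degree k a series may be replaced by its truncation, so associativity is inherited from
    polynomials. *)
Lemma convA f g h : conv f (conv g h) =1 conv (conv f g) h.
Proof.
move=> k; set P := fun f => \poly_(i < k.+1) f i.
have trunc p q j : (j < k.+1)%N -> conv p q j = (P p * P q)`_j by exact: conv_coef.
transitivity (P f * (P g * P h))`_k.
  rewrite coefM; apply: eq_bigr => i _.
  by rewrite trunc ?ltnS ?leq_subr // coef_poly ltn_ord.
rewrite mulrA coefM; apply: eq_bigr => i _.
by rewrite trunc // (coef_poly k.+1 h) ltnS leq_subr.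
Qed.

Lemma conv_rev f g k : conv f g k = \sum_(i < k.+1) f (k - i)%N * g i.
Proof.
rewrite /conv (reindex_inj rev_ord_inj) /=; apply: eq_bigr => i _.
by rewrite !subSS subKn // -ltnS.
Qed.

Lemma conv_cancel_l f g : f 0%N = 1 -> (forall k, conv f g k = 0) -> forall k, g k = 0.
Proof.
move=> f0 fg0; elim/ltn_ind=> k IH; have := fg0 k.
rewrite /conv big_ord_recl f0 mul1r subn0 big1 ?addr0 // => i _.
by rewrite IH ?mulr0 //= /bump /=; have := ltn_ord i; lia.
Qed.

Lemma conv_cancel_r f g : g 0%N = 1 -> (forall k, conv f g k = 0) -> forall k, f k = 0.
Proof.
move=> f0 fg0; elim/ltn_ind=> k IH; have := fg0 k.
by rewrite /conv big_ord_recr /= subnn f0 mulr1 big1 ?add0r // => i _; rewrite IH ?mul0r.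
Qed.

Lemma conv_divr f g : g 0%N = 1 -> exists q, forall k, f k = conv q g k.
Proof.
move=> g0.
(* Long division: [L k] is the list of the first k coefficients of the quotient, and [step] appends
   the next one. *)
pose step (l : seq R) := rcons l (f (size l) - \sum_(i < size l) l`_i * g (size l - i)%N).
pose L k := iter k step [::].
have szL k : size (L k) = k by elim: k => //= k IH; rewrite size_rcons -/(L k) IH.
have LE k i : (i < k)%N -> (L k)`_i = (L i.+1)`_i.
  elim: k => // k IH ik; rewrite {1}/L /= -/(L k) nth_rcons szL.
  have [ik'|ki|->] := ltngtP i k; [exact: IH|by lia|].
  by rewrite /L /= -/(L k) nth_rcons szL ltnn eqxx.
exists (fun i => (L i.+1)`_i) => k.
rewrite /conv big_ord_recr /= subnn g0 mulr1 -/(L k.+1).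
rewrite (_ : \sum_(i < k) _ = \sum_(i < k) (L k)`_i * g (k - i)%N).
  by rewrite nth_rcons -/(L k) szL ltnn eqxx addrC subrK.
by apply: eq_bigr => i _; rewrite -(LE k).
Qed.

End Convolution.

(** * Linear maps on polynomials and the substitution t -> -t *)

Section PolyLinear.
Variables (F : fieldType) (V : lmodType F).

Definition plin (e : nat -> V) (p : {poly F}) : V := \sum_(i < size p) p`_i *: e i.

Lemma plinE e n (p : {poly F}) : (size p <= n)%N -> plin e p = \sum_(i < n) p`_i *: e i.
Proof.
move=> /subnKC <-; rewrite big_split_ord /= [X in _ + X]big1 ?addr0 // => i _.
by rewrite nth_default ?scale0r // leq_addr.
Qed.

Lemma plin_linear e : linear (plin e).
Proof.
move=> c p q; pose n := maxn (size p) (size q).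
rewrite (@plinE e n p) ?leq_maxl // (@plinE e n q) ?leq_maxr //.
rewrite (@plinE e n) ?scaler_sumr -?big_split /=.
  by apply: eq_bigr => i _; rewrite coefD coefZ scalerDl scalerA.
apply: leq_trans (size_polyD _ _) _; rewrite geq_max leq_maxr andbT.
by rewrite (leq_trans (size_scale_leq _ _)) ?leq_maxl.
Qed.

HB.instance Definition _ e :=
  GRing.isLinear.Build F {poly F} V *:%R (plin e) (@plin_linear e).

Lemma plinXn e i : plin e 'X^i = e i.
Proof.
rewrite /plin size_polyXn big_ord_recr /= coefXn eqxx scale1r big1 ?add0r // => j _.
by rewrite coefXn (ltn_eqF (ltn_ord j)) scale0r.
Qed.

Lemma eq_poly_linear (f g : {poly F} -> V) : linear f -> linear g ->
  (forall i, f 'X^i = g 'X^i) -> f =1 g.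
Proof.
have sumE (h : {poly F} -> V) : linear h -> forall p, h p = \sum_(i < size p) p`_i *: h 'X^i.
  move=> hL p; have h0 : h 0 = 0.
    by have := hL (-1) 0 0; rewrite !scaleN1r oppr0 addr0 addNr.
  rewrite -[in LHS](coefK p) poly_def; elim: (size p) => [|n IH]; first by rewrite !big_ord0.
  by rewrite !big_ord_recr /= addrC hL IH addrC.
by move=> fL gL fg p; rewrite !sumE //; apply: eq_bigr => i _; rewrite fg.
Qed.

End PolyLinear.

Section PolyNeg.
Variable F : fieldType.
Implicit Types p q : {poly F}.

Definition pneg p : {poly F} := p \Po (- 'X).

Lemma pnegM p q : pneg (p * q) = pneg p * pneg q. Proof. exact: comp_polyM. Qed.
Lemma pnegK p : pneg (pneg p) = p.
Proof. by rewrite /pneg -comp_polyA rmorphN /= comp_polyX opprK comp_polyXr. Qed.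
Lemma pnegX : pneg 'X = - 'X. Proof. exact: comp_polyX. Qed.
Lemma pnegXn i : pneg 'X^i = (-1) ^+ i *: 'X^i.
Proof. by rewrite /pneg comp_Xn_poly [LHS]exprNn -[in LHS]signr_odd -[in RHS]signr_odd; case: odd; rewrite ?(expr0, expr1, mulN1r, mul1r, scaleN1r, scale1r). Qed.
Lemma pnegD p q : pneg (p + q) = pneg p + pneg q. Proof. exact: comp_polyD. Qed.
Lemma pnegZ c p : pneg (c *: p) = c *: pneg p. Proof. exact: comp_polyZ. Qed.
Lemma pneg1 : pneg 1 = 1. Proof. exact: comp_polyC. Qed.
Lemma coef_pneg p i : (pneg p)`_i = (-1) ^+ i * p`_i.
Proof.
rewrite -[p]coefK poly_def /pneg linear_sum !coef_sum mulr_sumr; apply: eq_bigr => j _.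
rewrite linearZ /= -/(pneg 'X^j) pnegXn !coefZ !coefXn.
by case: eqP => [->|_]; rewrite ?mulr1 ?mulr0 // mulrC.
Qed.
Lemma size_pneg p : size (pneg p) = size p.
Proof. by rewrite size_comp_poly2 // size_polyN size_polyX. Qed.

End PolyNeg.

(** * The commutation factor g *)

Section GPolynomials.
Variable F : fieldType.

(** Origin: with t acting as [dd], the element [b (2k+1)] is [a (2k) * b 1] plus t^2 - t applied to
    [b (2k-1)]. *)
Definition wpoly : {poly F} := 'X^2 - 'X.

(* Coefficients, in powers of [u^-2], of [(u^2 - t^2 - t) / (u^2 - t^2 + t)]. *)
Definition gpoly (j : nat) : {poly F} := if j is i.+1 then - ('X * wpoly ^+ i) *+ 2 else 1.

Lemma pneg_wpoly : pneg wpoly = 'X^2 + 'X.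
Proof. by rewrite /pneg /wpoly comp_polyB comp_Xn_poly comp_polyX sqrrN opprK. Qed.

Lemma pneg_gpolyS i : pneg (gpoly i.+1) = 'X * pneg wpoly ^+ i *+ 2.
Proof.
rewrite /gpoly /pneg raddfMn /= rmorphN rmorphM rmorphXn /= comp_polyX.
by rewrite mulNr opprK.
Qed.

(** The substitution t -> -t exchanges numerator and denominator of g, so g(-t) g(t) = 1; these are
    its coefficients beyond the constant one. *)
Lemma sum_gpoly l : (0 < l)%N -> \sum_(j < l.+1) pneg (gpoly j) * gpoly (l - j) = 0.
Proof.
case: l => // l _; rewrite big_ord_recr /= subnn mulr1 big_ord_recl /= pneg1 mul1r.
set w := wpoly; set w' := pneg w.
have dw : w' - w = 'X *+ 2 by rewrite /w' pneg_wpoly /w /wpoly; ring.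
have -> : \sum_(i < l) pneg (gpoly (bump 0 i)) * gpoly (l.+1 - bump 0 i) =
    - ('X *+ 2) * ((w' ^+ l - w ^+ l)).
  case: l => [|l]; first by rewrite big_ord0 !expr0 subrr mulr0.
  rewrite subrXX dw !mulr_sumr [RHS](reindex_inj rev_ord_inj); apply: eq_bigr => i _ /=.
  have il : (i <= l)%N by rewrite -ltnS.
  rewrite (_ : l.+2 - bump 0 i = (l - i).+1)%N; last by rewrite /bump /=; lia.
  by rewrite pneg_gpolyS -/w -/w' /gpoly -/w subSS subKn //; ring.
by rewrite (pneg_gpolyS l) -/w -/w' /gpoly -/w; ring.
Qed.

End GPolynomials.

(** * Expressing the generators through [eta] *)

Section Eta.
Variables (F : numFieldType) (R : algType F) (a b : nat -> R).
Hypothesis ab_rel : qrel a b.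

#[local] Instance alg_ring_ops : @Ring_ops R 0 1 (fun x y => x + y) (fun x y => x * y)
  (fun x y => x - y) (fun x => - x) (@eq R) := nc_ring_ops R.
#[local] Instance alg_ring : @Ring R _ _ _ _ _ _ _ alg_ring_ops := nc_ring R.

Let A k := a k.*2.
Definition dd (X : R) : R := 2^-1 *: (a 2%N * X - X * a 2%N).

Lemma dd_linear : linear dd.
Proof.
move=> c X Y; rewrite /dd scalerA [c * _]mulrC -scalerA -scalerDr; congr (_ *: _).
rewrite mulrDr mulrDl -scalerAr -scalerAl opprD scalerBr.
by rewrite addrACA.
Qed.
HB.instance Definition _ := GRing.isLinear.Build F R R *:%R dd dd_linear.

Lemma half2 (V : lmodType F) (X : V) : 2^-1 *: (X + X) = X.
Proof. by rewrite -mulr2n -scaler_nat scalerA mulVf ?scale1r ?pnatr_eq0. Qed.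

Lemma ddM X Y : dd (X * Y) = dd X * Y + X * dd Y.
Proof.
rewrite /dd -scalerAl -scalerAr -scalerDr; congr (_ *: _); non_commutative_ring.
Qed.

Lemma eq_double (X Y : R) : X + X = Y + Y -> X = Y.
Proof. by move=> XY; rewrite -(half2 X) XY half2. Qed.

Definition eta i := iter i dd (b 1%N).
Local Notation etap := (plin eta).

Lemma etap1 : etap 1 = b 1%N.
Proof. by rewrite -(expr0 'X) plinXn. Qed.

Lemma etap_XM p : etap ('X * p) = dd (etap p).
Proof.
move: p; apply: eq_poly_linear => [c p q|c p q|i]; last by rewrite -exprS !plinXn.
  by rewrite mulrDr -scalerAr linearP.
by rewrite !linearP.
Qed.

Lemma a2A k : a 2%N * A k = A k * a 2%N.
Proof.
apply/eqP; rewrite -subr_eq0 (qrel_aa ab_rel) odd_double.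
by have := qrel_bb ab_rel k.*2; rewrite odd_double addrC => ->.
Qed.

Lemma dd_A k : dd (A k) = 0.
Proof. by rewrite /dd a2A subrr scaler0. Qed.

Lemma b1A k : b 1%N * A k = A k * b 1%N + (b k.*2 + b k.*2).
Proof.
by have := qrel_ba ab_rel k.*2; rewrite odd_double => <-; rewrite addrC subrK.
Qed.

(** The relation for [a_2, b_s], solved for b_(s+1), reads b_(s+1) = - dd b_s for odd s and b_(s+1)
    = a_s b_1 + b_s - dd b_s for even s; [dd] passes through the [A i], which it kills. *)
Lemma b_AE k : b k.*2.+1 = \sum_(i < k.+1) A i * etap (wpoly F ^+ (k - i)) /\
  b k.*2.+2 = - \sum_(i < k.+1) A i * etap ('X * wpoly F ^+ (k - i)).
Proof.
have ddA i X : dd (A i * X) = A i * dd X by rewrite ddM dd_A mul0r add0r.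
have even_of_odd m : b m.*2.+1 = \sum_(i < m.+1) A i * etap (wpoly F ^+ (m - i)) ->
    b m.*2.+2 = - \sum_(i < m.+1) A i * etap ('X * wpoly F ^+ (m - i)).
  move=> bm; rewrite (eq_bigr (fun i : 'I_m.+1 => dd (A i * etap (wpoly F ^+ (m - i))))).
    rewrite -linear_sum /= -bm /dd.
    rewrite (qrel_ab ab_rel) /= odd_double /=.
    have := qrel_ba ab_rel m.*2.+1; rewrite /= odd_double /= => /eqP.
    rewrite subr_eq0 => /eqP ->; rewrite addrK scalerN opprK half2 //.
  by move=> i _; rewrite etap_XM ddA.
elim: k => [|k [IHo IHe]]; last first.
  suff h : b k.+1.*2.+1 = \sum_(i < k.+2) A i * etap (wpoly F ^+ (k.+1 - i)).
    by split=> //; exact: even_of_odd.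
  have -> : b k.+1.*2.+1 = A k.+1 * b 1%N + b k.+1.*2 - dd (b k.+1.*2).
    rewrite /dd (qrel_ab ab_rel) /= odd_double /=.
    rewrite -/(A k.+1) b1A; set x := b k.+1.*2.+1; set y := A k.+1 * b 1%N; set z := b k.+1.*2.
    have -> : - (x + x) + y + (y + (z + z)) = (- x + y + z) + (- x + y + z).
      by non_commutative_ring.
    by rewrite half2; non_commutative_ring.
  rewrite doubleS IHe [RHS]big_ord_recr /= subnn expr0 etap1 -addrA addrC; congr (_ + _).
  rewrite [dd (- _)]linearN /= opprK [dd _]linear_sum /= -sumrN -big_split; apply: eq_bigr => i _ /=.
  rewrite ddA -etap_XM -mulrN -mulrDr subSn ?leq_ord // exprS /wpoly.
  by rewrite -linearN -linearD /=; congr (_ * plin _ _); ring.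
suff h : b 0.*2.+1 = \sum_(i < 1) A i * etap (wpoly F ^+ (0 - i)).
  by split=> //; exact: even_of_odd.
by rewrite big_ord1 expr0 etap1 /A (qrel_a0 ab_rel) mul1r.
Qed.

(** For p = 1 this is [b_1, a_2k] = 2 b_2k with b_2k expanded by [b_AE], which is the source of
    [gpoly]. Applying [dd] raises the power of X. *)
Lemma etap_A p k : etap p * A k = \sum_(i < k.+1) A i * etap (gpoly F (k - i) * p).
Proof.
move: p; apply: eq_poly_linear => [c p q|c p q|m].
- by rewrite linearP mulrDl -scalerAl.
- rewrite scaler_sumr -big_split; apply: eq_bigr => i _ /=.
  by rewrite mulrDr -scalerAr linearP mulrDr -scalerAr.
elim: m => [|m IHm].
  rewrite expr0 etap1 b1A; case: k => [|k].
    by rewrite big_ord1 /= mulr1 etap1 (qrel_b0 ab_rel) !addr0.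
  rewrite big_ord_recr /= subnn mulr1 etap1 addrC; congr (_ + _).
  rewrite doubleS (b_AE k).2 -opprD -big_split -sumrN; apply: eq_bigr => i _ /=.
  rewrite mulr1 subSn ?leq_ord //= -mulrDr -mulrN; congr (_ * _).
  by rewrite linearMn /= linearN mulr2n opprD.
rewrite exprS etap_XM.
have -> : dd (etap 'X^m) * A k = dd (etap 'X^m * A k) by rewrite ddM dd_A mulr0 addr0.
rewrite IHm linear_sum; apply: eq_bigr => i _ /=.
by rewrite ddM dd_A mul0r add0r -etap_XM mulrCA.
Qed.

Definition etac p q := etap p * etap q + etap q * etap p.

Lemma etacC p q : etac p q = etac q p. Proof. exact: addrC. Qed.

Lemma etac_A p q k : etac p q * A k =
  conv A (fun l => \sum_(j < l.+1) etac (gpoly F j * p) (gpoly F (l - j) * q)) k.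
Proof.
have two p' q' : etap p' * etap q' * A k =
    conv A (conv (fun j => etap (gpoly F j * p')) (fun j => etap (gpoly F j * q'))) k.
  rewrite -mulrA etap_A mulr_sumr convA; apply: eq_bigr => i _ /=.
  by rewrite mulrA etap_A.
rewrite /etac mulrDl !two /conv -big_split; apply: eq_bigr => i _ /=.
rewrite -mulrDr; congr (_ * _); rewrite big_split /=; congr (_ + _).
exact: (conv_rev (fun j => etap (gpoly F j * q)) (fun j => etap (gpoly F j * p))).
Qed.

Lemma b1b1_A k : b 1%N * b 1%N * A k = A k * (b 1%N * b 1%N).
Proof.
have := qrel_bb ab_rel k.*2; rewrite odd_double => h.
rewrite -mulrA b1A mulrDr mulrA b1A.
transitivity (A k * (b 1%N * b 1%N) + (b 1%N * b k.*2 + b k.*2 * b 1%N) +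
   (b 1%N * b k.*2 + b k.*2 * b 1%N)); first by non_commutative_ring.
by rewrite h !addr0.
Qed.

(** Since [etac 1 1] is twice the square of [b 1], it commutes with the series A, while [etac_A]
    inserts the factor g in both arguments. Comparing, A times the series of these sums beyond its
    constant term is 0, and A has constant term 1. *)
Lemma sum_etac_gpoly l : (0 < l)%N ->
  \sum_(j < l.+1) etac (gpoly F j) (gpoly F (l - j)) = 0.
Proof.
pose e l := \sum_(j < l.+1) etac (gpoly F j) (gpoly F (l - j)).
pose e' l := if l is 0%N then 0 else e l.
move=> l0; suff: e' l = 0 by rewrite /e'; case: (l) l0.
apply: (@conv_cancel_l _ A) => [|k]; first exact: (qrel_a0 ab_rel).
have e0 : e 0%N = etac 1 1 by rewrite /e big_ord1.
have h : etac 1 1 * A k = A k * etac 1 1.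
  by rewrite /etac etap1 mulrDl mulrDr b1b1_A.
move: h; rewrite etac_A.
under eq_conv => [? |l'] do [over | under eq_bigr => j _ do rewrite !mulr1; over].
rewrite -/e /conv !big_ord_recr /= subnn /= mulr0 addr0 e0 => /eqP.
rewrite -subr_eq0 addrK => /eqP h; rewrite -[RHS]h; apply: eq_bigr => i _.
by rewrite -/e /e' -(subnSK (ltn_ord i)).
Qed.

End Eta.

Arguments gpoly : simpl never.

(** * The anticommutators of [eta] and the elements C_m *)

Section EtaForm.
Variables (F : numFieldType) (R : algType F) (a b : nat -> R).
Hypothesis ab_rel : qrel a b.
#[local] Instance alg_ring_ops4 : @Ring_ops R 0 1 (fun x y => x + y) (fun x y => x * y)
  (fun x y => x - y) (fun x => - x) (@eq R) := nc_ring_ops R.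
#[local] Instance alg_ring4 : @Ring R _ _ _ _ _ _ _ alg_ring_ops4 := nc_ring R.

Local Notation et := (eta a b).
Local Notation etap := (plin (eta a b)).
Local Notation etac := (etac a b).
Let A k := a k.*2.
Let c i j := et i * et j + et j * et i.
Definition etaC m := c 0%N m.
Local Notation C := etaC.

(** The Hankel property up to total degree M. The induction raises M by two, since the odd degree in
    between needs the identity for g. *)
Let S M := forall i j, (i + j <= M)%N -> c i j = (-1) ^+ i *: C (i + j)%N.

Let cC i j : c i j = c j i. Proof. exact: addrC. Qed.

Let dd_c i j : dd a (c i j) = c i.+1 j + c i j.+1.
Proof. by rewrite linearD /= !ddM /c /=; non_commutative_ring. Qed.

Let S_odd M m : S M -> (m <= M)%N -> odd m -> C m = 0.
Proof.
move=> SM mM om; have := SM m 0%N; rewrite addn0 cC => /(_ mM).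
rewrite -/(C m) -signr_odd om expr1 scaleN1r => h.
by apply: eq_double; rewrite {1}h addNr addr0.
Qed.

Let etac_S M (p q : {poly F}) : S M -> (size p + size q <= M.+2)%N ->
  etac p q = plin C (pneg p * q).
Proof.
move=> SM sz; have sumE (r : {poly F}) : r = \sum_(i < size r) r`_i *: 'X^i by rewrite -poly_def coefK.
have -> : pneg p = \sum_(i < size p) (p`_i * (-1) ^+ i) *: 'X^i.
  rewrite {1}(sumE p) /pneg linear_sum; apply: eq_bigr => i _.
  by rewrite linearZ /= -/(pneg 'X^i) pnegXn scalerA.
rewrite [in RHS](sumE q) mulr_suml linear_sum /=.
rewrite /etac {1 2 3 4}/plin !mulr_suml.
under [X in X + _]eq_bigr => i _ do rewrite mulr_sumr.
under [X in _ + X]eq_bigr => i _ do rewrite mulr_sumr.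
rewrite [X in _ + X]exchange_big -big_split; apply: eq_bigr => i _ /=.
rewrite mulr_sumr linear_sum -big_split; apply: eq_bigr => j _ /=.
rewrite -!scalerAl -!scalerAr !linearZ /= -exprD plinXn !scalerA.
rewrite [q`_j * p`_i]mulrC -scalerDr -/(c i j) SM ?scalerA.
  by rewrite mulrAC.
by rewrite -2!ltnS (leq_trans _ sz) // -addSn -addnS leq_add.
Qed.

Let size_wpoly : size (wpoly F) = 3%N.
Proof. by rewrite size_polyDl size_polyXn // size_polyN size_polyX. Qed.

Let size_gpoly j : (size (gpoly F j) <= (if j is i.+1 then i.+1.*2 else 1))%N.
Proof.
case: j => [|i]; first by rewrite size_poly1.
rewrite /gpoly -scaler_nat (leq_trans (size_scale_leq _ _)) // size_polyN.
rewrite (leq_trans (size_polyMleq _ _)) // size_polyX /=.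
have := size_poly_exp_leq (wpoly F) i; rewrite size_wpoly.
by move: (size _) => x h; change (x.+1 <= i.+1.*2)%N; lia.
Qed.

(** In [sum_etac_gpoly] for l = k + 1 all inner terms have total degree at most 2k, where S applies,
    and the two outer ones both equal C(g), g = g_(k+1). Subtracting C of [sum_gpoly] leaves C(g(t)
    - g(-t)) = 0. The lower odd C_m vanish already, and the top coefficient is -4. *)
Let C_odd_step k : S k.*2 -> C k.*2.+1 = 0.
Proof.
move=> Sk; have := sum_etac_gpoly ab_rel (ltn0Sn k).
have := sum_gpoly F (ltn0Sn k).
rewrite big_ord_recl big_ord_recr /= subnn subn0 -[bump 0 k]/k.+1 mulr1 pneg1 mul1r => gE.
rewrite big_ord_recl big_ord_recr /= subnn subn0 -[bump 0 k]/k.+1 [etac _ 1]etacC.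
have cl q : etac 1 q = plin C q.
  move: q; apply: eq_poly_linear => [d p q|d p q|i].
  - by rewrite /etac linearP mulrDr mulrDl -scalerAl -scalerAr scalerDr addrACA.
  - exact: linearP.
  by rewrite /etac plinXn (etap1 a b) plinXn.
rewrite !cl.
rewrite (eq_bigr (fun i : 'I_k => plin C (pneg (gpoly F (bump 0 i)) * gpoly F (k.+1 - bump 0 i)))).
  rewrite -linear_sum /=; set mid := \sum_(i < k) _ in gE *; set g := gpoly F k.+1 in gE *.
  rewrite -!linearD /= => Cg.
  have {Cg gE mid} : plin C (g - pneg g) = 0.
    rewrite -[RHS]Cg; congr (plin C _); apply/eqP; rewrite -subr_eq0; apply/eqP.
    by rewrite -[RHS]oppr0 -gE; ring.
  have sg : (size (g - pneg g)%R <= k.+1.*2)%N.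
    rewrite (leq_trans (size_polyD _ _)) // size_polyN size_pneg maxnn.
    exact: (size_gpoly k.+1).
  rewrite (plinE _ sg) doubleS big_ord_recr /= big1 ?add0r.
    rewrite coefB coef_pneg exprS -signr_odd odd_double mulr1 mulN1r opprK.
    have -> : g`_k.*2.+1 = - 2.
      rewrite /g /gpoly coefMn coefN coefXM /=.
      have wm : wpoly F ^+ k \is monic.
        rewrite monic_exp // monicE /wpoly lead_coefDl ?lead_coefXn //.
        by rewrite size_polyN size_polyX size_polyXn.
      have -> : k.*2 = (size (wpoly F ^+ k)).-1.
        by rewrite size_exp size_wpoly mulnC muln2.
      by rewrite -lead_coefE (monicP wm) -mulNrn.
    move=> /eqP; rewrite scaler_eq0 -opprD oppr_eq0 -natrD pnatr_eq0 /=.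
    by move=> /eqP.
  move=> i _; have [oi|ei] := boolP (odd i).
    by rewrite (S_odd Sk) ?scaler0 // -ltnS.
  by rewrite coefB coef_pneg -signr_odd (negbTE ei) expr0 mul1r subrr scale0r.
move=> i _ /=; apply: (etac_S Sk).
have ik := ltn_ord i.
have -> : (k.+1 - bump 0 i = (k - i.+1).+1)%N by rewrite /bump /=; lia.
rewrite -[bump 0 i]/i.+1.
apply: leq_trans (leq_add (size_gpoly i.+1) (size_gpoly (k - i.+1).+1)) _.
by rewrite -doubleD -doubleS leq_double; lia.
Qed.

Let S_all M : S M.
Proof.
suff Sk k : S k.*2.
  by move=> i j ij; apply: (Sk M); rewrite (leq_trans ij) // -addnn leq_addr.
elim: k => [|k Sk].
  by move=> i j; rewrite leqn0 addn_eq0 => /andP[/eqP-> /eqP->]; rewrite expr0 scale1r.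
have C0 := C_odd_step Sk; set m := k.*2 in Sk C0.
have d0 : dd a (C m) = 0.
  (* Recursion along the antidiagonal of degree m + 1, starting from C_(m+1) = 0. Its other end is
     C_(m+1) again by symmetry of [c], so a nonzero multiple of [dd a (C m)] is 0. *)
  have cE i : (i <= m.+1)%N -> c i (m.+1 - i)%N = - ((-1) ^+ i * i%:R) *: dd a (C m).
    elim: i => [_|i IH im]; first by rewrite subn0 mulr0 oppr0 scale0r -/(C _) C0.
    have := dd_c i (m - i)%N; rewrite Sk ?subnKC // linearZ /= => /eqP.
    rewrite -subr_eq subSS => /eqP <-.
    rewrite -subSn // IH ?(leq_trans _ im) // -scalerBl; congr (_ *: _).
    by rewrite exprS -natr1; ring.
  have := cE m.+1 (leqnn _); rewrite subnn cC -/(C _) C0 => /esym/eqP.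
  rewrite scaler_eq0 oppr_eq0 mulf_eq0 signr_eq0 pnatr_eq0 /= => /eqP //.
have step n : S n -> dd a (C n) = 0 -> S n.+1.
  move=> Sn dn i j; rewrite leq_eqVlt => /orP[/eqP ij|]; last by rewrite ltnS; exact: Sn.
  elim: i j ij => [|i IH] j ij; first by rewrite expr0 scale1r.
  have := dd_c i j; rewrite Sn; last by lia.
  have -> : (i + j = n)%N by lia.
  rewrite linearZ /= dn scaler0 => /esym/eqP; rewrite addr_eq0 => /eqP ->.
  by rewrite IH -?addSnnS // exprS mulN1r scaleNr.
have Sm1 := step _ Sk d0; rewrite doubleS; apply: step => //.
by rewrite C0 linear0.
Qed.

Lemma etacE p q : etac p q = plin C (pneg p * q).
Proof. by apply: (@etac_S (size p + size q)%N p q); [exact: S_all | rewrite leqW]. Qed.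

Lemma etaC_odd m : odd m -> C m = 0.
Proof. by apply: (@S_odd m m); first exact: S_all. Qed.

Lemma dd_etaC m : dd a (C m) = 0.
Proof.
have := dd_c 0 m; rewrite (@S_all m.+1 1 m) // (@S_all m.+1 0 m.+1) //.
by rewrite expr1 expr0 scaleN1r scale1r add1n add0n addNr.
Qed.

(** The commutator of C_m with eta_0 equals that of eta_m with eta_0^2. Both this and the step from
    eta_i to eta_(i+1) follow by applying [dd], which kills eta_0^2 and C_m. *)
Lemma etaC_eta m i : C m * et i = et i * C m.
Proof.
have e0 j : et 0%N * et 0%N * et j = et j * (et 0%N * et 0%N).
  elim: j => [|j IH]; first by rewrite mulrA.
  have d0 : dd a (et 0%N * et 0%N) = 0.
    have := dd_etaC 0; rewrite /etaC /c linearD /= => h.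
    by apply: eq_double; rewrite h addr0.
  by have := congr1 (dd a) IH; rewrite !(ddM a) -ddM d0 mul0r mulr0 add0r addr0.
elim: i => [|i IH]; last first.
  by have := congr1 (dd a) IH; rewrite !ddM dd_etaC mul0r mulr0 add0r addr0.
apply: eq_double; rewrite /etaC /c.
transitivity ((et 0%N * C m + et 0%N * C m) +
  (et m * (et 0%N * et 0%N) - et 0%N * et 0%N * et m) +
  (et m * (et 0%N * et 0%N) - et 0%N * et 0%N * et m)).
  by rewrite /etaC /c; non_commutative_ring.
by rewrite e0 subrr !addr0.
Qed.

(** Moving A past C(t^m) multiplies t^m by g(-t) g(t) = 1. *)
Lemma etaC_A m k : C m * a k.*2 = a k.*2 * C m.
Proof.
have -> : C m = etac 1 'X^m by rewrite /etac plinXn -(expr0 'X) plinXn.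
rewrite etac_A // /conv big_ord_recr /= subnn big_ord1 /= !mul1r.
rewrite big1 ?add0r // => i _.
rewrite (eq_bigr (fun j : 'I_(k - i).+1 =>
   plin C (pneg (gpoly F j) * gpoly F (k - i - j) * 'X^m))).
  by rewrite -linear_sum -mulr_suml sum_gpoly ?subn_gt0 // mul0r linear0 mulr0.
by move=> j _; rewrite etacE mulr1 mulrA.
Qed.

End EtaForm.

(** * Even functionals on F[t] with nonzero radical *)

Section CyclicForm.
Variables (F : numFieldType) (gam : {poly F} -> F) (chi : {poly F}).
Hypothesis gam_linear : forall c p q, gam (c *: p + q) = c * gam p + gam q.
Hypothesis gam_even : forall p, gam (pneg p) = gam p.
Hypothesis chi_monic : chi \is monic.
Hypothesis chiP : forall p, chi %| p <-> (forall q, gam (p * q) = 0).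

Implicit Types p q r : {poly F}.

Let n := (size chi).-1.
Let size_chi : size chi = n.+1.
Proof. by rewrite /n prednK // lt0n size_poly_eq0 monic_neq0. Qed.

Let gam0 : gam 0 = 0.
Proof. by have := gam_linear (-1) 0 0; rewrite scaler0 addr0 mulN1r addNr. Qed.
Let gamD p q : gam (p + q) = gam p + gam q.
Proof. by have := gam_linear 1 p q; rewrite scale1r mul1r. Qed.
Let gamZ c p : gam (c *: p) = c * gam p.
Proof. by have := gam_linear c p 0; rewrite gam0 !addr0. Qed.

(** The coefficient of 1/t in the expansion of r / chi at infinity; its pairing (p, q) -> lam(pq) is
    nondegenerate on F[t] / chi. *)
Let lam (r : {poly F}) : F := (r %% chi)`_n.-1.
Let lamD p q : lam (p + q) = lam p + lam q. Proof. by rewrite /lam modpD coefD. Qed.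
Let lamZ c p : lam (c *: p) = c * lam p. Proof. by rewrite /lam modpZl coefZ. Qed.
Let lam_sum I (r : seq I) (f : I -> {poly F}) : lam (\sum_(i <- r) f i) = \sum_(i <- r) lam (f i).
Proof.
by elim: r => [|i r IH]; rewrite ?big_nil ?big_cons ?lamD ?IH // /lam mod0p coef0.
Qed.
Let gam_sum I (r : seq I) (f : I -> {poly F}) : gam (\sum_(i <- r) f i) = \sum_(i <- r) gam (f i).
Proof. by elim: r => [|i r IH]; rewrite ?big_nil ?big_cons ?gamD ?IH. Qed.

Let lam_dvd p : chi %| p -> lam p = 0.
Proof. by rewrite /lam => /modp_eq0P ->; rewrite coef0. Qed.
Let gam_dvd p : chi %| p -> gam p = 0.
Proof. by move=> /chiP /(_ 1); rewrite mulr1. Qed.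
Let lam_small p : (size p <= n)%N -> lam p = p`_n.-1.
Proof. by move=> sp; rewrite /lam modp_small // size_chi ltnS. Qed.
Let lam_eq p q r : p - q = chi * r -> lam p = lam q.
Proof.
by move=> pq; rewrite -[p](subrK q) pq lamD lam_dvd ?add0r // dvdp_mulr.
Qed.
Let gam_eq p q r : p - q = chi * r -> gam p = gam q.
Proof.
by move=> pq; rewrite -[p](subrK q) pq gamD gam_dvd ?add0r // dvdp_mulr.
Qed.

Lemma pneg_chi : pneg chi = (-1) ^+ n *: chi.
Proof.
have dv : chi %| pneg chi.
  apply/chiP => q; rewrite -[q]pnegK -pnegM gam_even; apply/gam_dvd/dvdp_mulr/dvdpp.
have /eqpf_eq[c _ cE] : pneg chi %= chi.
  by rewrite eqp_sym -dvdp_size_eqp // size_pneg.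
rewrite cE; congr (_ *: _); have := congr1 (fun p : {poly F} => p`_n) cE.
rewrite coefZ coef_pneg (_ : chi`_n = 1) ?mulr1 //.
by move/monicP: chi_monic; rewrite lead_coefE.
Qed.

Let lam_pneg p : (0 < n)%N -> lam (pneg p) = - (-1) ^+ n * lam p.
Proof.
move=> n0; rewrite [p in LHS](divp_eq p chi) pnegD pnegM pneg_chi -scalerAr.
rewrite lamD lamZ lam_dvd ?mulr0 ?add0r ?dvdp_mull //.
rewrite lam_small ?size_pneg; last by rewrite -ltnS -size_chi ltn_modp monic_neq0.
by rewrite coef_pneg; congr (_ * _); rewrite -[in RHS](prednK n0) exprS mulN1r opprK.
Qed.

Let lam_inj p : (size p <= n)%N -> (forall r, lam (p * r) = 0) -> p = 0.
Proof.
move=> sp lp; apply/eqP/negPn/negP => p0.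
have sp0 : (0 < size p)%N by rewrite lt0n size_poly_eq0.
have /eqP := lp 'X^(n - size p).
rewrite lam_small ?size_mulXn //; last by rewrite subnK.
rewrite coefMXn; have -> : (n.-1 < n - size p)%N = false by lia.
have -> : (n.-1 - (n - size p) = (size p).-1)%N by lia.
by rewrite -lead_coefE lead_coef_eq0 (negbTE p0).
Qed.

Let functionalE (f : {poly F} -> F) : (forall c p q, f (c *: p + q) = c * f p + f q) ->
  (forall q, f (chi * q) = 0) -> forall r, f r = \sum_(j < n) (r %% chi)`_j * f 'X^j.
Proof.
move=> fL fchi r; rewrite [r in LHS](divp_eq r chi).
rewrite [_ * chi]mulrC -[chi * _]scale1r fL fchi mulr0 add0r.
have f0 : f 0 = 0 by have := fchi 0; rewrite mulr0.
have : (size (r %% chi)%R <= n)%N by rewrite -ltnS -size_chi ltn_modp monic_neq0.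
move: (r %% chi) => {}r; rewrite -[r in f r]coefK => sr.
have -> : \poly_(i < size r) r`_i = \poly_(i < n) r`_i.
  apply/polyP => i; rewrite !coef_poly; case: ltnP => ri; first by rewrite (leq_trans ri sr).
  by rewrite nth_default ?if_same.
rewrite poly_def; elim: (n) => [|m IH]; first by rewrite !big_ord0.
by rewrite !big_ord_recr /= addrC fL IH addrC.
Qed.

(** The Hankel matrix of [lam] is invertible by [lam_inj], so every functional vanishing on the
    multiples of chi is lam(P r) for some P. *)
Let lam_repr : exists2 P : {poly F}, (size P <= n)%N & forall r, gam r = lam (P * r).
Proof.
pose H : 'M[F]_n := \matrix_(i, j) lam ('X^i * 'X^j).
have HE (v : 'rV_n) j : (v *m H) 0 j = lam (rVpoly v * 'X^j).
  rewrite mxE /rVpoly poly_def mulr_suml lam_sum; apply: eq_bigr => i _.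
  by rewrite mxE valK -scalerAl lamZ.
have lamE p r : lam (p * r) = \sum_(j < n) (r %% chi)`_j * lam (p * 'X^j).
  apply: (functionalE (f := fun r => lam (p * r))) => [c q q'|q].
    by rewrite mulrDr -scalerAr lamD lamZ.
  by rewrite mulrCA lam_dvd // dvdp_mulr.
have Hu : H \in unitmx.
  rewrite -row_free_unit -kermx_eq0; apply/rowV0P => v /sub_kermxP vH.
  have v0 : rVpoly v = 0.
    apply: lam_inj; first exact: size_poly.
    by move=> r; rewrite lamE big1 // => j _; rewrite -HE vH mxE mulr0.
  by rewrite -[v]rVpolyK v0 linear0.
pose g := \row_(j < n) gam 'X^j; pose v := g *m invmx H.
exists (rVpoly v); first exact: size_poly.
move=> r; rewrite lamE (functionalE gam_linear).
  by apply: eq_bigr => j _; rewrite -HE /v mulmxKV // mxE.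
by move=> q; rewrite gam_dvd // dvdp_mulr.
Qed.

(** With gam(r) = lam(P r), evenness of gam fixes the parity of P opposite to that of chi. Hence N =
    chi + P/2 is carried by t -> -t to chi - P/2 up to sign. A common factor d of chi and P would
    put chi / d into the radical, so chi is coprime to P and to N. *)
Lemma cyclic_form_repr : exists N : {poly F}, [/\ N \is monic, size N = size chi, coprimep chi N,
  pneg N = (-1) ^+ n *: (chi *+ 2 - N) & forall r, gam r = 2 * lam (N * r)].
Proof.
have [P sP gP] := lam_repr; pose N := chi + 2^-1 *: P; exists N.
have s2P : (size (2^-1 *: P) < size chi)%N.
  by rewrite (leq_ltn_trans (size_scale_leq _ _)) // size_chi ltnS.
have half (p : {poly F}) : (2^-1 *: p) *+ 2 = p.
  by rewrite -scaler_nat scalerA mulfV ?scale1r ?pnatr_eq0.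
have pnegP : pneg P = - (-1) ^+ n *: P.
  have [n0|n0] := posnP n.
    have P0 : P = 0 by apply/eqP; rewrite -size_poly_eq0 -leqn0 -n0.
    by rewrite P0 scaler0 /pneg comp_poly0.
  apply/eqP; rewrite -subr_eq0; apply/eqP; apply: lam_inj.
    rewrite (leq_trans (size_polyD _ _)) // geq_max size_pneg sP size_polyN.
    by rewrite (leq_trans (size_scale_leq _ _)).
  move=> r; rewrite mulrBl -scalerAl -scaleNr lamD lamZ -gP -[r in pneg P * r]pnegK -pnegM.
  by rewrite lam_pneg // -gP gam_even; ring.
split.
- by rewrite monicE lead_coefDl // (monicP chi_monic).
- by rewrite size_polyDl.
- suff cP : coprimep chi P.
    move/Bezout_eq1_coprimepP: cP => [[u1 u2] /= uE].
    apply/Bezout_eq1_coprimepP; exists (u1 - u2 *+ 2, u2 *+ 2) => /=.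
    by rewrite -uE -[in RHS](half P) /N; set Q := 2^-1 *: P; ring.
  set d := gcdp chi P.
  have [e eE] : exists e, chi = e * d by apply/dvdpP/dvdp_gcdl.
  have [P' PE] : exists P', P = P' * d by apply/dvdpP/dvdp_gcdr.
  have d0 : d != 0 by rewrite gcdp_eq0 (negbTE (monic_neq0 chi_monic)).
  have e0 : e != 0 by apply: contraTneq (monic_neq0 chi_monic) => e0; rewrite eE e0 mul0r eqxx.
  have : chi %| e.
    apply/chiP => q; rewrite gP PE lam_dvd //.
    by rewrite (_ : P' * d * (e * q) = chi * (P' * q)) ?dvdp_mulr // eE; ring.
  move=> /(dvdp_leq e0); rewrite {1}eE size_mul // coprimep_def -/d.
  have : (0 < size d)%N by rewrite lt0n size_poly_eq0.
  have : (0 < size e)%N by rewrite lt0n size_poly_eq0.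
  by lia.
- rewrite /N pnegD pneg_chi pnegZ pnegP scalerA mulrC mulNr scaleNr -scalerA -scalerBr.
  by congr (_ *: _); set Q := 2^-1 *: P; ring.
- have lam2 q : lam (q *+ 2) = 2 * lam q by rewrite mulr2n lamD mulr_natl mulr2n.
  move=> r; rewrite gP -[P in LHS]half [_ *+ 2 * r]mulrnAl lam2; congr (_ * _).
  by apply: (@lam_eq _ _ (- r)); rewrite /N; set Q := 2^-1 *: P; ring.
Qed.

(** * An orthogonal frame from the roots of N *)

Section Frame.
Variables (N : {poly F}) (m : nat) (s : 'I_m -> F).
Hypothesis size_N : size N = size chi.
Hypothesis coprime_N : coprimep chi N.
Hypothesis pneg_N : pneg N = (-1) ^+ n *: (chi *+ 2 - N).
Hypothesis gamN : forall r, gam r = 2 * lam (N * r).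
Hypothesis NE : N = \prod_(i < m) ('X + (s i)%:P).

Let lf (e : bool) (i : 'I_m) : {poly F} := 'X + ((-1) ^+ e * s i)%:P.
Let size_lf e i : size (lf e i) = 2%N. Proof. exact: size_XaddC. Qed.
Let lf_monic e i : lf e i \is monic. Proof. exact: monicXaddC. Qed.
Let size_prod_lf (P : pred 'I_m) e : size (\prod_(i | P i) lf (e i) i) = #|P|.+1.
Proof.
rewrite size_prod => [|i _]; last exact: monic_neq0.
under eq_bigr => i _ do rewrite size_lf.
by rewrite sum_nat_const -/(#|P|); lia.
Qed.
Let monic_prod_lf (P : pred 'I_m) e : \prod_(i | P i) lf (e i) i \is monic.
Proof. by apply: monic_prod => i _; exact: lf_monic. Qed.

Let NlfE : N = \prod_i lf false i.
Proof. by rewrite NE; apply: eq_bigr => i _; rewrite /lf mul1r. Qed.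
Let mn : m = n.
Proof.
by apply: succn_inj; rewrite -size_chi -size_N NlfE (size_prod_lf xpredT (fun=> false)) card_ord.
Qed.
Let pneg_lf e i : pneg (lf e i) = - lf (~~ e) i.
Proof.
rewrite /lf pnegD pnegX /pneg comp_polyC opprD -polyCN.
by case: e; rewrite ?expr1 ?expr0 ?mulN1r ?mul1r ?opprK.
Qed.
Let pneg_prod_lf (P : pred 'I_m) e :
  pneg (\prod_(i | P i) lf (e i) i) = (-1) ^+ #|P| *: \prod_(i | P i) lf (~~ e i) i.
Proof.
rewrite /pneg rmorph_prod /=.
rewrite (eq_bigr (fun i => (-1)%:P * lf (~~ e i) i)) => [|i _]; last first.
  by rewrite -/(pneg _) pneg_lf polyCN mulN1r.
by rewrite big_split /= prodr_const -rmorphXn /= mul_polyC.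
Qed.
Let Ns := \prod_i lf true i.
Let NNs : N + Ns = chi *+ 2.
Proof.
have := pneg_N; rewrite -mn {1}NlfE (pneg_prod_lf xpredT (fun=> false)) cardE size_enum_ord.
move=> /(congr1 ( *:%R ((-1) ^+ m))); rewrite !scalerA -expr2 sqrr_sign !scale1r => h.
by rewrite [Ns]h; ring.
Qed.
(** A common root would be a root of N + Ns = 2 chi, which is coprime to N. Regularity and
    typicality both come from this. *)
Let no_common_root x : root N x -> ~~ root Ns x.
Proof.
move=> Nx; apply/negP => Nsx; have := coprimep_root coprime_N (x := x).
suff cx : root chi x by move=> /(_ cx) /negP; apply.
move: Nx Nsx; rewrite !rootE => /eqP Nx /eqP Nsx; have := congr1 (horner^~ x) NNs.
by rewrite hornerD Nx Nsx addr0 hornerMn => /esym/eqP; rewrite mulrn_eq0.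
Qed.
Let root_prod_lf e i : root (\prod_i lf e i) (- ((-1) ^+ e * s i)).
Proof.
by rewrite (bigD1 i) //= rootM /lf -[X in 'X + X%:P]opprK polyCN root_XsubC eqxx.
Qed.

Lemma frame_regular i : s i != 0.
Proof.
apply/eqP => si0; have := root_prod_lf false i; rewrite -NlfE si0 mulr0 => /no_common_root /negP; apply.
by have := root_prod_lf true i; rewrite si0 mulr0.
Qed.

Lemma frame_typical i j : s i + s j != 0.
Proof.
apply/eqP => sij; have := root_prod_lf false i; rewrite -NlfE mul1r => /no_common_root /negP; apply.
have := root_prod_lf true j; rewrite expr1 mulN1r opprK.
by have -> : s j = - s i by apply/eqP; rewrite -addr_eq0 addrC sij.
Qed.

(** For xi_k = eta(p_k) the three clauses say that [b 1] is minus the sum of the xi_k, that the xi_k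
    satisfy the Clifford relations, and that [dd] acts on them as it does on V(s). *)
Lemma frame_poly : exists p : 'I_m -> {poly F},
  [/\ chi %| \sum_i p i + 1,
      forall k l, gam (pneg (p k) * p l) = if k == l then 2 * s k else 0
    & forall k, chi %| 'X * p k + s k *: (\sum_(i < m | (i < k)%N) p i - \sum_(i < m | (k < i)%N) p i)].
Proof.
(* Modulo chi, [u] inverts N; as N + Ns = 2 chi, the product [u * Ns] is -1 there. *)
have /Bezout_eq1_coprimepP[[v u] /= uE] := coprime_N.
have uN : u * N = 1 - v * chi by rewrite -uE; ring.
pose tau k := \prod_(i < m) lf (i < k)%N i.
pose Q (k : 'I_m) := \prod_(i < m | i != k) lf (i < k)%N i.
have tauS (k : 'I_m) : tau k.+1 = ('X - (s k)%:P) * Q k.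
  rewrite /tau (bigD1 k) //= ltnSn {1}/lf expr1 mulN1r polyCN; congr (_ * _).
  by apply: eq_bigr => i ik; rewrite ltnS leq_eqVlt val_eqE (negbTE ik).
have tau0 (k : 'I_m) : tau k = ('X + (s k)%:P) * Q k.
  by rewrite /tau (bigD1 k) //= ltnn {1}/lf expr0 mul1r.
(* Chosen so that 2 p_k = u (tau_(k+1) - tau_k): sums of the p_k telescope between tau_0 = N and
   tau_m = Ns. *)
pose p k := - s k *: (u * Q k).
have pE k : p k *+ 2 = u * (tau k.+1 - tau k).
  by rewrite /p tauS tau0 -mul_polyC polyCN; ring.
have psum_l k : (k <= m)%N -> (\sum_(i < m | (i < k)%N) p i) *+ 2 = u * (tau k - tau 0%N).
  elim: k => [_|k IH km]; first by rewrite big_pred0_eq subrr mulr0 mul0rn.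
  rewrite (bigD1 (Ordinal km)) //= (eq_bigl (fun i : 'I_m => (i < k)%N)); last first.
    by move=> i; rewrite ltnS (leq_eqVlt i) -val_eqE /=; case: ltngtP.
  by rewrite mulrnDl IH ?(ltnW km) // pE /=; ring.
have tm : tau m = Ns by apply: eq_bigr => i _; rewrite ltn_ord.
have t0 : tau 0%N = N by rewrite NlfE.
have psum : (\sum_i p i) *+ 2 = u * (Ns - N).
  rewrite -tm -t0 -psum_l //; congr (_ *+ 2); apply: eq_bigl => i; by rewrite ltn_ord.
have NsE : Ns = chi *+ 2 - N by rewrite -NNs; ring.
have dvd2 q : chi %| q *+ 2 -> chi %| q.
  by rewrite -scaler_nat dvdpZr ?pnatr_eq0.
exists p; split=> [|k l|k].
- apply: dvd2; rewrite mulrnDl psum NsE.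
  have -> : u * (chi *+ 2 - N - N) + 1 *+ 2 = chi * (u *+ 2 + v *+ 2).
    transitivity (chi * u *+ 2 - (u * N) *+ 2 + 1 *+ 2); first by ring.
    by rewrite uN; ring.
  exact/dvdp_mulr/dvdpp.
- have n0 : (0 < n)%N by rewrite -mn; case: (m) k => [[]|].
  pose sg : F := (-1) ^+ n; have sg2 : sg * sg = 1 by rewrite -expr2 sqrr_sign.
  pose Qs := \prod_(i | i != k) lf (~~ (i < k)%N) i.
  have pnQ : pneg (Q k) = - sg *: Qs.
    rewrite /Q (pneg_prod_lf [pred i | i != k]) cardC1 card_ord; congr (_ *: _).
    by rewrite mn /sg -{2}(prednK n0) exprS mulN1r opprK.
  have pnp : pneg (p k) = (s k * sg) *: (pneg u * Qs).
    by rewrite /p pnegZ pnegM pnQ -scalerAr scalerA mulrNN.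
  have pnu : pneg u * Ns = sg%:P - pneg v * chi.
    have := congr1 (@pneg F) uN; rewrite pnegM pneg_N -NsE.
    rewrite (_ : pneg (1 - v * chi) = 1 - sg *: (pneg v * chi)); last first.
      by rewrite pnegD pneg1 -scaleN1r pnegZ pnegM pneg_chi scaleN1r -scalerAr.
    move=> /(congr1 ( *:%R sg)); rewrite -scalerAr !scalerA sg2 scale1r => ->.
    by rewrite scalerBr scalerA sg2 scale1r -mul_polyC mulr1.
  (* Modulo chi, N is -Ns and [pneg u * Ns] is the sign [sg], so one of the two inverses
     disappears. *)
  have -> : gam (pneg (p k) * p l) = 2 * (s k * s l * lam (u * (Qs * Q l))).
    rewrite gamN; congr (_ * _); rewrite pnp /p -!scalerAl -!scalerAr !lamZ.
    have -> : lam (N * (pneg u * Qs * (u * Q l))) = lam (- sg *: (u * (Qs * Q l))).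
      apply: (@lam_eq _ _ ((pneg u *+ 2 + pneg v) * (u * (Qs * Q l)))).
      have -> : N = chi *+ 2 - Ns by rewrite NsE; ring.
      rewrite -mul_polyC polyCN.
      transitivity (chi * pneg u * (u * (Qs * Q l)) *+ 2 - pneg u * Ns * (u * (Qs * Q l))
         + sg%:P * (u * (Qs * Q l))); first by ring.
      by rewrite pnu; ring.
    rewrite lamZ; transitivity (s k * s l * (sg * sg) * lam (u * (Qs * Q l))); first by ring.
    by rewrite sg2 mulr1.
  have uNs : u * Ns = chi * (u *+ 2 + v) - 1.
    by rewrite NsE; transitivity (chi * u *+ 2 - u * N); [ring|rewrite uN; ring].
  case: eqVneq => [<-{l}|kl].
    (* From u N = 1 and u Ns = -1 modulo chi, 2 s_k u M Ms is M + Ms, a sum of two monic polynomials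
       of degree n - 1, on which [lam] is 2. *)
    pose M := \prod_(i | i != k) lf false i; pose Ms := \prod_(i | i != k) lf true i.
    have QQ : Qs * Q k = M * Ms.
      rewrite /Qs /Q /M /Ms -!big_split; apply: eq_bigr => i _ /=.
      by case: (i < k)%N => //=; rewrite mulrC.
    have N_M : N = ('X + (s k)%:P) * M by rewrite NlfE (bigD1 k) //= {1}/lf mul1r.
    have Ns_M : Ns = ('X - (s k)%:P) * Ms.
      by rewrite /Ns (bigD1 k) //= {1}/lf expr1 mulN1r polyCN.
    have szM e : size (\prod_(i | i != k) lf e i) = n.
      by rewrite (size_prod_lf [pred i | i != k]) cardC1 card_ord mn prednK.
    have : lam ((s k *+ 2) *: (u * (M * Ms))) = lam (M + Ms).
      apply: (@lam_eq _ _ (- (v * Ms + u * M *+ 2 + v * M))).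
      rewrite -mul_polyC polyCMn; transitivity (Ms * (u * (('X + (s k)%:P) * M)) -
        M * (u * (('X - (s k)%:P) * Ms)) - (M + Ms)); first by ring.
      by rewrite -N_M -Ns_M uN uNs; ring.
    rewrite lamZ (@lam_small (M + Ms)); last first.
      by rewrite (leq_trans (size_polyD _ _)) // geq_max !szM leqnn.
    have lc e : (\prod_(i | i != k) lf e i)`_n.-1 = 1.
      by rewrite -(szM e) -lead_coefE; apply/monicP/(monic_prod_lf [pred i | i != k]).
    rewrite coefD !lc QQ => h; transitivity (s k * ((s k *+ 2) * lam (u * (M * Ms)))).
      by ring.
    by rewrite h; ring.
  (* For distinct k and l the product contains all factors of Ns (k < l) or of N (l < k).
     Multiplication by u turns these into a sign modulo chi, and the remaining H has degree at most
     n - 2. *)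
  suff -> : lam (u * (Qs * Q l)) = 0 by rewrite !mulr0.
  pose e := (k < l)%N; pose h (i : 'I_m) := ~~ (i < k)%N (+) (i < l)%N (+) e.
  pose H := \prod_(i | (i != k) && (i != l)) lf (h i) i.
  have kl' : (k != l :> nat) by [].
  have QQ : Qs * Q l = \prod_i lf e i * H.
    rewrite /Qs /Q (bigD1 l) 1?eq_sym //= [X in _ * X](bigD1 k) //=.
    have -> : (~~ (l < k)%N) = e by rewrite /e; move: kl'; case: ltngtP.
    rewrite -/e (eq_bigl (fun i => (i != k) && (i != l))
      (fun i => lf (i < l)%N i)) => [|i]; last by rewrite andbC.
    set A1 := \prod_(i | _) _; set A2 := \prod_(i | _) _.
    have PE : \prod_i lf e i = lf e k * (lf e l * \prod_(i | (i != k) && (i != l)) lf e i).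
      by rewrite (bigD1 k) //= (bigD1 l) 1?eq_sym.
    have AA : A1 * A2 = \prod_(i | (i != k) && (i != l)) lf e i * H.
      rewrite /A1 /A2 /H -!big_split; apply: eq_bigr => i /andP[ik il] /=.
      have ik' : (i != k :> nat) by [].
      have il' : (i != l :> nat) by [].
      rewrite /h /e; move: kl' ik' il'.
      case: (ltngtP i k); case: (ltngtP i l); case: (ltngtP k l) => //= *;
        rewrite // mulrC //; lia.
    by rewrite PE; transitivity (lf e l * lf e k * (A1 * A2)); [|rewrite AA]; ring.
  have szH : (size H <= n.-1)%N.
    rewrite /H (size_prod_lf [pred i | (i != k) && (i != l)]) -mn.
    have := cardC1 k; rewrite card_ord => <-; apply/proper_card/properP.
    split; first by apply/subsetP => i; rewrite !inE => /andP[].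
    by exists l; rewrite !inE ?eqxx ?andbF // eq_sym.
  have lamH : lam H = 0.
    rewrite lam_small ?(leq_trans szH) ?leq_pred // nth_default //.
  rewrite QQ /e; case: (k < l)%N.
    rewrite -/Ns (@lam_eq _ (-1 *: H) (H * (u *+ 2 + v))) ?lamZ ?lamH ?mulr0 //.
    by rewrite (mulrA u) uNs scaleN1r; ring.
  rewrite -NlfE (@lam_eq _ H (- H * v)) ?lamH //.
  by rewrite (mulrA u) uN; ring.
(* The doubled expression becomes a multiple of chi because tau_k + tau_(k+1) = 2 X Q_k and N + Ns =
   2 chi. *)
apply: dvd2; have := psum; rewrite (bigID (fun i : 'I_m => (i < k.+1)%N)) /= mulrnDl.
rewrite (psum_l k.+1) // (eq_bigl (fun i : 'I_m => (k < i)%N)) => [|i]; last by rewrite -leqNgt.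
move=> h; rewrite mulrnDl -mulrnAr pE scalerMnr mulrnBl (psum_l k) ?(ltnW (ltn_ord k)) //.
have -> : (\sum_(i < m | (k < i)%N) p i) *+ 2 = u * (Ns - N) - u * (tau k.+1 - tau 0%N).
  by rewrite -h; ring.
rewrite t0 NsE tau0 tauS -mul_polyC.
set T := (X in chi %| X).
have -> : T = chi * (- (s k)%:P * u *+ 2) by rewrite /T; ring.
exact/dvdp_mulr/dvdpp.
Qed.

End Frame.
End CyclicForm.

(** * Two systems with the same [eta] *)

Lemma sum_even_terms (V : zmodType) k (G : nat -> V) :
  (forall i, (i <= k.*2)%N -> odd i -> G i = 0) ->
  \sum_(i < k.*2.+1) G i = \sum_(i < k.+1) G i.*2.
Proof.
elim: k => [|k IH] G0; first by rewrite !big_ord1.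
have {}IH := IH (fun i ik => G0 i (leqW (leqW ik))).
by rewrite doubleS 2!big_ord_recr IH /= [RHS]big_ord_recr /= (G0 k.*2.+1) ?addr0 //= odd_double.
Qed.

Lemma sum_odd_terms (V : zmodType) k (G : nat -> V) :
  (forall i, (i <= k.*2.+1)%N -> ~~ odd i -> G i = 0) ->
  \sum_(i < k.*2.+2) G i = \sum_(i < k.+1) G i.*2.+1.
Proof.
elim: k => [|k IH] G0.
  by rewrite big_ord_recr !big_ord1 /= G0 // add0r.
have {}IH := IH (fun i ik => G0 i (leqW (leqW ik))).
rewrite doubleS 2!big_ord_recr IH /= [RHS]big_ord_recr /=.
by rewrite (G0 k.*2.+2) ?addr0 //= odd_double.
Qed.

(** The coefficients of the even series f(u); the constant term is 1 whatever [fc 0] is. *)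
Definition gcoef (F : pzRingType) (fc : nat -> F) (r : nat) : F :=
  if r == 0%N then 1 else if odd r then 0 else fc r./2.

Section Compare.
Variables (F : numFieldType) (R : algType F) (a b a' b' : nat -> R).
Hypotheses (rel : qrel a b) (rel' : qrel a' b').
Hypothesis eta_eq : forall i, eta a b i = eta a' b' i.

Let plin_eq p : plin (eta a b) p = plin (eta a' b') p.
Proof. by apply: eq_bigr => i _; rewrite eta_eq. Qed.

(** Here f is the right quotient of the two series A and A'. The formulas [b_AE] are linear over A,
    so the same f relates the odd series; and A and A' pass eta(p) with the same factor g, so f
    commutes with eta(p). *)
Lemma qrel_quotient : exists f : nat -> R,
  [/\ forall k, a k.*2 = conv f (fun i => a' i.*2) k,
      forall k, b k.*2.+1 = conv f (fun i => b' i.*2.+1) k,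
      forall k, b k.*2.+2 = conv f (fun i => b' i.*2.+2) k
    & forall k p, f k * plin (eta a b) p = plin (eta a b) p * f k].
Proof.
have [f fE] := @conv_divr R (fun k => a k.*2) (fun k => a' k.*2) (qrel_a0 rel').
exists f; split=> // k.
- rewrite (b_AE rel k).1 (_ : \sum_(i < _) _ = conv (conv f (fun k => a' k.*2))
    (fun j => plin (eta a' b') (wpoly F ^+ j)) k); last first.
    by apply: eq_bigr => i _; rewrite -fE plin_eq.
  by rewrite -convA; apply: eq_conv => // j; rewrite (b_AE rel' j).1.
- rewrite (b_AE rel k).2 (_ : \sum_(i < _) _ = conv (conv f (fun k => a' k.*2))
    (fun j => plin (eta a' b') ('X * wpoly F ^+ j)) k); last first.
    by apply: eq_bigr => i _; rewrite -fE plin_eq.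
  rewrite -convA -sumrN; apply: eq_bigr => j _.
  by rewrite (b_AE rel' _).2 mulrN.
move=> p; apply/eqP; rewrite -subr_eq0; apply/eqP; move: k.
apply: (@conv_cancel_r _ _ (fun k => a' k.*2)) => [|k]; first exact: (qrel_a0 rel').
pose g j := plin (eta a' b') (gpoly F j * p).
rewrite /conv; under eq_bigr => i _ do rewrite mulrBl -!mulrA (plin_eq p) (etap_A rel').
rewrite big_split sumrN -mulr_sumr /=.
rewrite (_ : \sum_(i < k.+1) f i * a' (k - i).*2 = a k.*2) ?fE // -(fE k).
rewrite -(plin_eq p) (etap_A rel); apply/eqP; rewrite subr_eq0; apply/eqP.
transitivity (conv f (conv (fun k => a' k.*2) g) k); first by [].
by rewrite convA; apply: eq_bigr => i _; rewrite -fE plin_eq.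
Qed.

Lemma qrel_scalar_quotient (f : nat -> R) (fc : nat -> F) :
  (forall k, a k.*2 = conv f (fun i => a' i.*2) k) ->
  (forall k, b k.*2.+1 = conv f (fun i => b' i.*2.+1) k) ->
  (forall k, b k.*2.+2 = conv f (fun i => b' i.*2.+2) k) ->
  (forall k, f k = (fc k)%:A) ->
  forall m, a m = \sum_(r < m.+1) gcoef fc (m - r) *: a' r /\
            b m = \sum_(r < m.+1) gcoef fc (m - r) *: b' r.
Proof.
move=> aE boE beE fE.
have fc0 : fc 0%N = 1.
  have := aE 0%N; rewrite /conv big_ord1 /= (qrel_a0 rel) (qrel_a0 rel') mulr1 fE.
  move=> h; have : (fc 0%N - 1) *: (1 : R) == 0 by rewrite scalerBl scale1r -h subrr.
  by rewrite scaler_eq0 oner_eq0 orbF subr_eq0 => /eqP.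
have gE j : gcoef fc j.*2 = fc j.
  by rewrite /gcoef double_eq0 odd_double doubleK; case: eqP => [->|].
have gO j : odd j -> gcoef fc j = 0 by rewrite /gcoef; case: j => //= j ->.
have cE g k : conv f g k = \sum_(i < k.+1) fc (k - i)%N *: g i.
  by rewrite conv_rev; apply: eq_bigr => i _; rewrite fE -scalerAl mul1r.
have bodd k : b k.*2.+1 = \sum_(r < k.*2.+2) gcoef fc (k.*2.+1 - r) *: b' r.
  rewrite (sum_odd_terms (k := k) (G := fun r => gcoef fc (k.*2.+1 - r) *: b' r)) => [|i ik oi].
    by rewrite boE cE; apply: eq_bigr => i _; rewrite subSS -doubleB gE.
  by rewrite gO ?scale0r // oddB //= odd_double (negbTE oi).
have beven k : b k.*2 = \sum_(r < k.*2.+1) gcoef fc (k.*2 - r) *: b' r.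
  rewrite (sum_even_terms (k := k) (G := fun r => gcoef fc (k.*2 - r) *: b' r)) => [|i ik oi].
    case: k => [|k]; first by rewrite big_ord1 (qrel_b0 rel) (qrel_b0 rel') scaler0.
    rewrite doubleS beE cE [RHS]big_ord_recl /= (qrel_b0 rel') scaler0 add0r.
    by apply: eq_bigr => i _; rewrite -[bump 0 i]/i.+1 doubleS !subSS -doubleB gE.
  by rewrite gO ?scale0r // oddB //= odd_double oi.
have aeven k : a k.*2 = \sum_(r < k.*2.+1) gcoef fc (k.*2 - r) *: a' r.
  rewrite (sum_even_terms (k := k) (G := fun r => gcoef fc (k.*2 - r) *: a' r)) => [|i ik oi].
    by rewrite aE cE; apply: eq_bigr => i _; rewrite -doubleB gE.
  by rewrite gO ?scale0r // oddB //= odd_double oi.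
have aodd k : a k.*2.+1 = \sum_(r < k.*2.+2) gcoef fc (k.*2.+1 - r) *: a' r.
  rewrite (sum_odd_terms (k := k) (G := fun r => gcoef fc (k.*2.+1 - r) *: a' r)) => [|i ik oi].
    (* An odd-indexed a_s is minus half the anticommutator of b_1 and b_s, and b_1 is common to both
       systems. *)
    apply: eq_double; apply: oppr_inj.
    have := qrel_bb rel k.*2.+1; rewrite /= odd_double /= => <-.
    have -> : b 1%N = b' 1%N := eta_eq 0.
    rewrite boE cE mulr_sumr mulr_suml -!big_split -sumrN.
    apply: eq_bigr => i _ /=; rewrite subSS -doubleB gE -scalerAl -scalerAr -scalerDr.
    have := qrel_bb rel' i.*2.+1; rewrite /= odd_double /= => ->.
    by rewrite scalerN scalerDr.
  by rewrite gO ?scale0r // oddB //= odd_double (negbTE oi).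
move=> m; rewrite -(odd_double_half m); case: (odd m); rewrite ?add1n ?add0n; split=> //.
Qed.

End Compare.

(** * The operators of V(s) *)

Section Pull.
Variables (F : numFieldType) (R : algType F) (I : eqType) (x : I -> F) (xi : I -> R).
Hypothesis xi2 : forall i, xi i * xi i = (x i)%:A.
Hypothesis xiC : forall i j, i != j -> xi i * xi j = - (xi j * xi i).
#[local] Instance alg_ring_ops6 : @Ring_ops R 0 1 (fun x y => x + y) (fun x y => x * y)
  (fun x y => x - y) (fun x => - x) (@eq R) := nc_ring_ops R.
#[local] Instance alg_ring6 : @Ring R _ _ _ _ _ _ _ alg_ring_ops6 := nc_ring R.

Fixpoint pullab (l : seq I) : (nat -> R) * (nat -> R) :=
  if l is i :: l' then
    let: (a, b) := pullab l' in (astep a b (x i)%:A (xi i), bstep a b (x i)%:A (xi i))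
  else (fun k => (k == 0%N)%:R, fun=> 0).
Definition pulla l := (pullab l).1.
Definition pullb l := (pullab l).2.

Lemma pulla_cons i l k : pulla (i :: l) k.+1 =
  pulla l k.+1 - x i *: pulla l k + asgn k.+1 (xi i * pullb l k).
Proof. by rewrite /pulla /pullb /=; case: (pullab l) => a b /=; rewrite -scalerAl mul1r. Qed.
Lemma pullb_cons i l k : pullb (i :: l) k.+1 =
  pullb l k.+1 - x i *: pullb l k + asgn k.+1 (xi i * pulla l k).
Proof. by rewrite /pulla /pullb /=; case: (pullab l) => a b /=; rewrite -scalerAl mul1r. Qed.
Lemma pulla0 l : pulla l 0%N = 1.
Proof. by elim: l => //= i l; rewrite /pulla /=; case: (pullab l). Qed.
Lemma pullb0 l : pullb l 0%N = 0.
Proof. by elim: l => //= i l; rewrite /pullb /=; case: (pullab l). Qed.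

(** Induction that tracks parity: P is inherited by the even operators, Q by the odd ones, and each
    [xi i] exchanges them. *)
Lemma pull_ind (P Q : R -> Prop) l :
  P 1 -> Q 0 -> P 0 -> (forall X Y, P X -> P Y -> P (X + Y)) -> (forall X Y, Q X -> Q Y -> Q (X + Y)) ->
  (forall c X, P X -> P (c *: X)) -> (forall c X, Q X -> Q (c *: X)) ->
  (forall i X, i \in l -> P X -> Q (xi i * X)) -> (forall i X, i \in l -> Q X -> P (xi i * X)) ->
  forall k, P (pulla l k) /\ Q (pullb l k).
Proof.
move=> P1 Q0 P0 PD QD PZ QZ; elim: l => [|i l IH] PQ QP k.
  by rewrite /pulla /pullb /=; split=> //; case: (k == 0%N).
have {}IH : forall k, P (pulla l k) /\ Q (pullb l k).
  apply: IH => j X jl; [apply: PQ|apply: QP]; by rewrite inE jl orbT.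
have il : i \in i :: l by rewrite inE eqxx.
case: k => [|k]; first by rewrite pulla0 pullb0.
rewrite pulla_cons pullb_cons -!scaleNr /asgn.
have [[Pa Qb] [Pa' Qb']] := (IH k, IH k.+1).
have h (S : R -> Prop) X : (forall c X, S X -> S (c *: X)) -> S X ->
    S (if odd k.+1 then - X else X).
  by move=> SZ SX; case: ifP => _ //; rewrite -scaleN1r; exact: SZ.
by split; [apply: (PD); [apply: PD => //; exact: PZ|apply: h => //; exact: QP]
          |apply: (QD); [apply: QD => //; exact: QZ|apply: h => //; exact: PQ]].
Qed.

Lemma pull_xi l j : j \notin l -> forall k,
  pulla l k * xi j = xi j * pulla l k /\ pullb l k * xi j = - (xi j * pullb l k).
Proof.
move=> jl; apply: (@pull_ind (fun X => X * xi j = xi j * X) (fun X => X * xi j = - (xi j * X))).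
- by rewrite mulr1 mul1r.
- by rewrite mulr0 mul0r oppr0.
- by rewrite mulr0 mul0r.
- by move=> X Y hX hY; rewrite mulrDl mulrDr hX hY.
- by move=> X Y hX hY; rewrite mulrDl mulrDr hX hY opprD.
- by move=> c X hX; rewrite -scalerAl -scalerAr hX.
- by move=> c X hX; rewrite -scalerAl -scalerAr hX scalerN.
- move=> i X il hX; rewrite -mulrA hX mulrA xiC ?mulNr ?mulrA //.
  by apply: contraNneq jl => <-.
- move=> i X il hX; rewrite -mulrA hX mulrN mulrA xiC ?mulNr ?opprK ?mulrA //.
  by apply: contraNneq jl => ->.
Qed.

Lemma pulla1 l : exists c, pulla l 1%N = c%:A.
Proof.
elim: l => [|i l [c IH]]; first by exists 0; rewrite /pulla scale0r.
exists (c - x i); rewrite pulla_cons IH pulla0 pullb0 mulr0 /asgn /= oppr0 addr0.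
by rewrite scalerBl.
Qed.

Lemma pullb1 l : pullb l 1%N = - \sum_(i <- l) xi i.
Proof.
elim: l => [|i l IH]; first by rewrite /pullb big_nil oppr0.
rewrite pullb_cons IH pulla0 pullb0 scaler0 subr0 /asgn /= mulr1 big_cons opprD addrC //.
Qed.

Lemma pull_qrel l : uniq l -> qrel (pulla l) (pullb l).
Proof.
elim: l => [_|i l IH /= /andP[il ul]].
  rewrite /pulla /pullb; split=> //= s; rewrite ?mulr0 ?mul0r ?subrr ?addr0 ?oppr0 ?if_same //.
  - by case: s => [|s]; rewrite /= ?addr0 ?oppr0 ?if_same.
  - by rewrite addr0.
  - by rewrite addr0.
have -> : pulla (i :: l) = astep (pulla l) (pullb l) (x i)%:A (xi i).
  by rewrite /pulla /pullb /=; case: (pullab l).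
have -> : pullb (i :: l) = bstep (pulla l) (pullb l) (x i)%:A (xi i).
  by rewrite /pulla /pullb /=; case: (pullab l).
have [c a1] := pulla1 l.
apply: qrel_step => // [s|s||s|s].
- exact: (pull_xi il s).1.
- exact: (pull_xi il s).2.
- exact: IH.
- by rewrite a1 -scalerAl -scalerAr mul1r mulr1.
- by rewrite a1 -scalerAl -scalerAr mul1r mulr1.
Qed.

(** The sum of the xi_j before k minus the sum of those after k, in the order of the list. *)
Fixpoint dseq (l : seq I) (k : I) : R :=
  if l is i :: l' then if i == k then - \sum_(j <- l') xi j else xi i + dseq l' k else 0.

Lemma pull_dd l k : uniq l -> k \in l -> dd (pulla l) (xi k) = - x k *: dseq l k.
Proof.
move=> ul kl; suff h : pulla l 2%N * xi k - xi k * pulla l 2%N = - (x k *: dseq l k + x k *: dseq l k).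
  by rewrite /dd h scalerN half2 scaleNr.
elim: l ul kl => // i l IH /= /andP[il ul] kl; have [c a1] := pulla1 l.
rewrite pulla_cons a1 /asgn /=; set A2 := pulla l 2%N; set Z := x i *: c%:A; set b1 := pullb l 1%N.
have Zc X : Z * X = X * Z by rewrite /Z -!scalerAl -!scalerAr mul1r mulr1.
case: eqVneq => [ik|ik].
  rewrite -ik in kl *; have [hA hb] := ((pull_xi il 2%N).1, (pull_xi il 1%N).2).
  transitivity ((A2 * xi i - xi i * A2) - (Z * xi i - xi i * Z) +
     (xi i * (b1 * xi i) - xi i * xi i * b1)); first by non_commutative_ring.
  rewrite hA hb Zc !subrr ?subr0 add0r mulrN mulrA xi2 -scalerAl mul1r -opprD.
  by rewrite /b1 pullb1.
have {}kl : k \in l by move: kl; rewrite inE eq_sym (negbTE ik).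
have bk : b1 * xi k + xi k * b1 = - ((x k)%:A + (x k)%:A).
  rewrite /b1 pullb1 (bigD1_seq k) //=; set S := \sum_(j <- l | _) _.
  have SC : S * xi k + xi k * S = 0.
    rewrite mulr_suml mulr_sumr -big_split big1 //= => j jk.
    by rewrite xiC // addNr.
  transitivity (- (xi k * xi k + xi k * xi k) - (S * xi k + xi k * S)).
    by non_commutative_ring.
  by rewrite SC xi2 subr0.
transitivity ((A2 * xi k - xi k * A2) - (Z * xi k - xi k * Z) +
   (xi i * (b1 * xi k + xi k * b1) - (xi i * xi k + xi k * xi i) * b1)).
  by non_commutative_ring.
rewrite IH // Zc subrr subr0 bk (xiC ik) addNr mul0r subr0 mulrN mulrDr -scalerAr mulr1.
by rewrite scalerDr; non_commutative_ring.
Qed.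

(** The product of xi_i with an odd operator in the other generators changes sign when its factors
    are exchanged, so its trace is 0 and only the factor 1 - x_i X of the recursion survives. *)
Lemma pull_trace (tr : R -> F) l : (forall c X Y, tr (c *: X + Y) = c * tr X + tr Y) ->
  (forall X Y, tr (X * Y) = tr (Y * X)) -> uniq l ->
  forall k, tr (pulla l k) = (\prod_(i <- l) (1 - x i *: 'X))`_k * tr 1.
Proof.
move=> trL trC; have tr0 : tr 0 = 0 by have := trL (-1) 0 0; rewrite scaler0 addr0 mulN1r addNr.
have trD X Y : tr (X + Y) = tr X + tr Y by have := trL 1 X Y; rewrite scale1r mul1r.
have trZ c X : tr (c *: X) = c * tr X by have := trL c X 0; rewrite tr0 !addr0.
elim: l => [_|i l IH /= /andP[il ul]] k.
  by rewrite /pulla /= big_nil coef1; case: (k == 0%N); rewrite ?mul1r ?mul0r.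
case: k => [|k].
  rewrite pulla0 big_cons coef0M coefB coef1 coefZ coefX /= mulr0 subr0 mul1r -IH //.
  by rewrite pulla0.
rewrite pulla_cons -scaleNr !trD trZ !IH // big_cons mulrBl mul1r coefB -scalerAl coefZ coefXM /=.
have t0 : tr (xi i * pullb l k) = 0.
  have h := (pull_xi il k).2; have := trC (xi i) (pullb l k); rewrite h -scaleN1r trZ mulN1r.
  by move=> /eqP; rewrite -addr_eq0 -mulr2n mulrn_eq0 /= => /eqP.
rewrite (_ : tr (asgn _ _) = 0); first by ring.
by rewrite /asgn; case: ifP; rewrite // -scaleN1r trZ t0 mulr0.
Qed.

End Pull.

Lemma qrel_gen (F : numFieldType) (R : algType F) (a b : nat -> R) (P : R -> Prop) :
  qrel a b -> (forall X Y, P X -> P Y -> P (X + Y)) -> (forall X Y, P X -> P Y -> P (X * Y)) ->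
  (forall c X, P X -> P (c *: X)) -> (forall k, P (a k.*2)) -> P (b 1%N) ->
  (forall p, P (plin (eta a b) p)) /\ forall m, P (a m) /\ P (b m).
Proof.
move=> rel PD PM PZ Pa Pb.
have P0 : P 0 by rewrite -(scale0r (b 1%N)); exact: PZ.
have PN X : P X -> P (- X) by rewrite -scaleN1r; exact: PZ.
have PS I (r : seq I) (f : I -> R) : (forall i, P (f i)) -> P (\sum_(i <- r) f i).
  by move=> Pf; elim: r => [|i r IH]; rewrite ?big_nil ?big_cons //; exact: PD.
have Pe i : P (eta a b i).
  elim: i => [//|i IH]; rewrite /eta iterS -/(eta a b i); apply: (PZ); apply: PD.
    by apply: PM IH; exact: (Pa 1%N).
  by apply/PN/PM => //; exact: (Pa 1%N).
have Pp p : P (plin (eta a b) p) by apply: PS => i; exact: PZ.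
split=> // m.
have Pbm k : P (b k.*2.+1) /\ P (b k.*2.+2).
  have [-> ->] := b_AE rel k.
  by split; [|apply: PN]; apply: PS => i; exact: PM.
rewrite -(odd_double_half m); case: (odd m); rewrite ?add1n ?add0n.
  split; last exact: (Pbm _).1.
  have := qrel_bb rel m./2.*2.+1; rewrite /= odd_double /= => h.
  rewrite -(half2 (a _)) -[_ + _]opprK -h; apply/PZ/PN/PD; apply: PM => //; exact: (Pbm _).1.
split=> //; case: (m./2) => [|k]; first by rewrite (qrel_b0 rel).
by rewrite doubleS; exact: (Pbm k).2.
Qed.

Lemma poly_ideal_gen (F : fieldType) (I : {poly F} -> Prop) (p0 : {poly F}) :
  (forall p q, I p -> I q -> I (p + q)) -> (forall p q, I p -> I (p * q)) ->
  p0 != 0 -> I p0 ->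
  exists2 chi, chi \is monic & forall p, chi %| p <-> I p.
Proof.
move=> ID IM; move: {2}(size p0) (erefl (size p0)) => m.
elim/ltn_ind: m p0 => m IH p0 sm p00 Ip0.
have [h|h] := classic (forall q, I q -> p0 %| q).
  exists ((lead_coef p0)^-1 *: p0).
    by rewrite monicE lead_coefZ mulVf // lead_coef_eq0.
  move=> p; rewrite dvdpZl ?invr_eq0 ?lead_coef_eq0 //; split=> [/dvdpP[q ->]|]; last exact: h.
  by rewrite mulrC; exact: IM.
have [q h'] := not_all_ex_not _ _ h; have [Iq /negP ndq] := imply_to_and _ _ h'.
have rE : q %% p0 = q + p0 * - (q %/ p0) by rewrite {2}(divp_eq q p0); ring.
apply: (IH (size (q %% p0)) _ (q %% p0)) => //.
- by rewrite -sm ltn_modp.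
- by rewrite rE; apply: (ID) => //; exact: IM.
Qed.

(** * Simple graded modules as spaces of column vectors *)

Section MatrixModules.
Variables (F : numClosedFieldType) (n0 : nat).
Local Notation R := 'M[F]_n0.+1.

Definition mstable (U : 'cV[F]_n0.+1 -> Prop) (X : R) := forall v, U v -> U (X *m v).
(** [E] stands for the projector onto the even part, so that stability under [E] means being a
    graded subspace. *)
Definition msimple (E : R) (G : R -> Prop) := forall U : 'cV[F]_n0.+1 -> Prop,
  U 0 -> (forall v w, U v -> U w -> U (v + w)) -> (forall c v, U v -> U (c *: v)) ->
  mstable U E -> (forall X, G X -> mstable U X) ->
  (forall v, U v -> v = 0) \/ (forall v, U v).

Lemma mx_cV_ext (X Y : R) : (forall v : 'cV_n0.+1, X *m v = Y *m v) -> X = Y.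
Proof.
move=> h; apply/matrixP => i j; have := h (delta_mx j 0).
by rewrite -!colE => /matrixP /(_ i 0); rewrite !mxE.
Qed.

Lemma mulmv (X Y : R) (v : 'cV_n0.+1) : (X * Y) *m v = X *m (Y *m v).
Proof. by rewrite -[X * Y]/(X *m Y) mulmxA. Qed.

Lemma schur E G (X : R) : msimple E G -> X * E = E * X ->
  (forall Y, G Y -> X * Y = Y * X) -> X = (X 0 0)%:A.
Proof.
move=> sG XE XG; suff [c cE] : exists c, X = c%:A.
  by rewrite {1}cE; congr (_ *: _); rewrite cE !mxE mulr1.
(* Eigenvectors are rows here, hence the transpose. The eigenspace is graded because X commutes with
   E. *)
have [c rc] : exists c, root (char_poly X^T) c.
  by apply/closed_rootP; rewrite size_char_poly.
have /eigenvalueP[v vX v0] : eigenvalue X^T c by rewrite eigenvalue_root_char.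
exists c; have Xv : X *m v^T = c *: v^T by rewrite -[X]trmxK -trmx_mul vX linearZ.
case: (sG (fun w => X *m w = c *: w)).
- by rewrite mulmx0 scaler0.
- by move=> u w hu hw; rewrite mulmxDr hu hw scalerDr.
- by move=> d w hw; rewrite -scalemxAr hw !scalerA mulrC.
- by move=> w hw; rewrite -mulmv XE mulmv hw -scalemxAr.
- by move=> Y GY w hw; rewrite -mulmv XG // mulmv hw -scalemxAr.
- by move=> /(_ _ Xv) /eqP; rewrite -(inj_eq trmx_inj) trmxK trmx0 (negbTE v0).
by move=> h; apply: mx_cV_ext => w; rewrite h -scalemxAl mul1mx.
Qed.

(** The hypothesis with X = Y gives X^2 = 0. If w is killed by the rest of the list but not by X,
    then X w is killed by all. *)
Lemma common_kernel (ks : seq R) (v : 'cV[F]_n0.+1) :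
  (forall X Y : R, X \in ks -> Y \in ks -> X * Y = - (Y * X)) -> v != 0 ->
  exists2 w : 'cV[F]_n0.+1, w != 0 & forall X : R, X \in ks -> X *m w = 0.
Proof.
elim: ks => [_ v0|X ks IH aC v0]; first by exists v.
have [|w w0 kw] := IH _ v0; first by move=> Y Z Yk Zk; apply: aC; rewrite inE ?Yk ?Zk orbT.
have [Xw|Xw] := eqVneq (X *m w) 0.
  by exists w => // Y; rewrite inE => /predU1P[-> //|]; exact: kw.
exists (X *m w) => // Y; rewrite inE => /predU1P[->|Yk].
  have : X * X + X * X = 0 by rewrite {1}aC ?mem_head // addNr.
  by move=> XX; rewrite -mulmv (_ : X * X = 0) ?mul0mx //; apply: (eq_double (Y := 0)); rewrite XX addr0.
by rewrite -mulmv aC ?mem_head ?inE ?Yk ?orbT // mulNmx mulmv kw // mulmx0 oppr0.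
Qed.

Lemma plin_kernel (e : nat -> R) : exists2 p : {poly F}, p != 0 & plin e p = 0.
Proof.
pose d := (n0.+1 * n0.+1)%N.
pose K : 'M[F]_(d.+1, d) := \matrix_(i < d.+1) mxvec (e i).
have : kermx K != 0 by rewrite kermx_eq0 /row_free neq_ltn ltnS rank_leq_col.
move=> /rowV0Pn[v /sub_kermxP vK v0]; exists (rVpoly v).
  by apply: contraNneq v0 => h; rewrite -[v]rVpolyK h linear0.
apply: (can_inj mxvecK); rewrite linear0 -vK (plinE _ (size_poly _ _)) linear_sum mulmx_sum_row.
by apply: eq_bigr => i _; rewrite linearZ rowK coef_rVpoly_ord.
Qed.

End MatrixModules.

Lemma dseq_enum (F : numFieldType) (R : algType F) n (xi : 'I_n -> R) (k : 'I_n) :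
  dseq xi (enum 'I_n) k = \sum_(i < n | (i < k)%N) xi i - \sum_(i < n | (k < i)%N) xi i.
Proof.
have gen (l : seq 'I_n) : sorted ltn (map val l) -> k \in l ->
    dseq xi l k = \sum_(i <- l | (i < k)%N) xi i - \sum_(i <- l | (k < i)%N) xi i.
  elim: l => // i l IH /= pl; have ilt : {in l, forall j : 'I_n, (i < j)%N}.
    move=> j jl; have := order_path_min ltn_trans pl.
    by move=> /allP /(_ (val j)); apply; exact: map_f.
  have sl : sorted ltn (map val l) by exact: path_sorted pl.
  rewrite inE !big_cons => /predU1P[ki|kl].
    rewrite ki eqxx ltnn.
    have -> : \sum_(j <- l | (j < i)%N) xi j = 0.
      rewrite big_seq_cond big_pred0 // => j.
      by apply/negP => /andP[jl]; have := ilt _ jl; lia.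
    rewrite sub0r; congr (- _); rewrite big_seq [RHS]big_seq_cond; apply: eq_bigl => j.
    by case jl: (j \in l) => //=; rewrite ilt.
  have ik := ilt _ kl; rewrite ik; have -> : (k < i)%N = false by lia.
  have -> : (i == k) = false by apply/eqP => ik'; move: ik; rewrite ik' ltnn.
  by rewrite IH // addrA.
by rewrite gen ?mem_enum // ?val_enum_ord ?iota_ltn_sorted // !big_enum_cond.
Qed.

(** Moving the two factors past eta(q) in either order produces the same arguments, since
    polynomials commute. All lower commutators cancel and the top one is left unchanged. *)
Lemma qrel_comm_etap (F : numFieldType) (R : algType F) (a b : nat -> R) i j q :
  qrel a b -> (forall k l, (k + l < i + j)%N -> a k.*2 * a l.*2 = a l.*2 * a k.*2) ->
  (a i.*2 * a j.*2 - a j.*2 * a i.*2) * plin (eta a b) q =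
  plin (eta a b) q * (a i.*2 * a j.*2 - a j.*2 * a i.*2).
Proof.
move=> rel IH.
have two k l : plin (eta a b) q * (a k.*2 * a l.*2) =
    \sum_(k' < k.+1) \sum_(l' < l.+1) a k'.*2 * a l'.*2 *
       plin (eta a b) (gpoly F (l - l') * (gpoly F (k - k') * q)).
  rewrite mulrA (etap_A rel) mulr_suml; apply: eq_bigr => k' _.
  by rewrite -[LHS]mulrA (etap_A rel) mulr_sumr; apply: eq_bigr => l' _; exact: mulrA.
rewrite mulrBr !two [X in _ = _ - X]exchange_big -sumrB /=.
under [RHS]eq_bigr => k' _ do [rewrite -sumrB;
  under eq_bigr => l' _ do rewrite [gpoly F (i - k') * (_ * q)]mulrCA -mulrBl].
rewrite big_ord_recr /= big1 ?add0r => [|k' _]; last first.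
  by rewrite big1 // => l' _; rewrite IH ?subrr ?mul0r // -addSn leq_add // -ltnS.
rewrite big_ord_recr /= big1 ?add0r => [|l' _]; last first.
  by rewrite IH ?subrr ?mul0r // ltn_add2l.
by rewrite !subnn !mul1r.
Qed.

(** * Structure of a simple module satisfying [qrel] *)

Section Structure.
Variables (F : numClosedFieldType) (n0 : nat).
Local Notation R := 'M[F]_n0.+1.
Variable E : R.
Definition mxodd (X : R) := X * E = (1 - E) * X.

Lemma mxoddD X Y : mxodd X -> mxodd Y -> mxodd (X + Y).
Proof. by rewrite /mxodd => hX hY; rewrite mulrDl mulrDr hX hY. Qed.
Lemma mxoddZ c X : mxodd X -> mxodd (c *: X).
Proof. by rewrite /mxodd => hX; rewrite -scalerAl -scalerAr hX. Qed.
Lemma mxodd0 : mxodd 0. Proof. by rewrite /mxodd mulr0 mul0r. Qed.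
Lemma mxodd_even_mul X Y : X * E = E * X -> mxodd Y -> mxodd (X * Y).
Proof.
rewrite /mxodd => hX hY; transitivity ((X - X * E) * Y).
  by rewrite -mulrA hY mulrA mulrBr mulr1.
by rewrite hX -[X in X - _]mul1r -mulrBl mulrA.
Qed.
Lemma mxodd_mul_even X Y : X * E = E * X -> mxodd Y -> mxodd (Y * X).
Proof. by rewrite /mxodd => hX hY; rewrite -mulrA hX mulrA hY mulrA. Qed.
Lemma mxodd_mul_odd X Y : mxodd X -> mxodd Y -> (X * Y) * E = E * (X * Y).
Proof.
rewrite /mxodd => hX hY; transitivity ((X - X * E) * Y).
  by rewrite -mulrA hY mulrA mulrBr mulr1.
by rewrite hX -[X in X - _]mul1r -mulrBl subKr mulrA.
Qed.

Section QModule.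
Variables (a b : nat -> R).
Hypothesis rel : qrel a b.
Hypothesis aC : forall i j, a i.*2 * a j.*2 = a j.*2 * a i.*2.
Hypothesis aE : forall k, a k.*2 * E = E * a k.*2.
Hypothesis bE : mxodd (b 1%N).
Let gens (X : R) := (exists k, X = a k.*2) \/ X = b 1%N.
Hypothesis simple_ab : msimple E gens.

Local Notation et := (eta a b).
Local Notation etap := (plin (eta a b)).
Local Notation C := (etaC a b).

Let et_odd i : mxodd (et i).
Proof.
elim: i => // i IH; rewrite /eta iterS -/(et i); apply: mxoddZ.
apply: mxoddD; first by apply: mxodd_even_mul IH; exact: (aE 1).
by rewrite -scaleN1r; apply/mxoddZ/(mxodd_mul_even (aE 1) IH).
Qed.
Let etap_odd p : mxodd (etap p).
Proof.
rewrite /plin; elim: (size p) => [|m IH]; first by rewrite big_ord0; exact: mxodd0.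
by rewrite big_ord_recr /=; apply/mxoddD/mxoddZ.
Qed.

Let c m := C m 0 0.
Let C_scalar m : C m = (c m)%:A.
Proof.
apply: (schur simple_ab); first by rewrite mulrDl mulrDr !mxodd_mul_odd //; exact: et_odd.
by move=> Y [[k ->]|->]; [exact: etaC_A|exact: (etaC_eta rel m 0)].
Qed.
Let gam (p : {poly F}) : F := plin (c : nat -> F^o) p.
Let plinC p : plin C p = (gam p)%:A.
Proof.
rewrite /gam /plin scaler_suml; apply: eq_bigr => i _; by rewrite C_scalar scalerA.
Qed.
Let gam_linear d p q : gam (d *: p + q) = d * gam p + gam q.
Proof. by rewrite /gam linearP. Qed.
Let gam_even p : gam (pneg p) = gam p.
Proof.
rewrite /gam (plinE _ (_ : (size (pneg p) <= size p)%N)) ?size_pneg // /plin.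
apply: eq_bigr => i _; rewrite coef_pneg; have [oi|oi] := boolP (odd i).
  by rewrite /c (etaC_odd rel oi) mxE !scaler0.
by rewrite -signr_odd (negbTE oi) mul1r.
Qed.
Let etacE' p q : etap p * etap q + etap q * etap p = (gam (pneg p * q))%:A.
Proof. by rewrite -plinC -(etacE rel). Qed.

Let rad (p : {poly F}) := forall q, gam (p * q) = 0.
Let rad_ker p : etap p = 0 -> rad p.
Proof.
move=> p0 q; rewrite -gam_even pnegM; have := etacE' p (pneg q).
rewrite p0 mul0r mulr0 addr0 => /esym/eqP.
by rewrite scaler_eq0 oner_eq0 orbF => /eqP.
Qed.
Let radD p q : rad p -> rad q -> rad (p + q).
Proof. by move=> hp hq r; rewrite mulrDl -[p * r]scale1r gam_linear hp hq mulr0 addr0. Qed.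
Let radM p q : rad p -> rad (p * q).
Proof. by move=> hp r; rewrite -mulrA. Qed.
Let rad_pneg p : rad p -> rad (pneg p).
Proof. by move=> hp q; rewrite -gam_even pnegM pnegK. Qed.

Let chi_ex : exists2 chi, chi \is monic & forall p, chi %| p <-> rad p.
Proof.
have [p0 p00 ep0] := plin_kernel et.
exact: (poly_ideal_gen radD radM p00 (rad_ker ep0)).
Qed.

(** The common kernel of all eta(q), q in the radical, is a submodule: eta(q) anticommutes with
    [b 1], and moving it past [a (2k)] keeps q in the ideal. It is nonzero by [common_kernel], hence
    everything. *)
Let etap_rad p : rad p -> etap p = 0.
Proof.
move=> hp; apply: mx_cV_ext => v; rewrite mul0mx.
have [chi chi_monic chiP] := chi_ex; have [p0 p00 ep0] := plin_kernel et.
pose U (v : 'cV[F]_n0.+1) := forall p, rad p -> etap p *m v = 0.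
have anti q r : rad q -> etap q * etap r = - (etap r * etap q).
  by move=> rq; apply/eqP; rewrite -addr_eq0 etacE' (rad_pneg rq) scale0r.
have e0M q : etap (p0 * q) = 0.
  move: q; apply: eq_poly_linear => [d q r|d q r|i]; first by rewrite mulrDr -scalerAr linearP.
    by rewrite scaler0 addr0.
  elim: i => [|i IH]; first by rewrite mulr1.
  by rewrite exprS mulrCA etap_XM IH linear0.
have : (forall v, U v -> v = 0) \/ forall v, U v.
  apply: simple_ab.
  - by move=> q _; rewrite mulmx0.
  - by move=> u w hu hw q hq; rewrite mulmxDr hu // hw // addr0.
  - by move=> d w hw q hq; rewrite -scalemxAr hw // scaler0.
  - move=> w hw q hq; rewrite -mulmv etap_odd mulmv hw // mulmx0 //.
  move=> X [[k ->]|->] w hw q hq.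
    rewrite -mulmv (etap_A rel) mulmx_suml big1 // => i _.
    by rewrite mulmv hw ?mulmx0 // mulrC; exact: radM.
  by rewrite -mulmv -[b 1%N](etap1 a b) anti // mulNmx mulmv hw // mulmx0 oppr0.
case=> [h|h]; last exact: h.
have chi_rad : rad chi by apply/chiP.
(* Finitely many operators suffice: eta kills the multiples of [p0], so cofactors of chi may be
   reduced modulo [p0]. *)
pose ks := [seq etap (chi * 'X^i) | i <- iota 0 (size p0)].
have [||w w0 kw] := @common_kernel _ _ ks (delta_mx 0 0).
- move=> X Y /mapP[i _ ->] /mapP[j _ ->]; apply: anti; exact: radM.
- by apply/eqP => /matrixP /(_ 0 0) /eqP; rewrite !mxE !eqxx oner_eq0.
case/eqP: w0; apply: h => q /chiP/dvdpP[r ->].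
have -> : r * chi = p0 * (r %/ p0 * chi) + chi * (r %% p0).
  by rewrite {1}(divp_eq r p0); ring.
rewrite linearD /= e0M add0r.
rewrite -[r %% p0]coefK poly_def mulr_sumr linear_sum mulmx_suml big1 // => i _.
rewrite -scalerAr linearZ /= -scalemxAl kw ?scaler0 //; apply/mapP; exists (i : nat) => //.
rewrite mem_iota /= add0n (leq_trans (ltn_ord i)) //.
by rewrite ltnW // ltn_modp.
Qed.

Lemma qmodule_structure : exists2 N : {poly F}, N \is monic &
  forall n (s : 'I_n -> F), N = \prod_(i < n) ('X + (s i)%:P) ->
  [/\ forall i, s i != 0, forall i j, s i + s j != 0 &
    exists xi : 'I_n -> R, exists fc : nat -> F,
    [/\ forall i, mxodd (xi i), forall i, xi i * xi i = (s i)%:A,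
        forall i j, i != j -> xi i * xi j = - (xi j * xi i),
        forall m, a m = \sum_(r < m.+1) gcoef fc (m - r) *: pulla s xi (enum 'I_n) r /\
                  b m = \sum_(r < m.+1) gcoef fc (m - r) *: pullb s xi (enum 'I_n) r
      & msimple E (fun X => exists i, X = xi i)]].
Proof.
have [chi chi_monic chiP] := chi_ex.
have [N [Nm sN cN pN gN]] := cyclic_form_repr gam_linear gam_even chi_monic chiP.
exists N => // n s NE; split.
- exact: (frame_regular chi_monic sN cN pN NE).
- exact: (frame_typical chi_monic sN cN pN NE).
have [p [p1 pp pX]] := frame_poly gam_even chi_monic chiP sN cN pN gN NE.
have ker q : chi %| q -> etap q = 0 by move=> /chiP; exact: etap_rad.
pose xi k := etap (p k); exists xi.
have xi_odd i : mxodd (xi i) by exact: etap_odd.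
have xi2 i : xi i * xi i = (s i)%:A.
  apply: eq_double; rewrite etacE' pp eqxx -scalerDl; congr (_ *: _); ring.
have xiC i j : i != j -> xi i * xi j = - (xi j * xi i).
  move=> ij; apply/eqP; rewrite -addr_eq0 etacE' pp (negbTE ij) scale0r //.
set a' := pulla s xi (enum 'I_n); set b' := pullb s xi (enum 'I_n).
have rel' : qrel a' b' by apply: pull_qrel => //; exact: enum_uniq.
have b1 : b' 1%N = b 1%N.
  rewrite /b' pullb1 big_enum /= -[b 1%N](etap1 a b) -linear_sum.
  apply/eqP; rewrite eq_sym -addr_eq0 -linearD /= addrC; apply/eqP; exact: ker.
have ddxi k : dd a' (xi k) = dd a (xi k).
  rewrite pull_dd ?enum_uniq ?mem_enum // dseq_enum -etap_XM.
  have sumE (Q : pred 'I_n) : etap (\sum_(i < n | Q i) p i) = \sum_(i < n | Q i) xi i.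
    by rewrite linear_sum.
  have := ker _ (pX k); rewrite linearD /= linearZ /= linearB /= !sumE => /eqP.
  by rewrite addr_eq0 => /eqP ->; rewrite scaleNr.
have eta_eq i : et i = eta a' b' i.
  (* [dd a] and [dd a'] are known to agree only on the span of the xi_k, so the induction also
     carries membership in that span. *)
  have [d [_ //]] : exists d : 'I_n -> F, et i = \sum_k d k *: xi k /\ et i = eta a' b' i.
  elim: i => [|i [d [dE eE]]].
    exists (fun=> -1); split; last by rewrite /= b1.
    by rewrite -scaler_sumr scaleN1r -[et 0]/(b 1%N) -b1 /b' pullb1 big_enum.
  have ddE : dd a (et i) = \sum_k (- d k * s k) *:
      (\sum_(j < n | (j < k)%N) xi j - \sum_(j < n | (k < j)%N) xi j).
    rewrite dE linear_sum; apply: eq_bigr => k _; rewrite linearZ /= -ddxi.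
    by rewrite pull_dd ?enum_uniq ?mem_enum // dseq_enum scalerA mulrN mulNr.
  pose sg (j k : 'I_n) : F := (j < k)%N%:R - (k < j)%N%:R.
  exists (fun j => \sum_k - d k * s k * sg j k); split.
    rewrite /eta iterS -/(et i) ddE.
    under [RHS]eq_bigr => j _ do rewrite scaler_suml.
    rewrite exchange_big; apply: eq_bigr => k _ /=.
    rewrite big_mkcond [X in _ - X]big_mkcond -sumrB scaler_sumr; apply: eq_bigr => j _.
    rewrite -[RHS]scalerA; congr (_ *: _); rewrite /sg scalerBl.
    by case: (j < k)%N; case: (k < j)%N; rewrite ?scale1r ?scale0r.
  rewrite /eta !iterS -/(et i) -/(eta a' b' i) -eE dE !linear_sum; apply: eq_bigr => k _.
  by rewrite !linearZ /= ddxi.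
have [f [faE fboE fbeE fetap]] := qrel_quotient rel rel' eta_eq.
have comm_xi X : (forall i, X * xi i = xi i * X) -> forall k, X * a' k = a' k * X /\ X * b' k = b' k * X.
  move=> hX; apply: (@pull_ind _ _ _ s xi (fun Y => X * Y = Y * X) (fun Y => X * Y = Y * X) (enum 'I_n)).
  - by rewrite mulr1 mul1r.
  - by rewrite mulr0 mul0r.
  - by rewrite mulr0 mul0r.
  - by move=> Y Z hY hZ; rewrite mulrDl mulrDr hY hZ.
  - by move=> Y Z hY hZ; rewrite mulrDl mulrDr hY hZ.
  - by move=> d Y hY; rewrite -scalerAl -scalerAr hY.
  - by move=> d Y hY; rewrite -scalerAl -scalerAr hY.
  - by move=> i Y _ hY; rewrite mulrA hX -!mulrA hY.
  - by move=> i Y _ hY; rewrite mulrA hX -!mulrA hY.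
have a'E k : a' k * E = E * a' k.
  apply: (proj1 (@pull_ind _ _ _ s xi (fun Y => Y * E = E * Y) mxodd (enum 'I_n) _ _ _ _ _ _ _ _ _ k)) => //.
  - by rewrite mulr1 mul1r.
  - exact: mxodd0.
  - by rewrite mulr0 mul0r.
  - by move=> Y Z hY hZ; rewrite mulrDl mulrDr hY hZ.
  - exact: mxoddD.
  - by move=> d Y hY; rewrite -scalerAl -scalerAr hY.
  - exact: mxoddZ.
  - by move=> i Y _ hY; exact: mxodd_mul_even.
  - by move=> i Y _ hY; exact: mxodd_mul_odd.
have fa' i k : f i * a' k = a' k * f i.
  by apply: (proj1 (comm_xi _ _ k)) => j; exact: fetap.
have fE i : f i * E = E * f i.
  apply/eqP; rewrite -subr_eq0; apply/eqP; move: i.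
  apply: (@conv_cancel_r _ _ (fun k => a' k.*2)) => [|k]; first exact: (qrel_a0 rel').
  have : a k.*2 * E - E * a k.*2 = 0 by rewrite aE subrr.
  move=> h; rewrite -[RHS]h faE mulr_suml mulr_sumr -sumrB; apply: eq_bigr => i _.
  by rewrite mulrBl -!mulrA -a'E.
(* By induction on i + j the commutator K commutes with every eta, hence with [a'], f and all
   generators: it is a scalar, of trace 0. *)
have a'C i j : a' i.*2 * a' j.*2 = a' j.*2 * a' i.*2.
  move: {2}(i + j)%N (erefl (i + j)%N) => m; elim/ltn_ind: m i j => m IH i j ij.
  pose K := a' i.*2 * a' j.*2 - a' j.*2 * a' i.*2.
  have Keta q : K * etap q = etap q * K.
    have -> : etap q = plin (eta a' b') q by apply: eq_bigr => l _; rewrite eta_eq.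
    by rewrite /K; apply: qrel_comm_etap => // k l kl; apply: (IH (k + l)%N) => //; rewrite -ij.
  have Kxi k : K * xi k = xi k * K by exact: Keta.
  have Ka' k := (comm_xi K Kxi k).1.
  have Kf k : K * f k = f k * K by rewrite mulrBl mulrBr -!mulrA -!fa' !mulrA -!fa'.
  have KS : K = (K 0 0)%:A.
    apply: (schur simple_ab); first by rewrite mulrBl mulrBr -!mulrA !a'E !mulrA !a'E.
    move=> Y [[k ->]|->]; last by rewrite -[b 1%N](etap1 a b).
    rewrite faE mulr_sumr mulr_suml; apply: eq_bigr => l _.
    by rewrite mulrA Kf -!mulrA Ka'.
  have K0 : K = 0.
    have : \tr K = 0 by rewrite raddfB /= -[a' _ * _]/(_ *m _) mxtrace_mulC subrr.
    rewrite KS linearZ /= mxtrace1 => /eqP; rewrite mulf_eq0 pnatr_eq0 orbF => /eqP ->.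
    by rewrite scale0r.
  by apply/eqP; rewrite -subr_eq0 -/K K0.
have fA i j : f i * a j.*2 = a j.*2 * f i.
  apply/esym/eqP; rewrite -subr_eq0; apply/eqP; move: i.
  apply: (@conv_cancel_r _ _ (fun k => a' k.*2)) => [|k]; first exact: (qrel_a0 rel').
  have a'a l : a' l.*2 * a j.*2 = a j.*2 * a' l.*2.
    rewrite faE mulr_sumr mulr_suml; apply: eq_bigr => r _.
    by rewrite mulrA -fa' -!mulrA a'C.
  have : a j.*2 * a k.*2 - a k.*2 * a j.*2 = 0 by rewrite aC subrr.
  move=> h; rewrite -[RHS]h (faE k) mulr_suml mulr_sumr -sumrB; apply: eq_bigr => i _.
  by rewrite mulrBl -!mulrA a'a.
pose fc i := f i 0 0.
have fS i : f i = (fc i)%:A.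
  apply: (schur simple_ab) => // Y [[k ->]|->] //.
  by rewrite -[b 1%N](etap1 a b).
exists fc; split=> //; first exact: (qrel_scalar_quotient rel rel' eta_eq faE fboE fbeE fS).
(* A subspace stable under the xi_k is stable under [a'] and [b'], hence under the generators, since
   f is scalar. *)
move=> U U0 UD UZ UE Uxi; apply: simple_ab => // X.
have stD Y Z : mstable U Y -> mstable U Z -> mstable U (Y + Z).
  by move=> hY hZ v Uv; rewrite mulmxDl; apply: UD; [exact: hY|exact: hZ].
have stZ d Y : mstable U Y -> mstable U (d *: Y).
  by move=> hY v Uv; rewrite -scalemxAl; apply/UZ/hY.
have stM i Y : mstable U Y -> mstable U (xi i * Y).
  by move=> hY v Uv; rewrite mulmv; apply: (Uxi (xi i)); [exists i|exact: hY].
have st0 : mstable U 0 by move=> v _; rewrite mul0mx.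
have st k : mstable U (a' k) /\ mstable U (b' k).
  apply: (@pull_ind _ _ _ s xi (@mstable F n0 U) (@mstable F n0 U) (enum 'I_n)) => //.
    by move=> v Uv; rewrite mul1mx.
  by move=> i Y _; exact: stM.
  by move=> i Y _; exact: stM.
move=> [[k ->]|->]; last by rewrite -b1; exact: (st 1%N).2.
rewrite faE /conv; elim: (index_enum _) => [|i r IH]; first by rewrite big_nil.
by rewrite big_cons; apply: (stD) => //; rewrite fS -scalerAl mul1r; exact: (stZ _ _ (st _).1).
Qed.

End QModule.
End Structure.

(** * Recovering f and s from f(u) prod (1 - s_i / u) *)

Section EvenSeries.
Variable F : numFieldType.

Lemma conv_comm (f g : nat -> F) k : conv f g k = conv g f k.
Proof. by rewrite conv_rev; apply: eq_bigr => i _; rewrite mulrC. Qed.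

(** Besides f p = g q, the substitution X -> -X gives f p(-X) = g q(-X). Cross-multiplying and
    cancelling f g yields p q(-X) = q p(-X), and coprimality makes p and q divide each other. *)
Lemma even_series_factor (f g : nat -> F) (p q : {poly F}) :
  (forall i, odd i -> f i = 0) -> (forall i, odd i -> g i = 0) -> f 0%N = 1 -> g 0%N = 1 ->
  p`_0 = 1 -> q`_0 = 1 -> coprimep p (pneg p) -> coprimep q (pneg q) ->
  (forall k, conv f (fun i => p`_i) k = conv g (fun i => q`_i) k) ->
  p = q /\ forall k, f k = g k.
Proof.
move=> fodd godd f0 g0 p0 q0 cp cq fg.
have neg (h : nat -> F) (r : {poly F}) k : (forall i, odd i -> h i = 0) ->
    conv h (fun i => (pneg r)`_i) k = (-1) ^+ k * conv h (fun i => r`_i) k.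
  move=> hodd; rewrite /conv mulr_sumr; apply: eq_bigr => i _; rewrite coef_pneg.
  have [/hodd -> |oi] := boolP (odd i); first by rewrite !mul0r mulr0.
  rewrite mulrCA; congr (_ * _); rewrite -signr_odd -[in RHS]signr_odd.
  by rewrite oddB ?leq_ord // (negbTE oi) addbF.
have fgn k : conv f (fun i => (pneg p)`_i) k = conv g (fun i => (pneg q)`_i) k.
  by rewrite !neg // fg.
pose P i := p`_i; pose Q i := q`_i; pose P' i := (pneg p)`_i; pose Q' i := (pneg q)`_i.
have PQ : p * pneg q = q * pneg p.
  apply/polyP => k; apply/eqP; rewrite -subr_eq0 !coefM; apply/eqP.
  pose D k := conv P Q' k - conv Q P' k; move: k.
  suff : forall k, D k = 0 by [].
  apply: (@conv_cancel_l _ (conv f g)).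
    by rewrite /conv big_ord1 f0 g0 mulr1.
  move=> k; rewrite /D /conv; under eq_bigr => i _ do rewrite mulrBr.
  rewrite sumrB; apply/eqP; rewrite subr_eq0; apply/eqP.
  have sw (u v w z : nat -> F) : conv (conv u v) (conv w z) =1 conv (conv u w) (conv v z).
    move=> m; rewrite -convA (eq_conv (frefl u) (convA v w z)).
    rewrite (eq_conv (frefl u) (eq_conv (conv_comm v w) (frefl z))).
    by rewrite (eq_conv (frefl u) (fsym (convA w v z))) convA.
  transitivity (conv (conv f P) (conv g Q') k); first exact: sw.
  transitivity (conv (conv g Q) (conv f P') k).
    by apply: eq_conv => m; [exact: fg|rewrite -fgn].
  transitivity (conv (conv g f) (conv Q P') k); first exact: sw.
  by apply: eq_bigr => i _; congr (_ * _); exact: conv_comm.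
have dpq : p %| q by rewrite -(Gauss_dvdpl _ cp) -PQ dvdp_mulr.
have dqp : q %| p by rewrite -(Gauss_dvdpl _ cq) PQ dvdp_mulr.
have pq : p = q.
  have /eqpf_eq[c _ cE] : p %= q by rewrite /eqp dpq dqp.
  by have := p0; rewrite cE coefZ q0 mulr1 => ->; rewrite scale1r.
split=> // k; apply/eqP; rewrite -subr_eq0; apply/eqP; move: k.
apply: (@conv_cancel_r _ _ P) => // k; rewrite /conv.
under eq_bigr => i _ do rewrite mulrBl.
by rewrite sumrB; apply/eqP; rewrite subr_eq0; apply/eqP; rewrite -[LHS]/(conv f P k) fg -pq.
Qed.

Definition espoly n (s : 'I_n -> F) : {poly F} := \prod_(i <- enum 'I_n) (1 - s i *: 'X).

Lemma espoly0 n (s : 'I_n -> F) : (espoly s)`_0 = 1.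
Proof.
rewrite /espoly; elim: (enum _) => [|i l IH]; first by rewrite big_nil coef1.
by rewrite big_cons coef0M IH coefB coef1 coefZ coefX /= mulr0 subr0 mulr1.
Qed.

Lemma espoly_coprime n (s : 'I_n -> F) : (forall i j, s i + s j != 0) ->
  coprimep (espoly s) (pneg (espoly s)).
Proof.
move=> sij; rewrite /espoly /pneg rmorph_prod /=.
elim: {1}(enum _) => [|i l IH]; first by rewrite big_nil coprime1p.
rewrite big_cons coprimepMl IH andbT {IH l}.
elim: (enum _) => [|j l IH]; first by rewrite big_nil coprimep1.
rewrite big_cons coprimepMr IH andbT.
have -> : (1 - s j *: 'X) \Po - 'X = 1 + s j *: 'X.
  by rewrite comp_polyB comp_polyZ comp_polyX scalerN opprK -polyC1 comp_polyC.
(* The Bezout relation al (1 - s_i X) + be (1 + s_j X) = 1. *)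
pose al := s j / (s i + s j); pose be := s i / (s i + s j).
have ab1 : al%:P + be%:P = 1 :> {poly F}.
  by rewrite -polyCD /al /be -mulrDl [s j + _]addrC divff.
have abs : al * s i = be * s j by rewrite /al /be mulrAC [s j * _]mulrC mulrAC.
apply/Bezout_eq1_coprimepP; exists (al%:P, be%:P) => /=; rewrite -!mul_polyC.
transitivity (al%:P + be%:P - ((al * s i)%:P - (be * s j)%:P) * 'X).
  by rewrite !polyCM; ring.
by rewrite abs subrr mul0r subr0.
Qed.

(** As no s_i vanishes, the roots of [espoly s] are the inverses of the s_i with multiplicity, and
    their number is n. *)
Lemma espoly_inj n n' (s : 'I_n -> F) (s' : 'I_n' -> F) :
  (forall i, s i != 0) -> (forall i, s' i != 0) -> espoly s = espoly s' ->
  exists2 sigma : 'I_n' -> 'I_n, bijective sigma & forall i, s' i = s (sigma i).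
Proof.
have szE m (t : 'I_m -> F) : (forall i, t i != 0) -> espoly t =
    (\prod_(i <- enum 'I_m) - t i) *: \prod_(x <- [seq (t i)^-1 | i <- enum 'I_m]) ('X - x%:P).
  move=> t0; rewrite /espoly big_map; elim: (enum _) => [|i l IH].
    by rewrite !big_nil scale1r.
  rewrite !big_cons IH -!mul_polyC polyCM.
  rewrite (_ : 1 - (t i)%:P * 'X = (- t i)%:P * ('X - ((t i)^-1)%:P)); first by ring.
  have h : (t i)%:P * ((t i)^-1)%:P = 1 :> {poly F} by rewrite -polyCM divff.
  by rewrite -[1 in LHS]h polyCN; ring.
move=> s0 s'0; rewrite !szE // => eqs.
have nz m (t : 'I_m -> F) : (forall i, t i != 0) -> \prod_(i <- enum 'I_m) - t i != 0.
  by move=> t0; rewrite prodf_seq_neq0; apply/allP => i _; rewrite oppr_eq0 t0.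
have eqp : \prod_(x <- [seq (s i)^-1 | i <- enum 'I_n]) ('X - x%:P) =
           \prod_(x <- [seq (s' i)^-1 | i <- enum 'I_n']) ('X - x%:P).
  have := congr1 lead_coef eqs; rewrite !lead_coefZ !(monicP (monic_prod_XsubC _ _ _)) !mulr1.
  by move=> h; move: eqs; rewrite h => /(scalerI (nz _ _ s'0)).
have pm := prod_XsubC_eq eqp.
have nn : n' = n.
  apply: etrans (esym (size_enum_ord n')) _; apply: etrans _ (size_enum_ord n).
  exact: (etrans (esym (size_map _ _)) (etrans (esym (perm_size pm)) (size_map _ _))).
move: s' s'0 pm {eqs eqp}; rewrite nn => s' s'0.
move=> pm.
have : perm_eq [tuple (s' i)^-1 | i < n] [tuple (s i)^-1 | i < n] by rewrite perm_sym.
move=> /tuple_permP[p pE]; exists p; first exact: (injF_bij perm_inj).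
move=> i; apply: invr_inj; have := congr1 (fun t : n.-tuple F => tnth t i) (val_inj pE).
by rewrite !tnth_mktuple.
Qed.

Lemma espoly_prod n n' (s : 'I_n -> F) (s' : 'I_n' -> F) (sigma : 'I_n' -> 'I_n) :
  bijective sigma -> (forall i, s' i = s (sigma i)) ->
  \prod_(i < n') ('X + (s' i)%:P) = \prod_(i < n) ('X + (s i)%:P).
Proof.
move=> sb ss; rewrite [RHS](reindex sigma) /=; last exact: onW_bij.
by apply: eq_bigr => i _; rewrite ss.
Qed.

End EvenSeries.

Section RingIdentities.
Variable R : pzRingType.
Implicit Types x y z w : R.

Lemma sub_of_double x y z w : z + z = x + w + y -> x - y = x - z + w + (x - z).
Proof.
move=> zz; have -> : y = z + z - x - w by rewrite zz; non_commutative_ring.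
by non_commutative_ring.
Qed.
Lemma subDK x y z : x - (y + z) + y = x - z. Proof. by non_commutative_ring. Qed.
Lemma subBB x y z : x - y - (x - z) = - (y - z). Proof. by non_commutative_ring. Qed.

End RingIdentities.

(** * V(s) stays simple over the operators [a] and [b] *)

Section PullSimple.
Variables (F : numClosedFieldType) (n0 : nat).
Local Notation R := 'M[F]_n0.+1.
Variables (E : R) (n : nat) (s : 'I_n -> F) (xi : 'I_n -> R).
Hypothesis s0 : forall i, s i != 0.
Hypothesis sij : forall i j, s i + s j != 0.
Hypothesis xi_odd : forall i, mxodd E (xi i).
Hypothesis xi2 : forall i, xi i * xi i = (s i)%:A.
Hypothesis xiC : forall i j, i != j -> xi i * xi j = - (xi j * xi i).
Hypothesis xi_simple : msimple E (fun X => exists i, X = xi i).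

Let a := pulla s xi (enum 'I_n).
Let b := pullb s xi (enum 'I_n).
Local Notation etap := (plin (eta a b)).

Lemma pull_enum_qrel : qrel a b.
Proof. by apply: pull_qrel => //; exact: enum_uniq. Qed.
Let rel := pull_enum_qrel.

Lemma pull_even_odd k : a k * E = E * a k /\ mxodd E (b k).
Proof.
apply: (@pull_ind _ _ _ s xi (fun Y => Y * E = E * Y) (mxodd E) (enum 'I_n)).
- by rewrite mulr1 mul1r.
- exact: mxodd0.
- by rewrite mulr0 mul0r.
- by move=> Y Z hY hZ; rewrite mulrDl mulrDr hY hZ.
- exact: mxoddD.
- by move=> d Y hY; rewrite -scalerAl -scalerAr hY.
- exact: mxoddZ.
- by move=> i Y _ hY; exact: mxodd_mul_even.
- by move=> i Y _ hY; exact: mxodd_mul_odd.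
Qed.

Let lin (c : 'I_n -> F) := \sum_i c i *: xi i.

Let dd_lin c : dd a (lin c) = lin (fun i =>
  \sum_(j < n | (j < i)%N) c j * s j - \sum_(j < n | (i < j)%N) c j * s j).
Proof.
rewrite /lin linear_sum /=.
under eq_bigr => k _ do rewrite linearZ /= pull_dd ?enum_uniq ?mem_enum // dseq_enum scalerA
  big_mkcond [X in _ - X]big_mkcond -sumrB scaler_sumr.
rewrite exchange_big; apply: eq_bigr => i _ /=.
rewrite [X in (X - _) *: _]big_mkcond [X in (_ - X) *: _]big_mkcond -sumrB scaler_suml.
apply: eq_bigr => j _; case: (ltngtP i j) => ij; rewrite ?subr0 ?sub0r ?scaler0 ?scale0r //.
  by rewrite mulrN.
by rewrite scalerN mulrN scaleNr opprK.
Qed.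

Let lin_inj c i : lin c = 0 -> c i = 0.
Proof.
move=> c0; have : xi i * lin c + lin c * xi i = 0 by rewrite c0 mulr0 mul0r addr0.
rewrite /lin (bigD1 i) //=; set S := \sum_(j | _) _.
have SC : xi i * S + S * xi i = 0.
  rewrite mulr_sumr mulr_suml -big_split big1 //= => j ji.
  by rewrite -scalerAl -scalerAr -scalerDr xiC 1?eq_sym // addNr scaler0.
rewrite mulrDr mulrDl addrACA SC addr0 -scalerAl -scalerAr xi2 scalerA -scalerDl.
move/eqP; rewrite scaler_eq0 oner_eq0 orbF -mulr2n mulrn_eq0 /= mulf_eq0 (negbTE (s0 i)) orbF.
by move/eqP.
Qed.

(** On the span of the xi_i no -s_k is an eigenvalue of [dd], which makes dd + s_k injective
    there. *)
Let eigen_inj c k : dd a (lin c) = - s k *: lin c -> lin c = 0.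
Proof.
rewrite dd_lin => h.
have {}h i : s k * c i = \sum_(j < n | (i < j)%N) c j * s j - \sum_(j < n | (j < i)%N) c j * s j.
  have : lin (fun i => \sum_(j < n | (j < i)%N) c j * s j - \sum_(j < n | (i < j)%N) c j * s j
      + s k * c i) = 0.
    rewrite /lin; under eq_bigr => j _ do rewrite scalerDl.
    rewrite big_split; apply/eqP; rewrite addr_eq0; apply/eqP.
    move: h; rewrite /lin => ->; rewrite scaler_sumr -sumrN; apply: eq_bigr => j _.
    by rewrite scalerA mulNr scaleNr.
  by move=> /(lin_inj i)/eqP /=; rewrite addrC addr_eq0 opprB => /eqP.
(* The eigenvector equation becomes (s_k + s_i) f_(i+1) = (s_k - s_i) f_i. At i = k it gives f_(k+1)
   = 0, hence f_n = e_n = 0 by typicality. Then f_0 = -e_n = 0, and the recursion kills every f_m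
   and with it every c_i. *)
pose e m := \sum_(j < n | (j < m)%N) c j * s j.
pose f m := e m *+ 2 - e n.
have eS (i : 'I_n) : e i.+1 = e i + c i * s i.
  rewrite /e (bigD1 i) //= addrC; congr (_ + _); apply: eq_bigl => j.
  by rewrite ltnS (leq_eqVlt j) -val_eqE /=; case: ltngtP.
have eT (i : 'I_n) : e n = e i.+1 + \sum_(j < n | (i < j)%N) c j * s j.
  rewrite /e (bigID (fun j : 'I_n => (j < i.+1)%N)) /=; congr (_ + _); apply: eq_bigl => j.
    by rewrite ltn_ord.
  by rewrite ltn_ord -leqNgt.
have fS (i : 'I_n) : (s k + s i) * f i.+1 = (s k - s i) * f i.
  have hi := h i; rewrite -/(e i) in hi.
  have := eT i; rewrite /f => ->; move: hi; set t := \sum_(j < n | _) _ => hi.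
  rewrite eS; apply/eqP; rewrite -subr_eq0; apply/eqP.
  transitivity (s i * (s k * c i - (t - e i)) *+ 2); first by ring.
  by rewrite hi subrr mulr0 mul0rn.
have fk m : (k < m <= n)%N -> f m = 0.
  elim: m => // m IH /andP[km mn]; have := fS (Ordinal mn) => /=.
  have -> : (s k - s (Ordinal mn)) * f m = 0.
    move: km; rewrite ltnS leq_eqVlt => /predU1P[km|km].
      by rewrite (_ : Ordinal mn = k) ?subrr ?mul0r //; apply: val_inj.
    by rewrite IH ?mulr0 // km ltnW.
  by move=> /eqP; rewrite mulf_eq0 (negbTE (sij _ _)) => /eqP.
have en : e n = 0 by have := fk n; rewrite ltn_ord leqnn => /(_ isT); rewrite /f mulr2n addrK.
have f00 m : (m <= n)%N -> f m = 0.
  elim: m => [_|m IH mn]; first by rewrite /f en /e big_pred0_eq mul0rn subrr.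
  have := fS (Ordinal mn); rewrite /= (IH (ltnW mn)) mulr0 => /eqP.
  by rewrite mulf_eq0 (negbTE (sij _ _)) => /eqP.
rewrite /lin big1 // => i _.
have e0 m : (m <= n)%N -> e m = 0.
  by move=> /f00; rewrite /f en subr0 => /eqP; rewrite mulrn_eq0 /= => /eqP.
have := eS i; rewrite (e0 i (ltnW (ltn_ord i))) (e0 i.+1 (ltn_ord i)) add0r => /esym/eqP.
by rewrite mulf_eq0 (negbTE (s0 i)) orbF => /eqP ->; rewrite scale0r.
Qed.

Let eta_lin i : exists c, eta a b i = lin c.
Proof.
elim: i => [|i [c cE]]; last by rewrite /eta iterS -/(eta a b i) cE dd_lin; eexists.
exists (fun=> -1); rewrite /= /b pullb1 big_enum /lin -scaler_sumr scaleN1r //.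
Qed.
Let etap_lin p : exists c, etap p = lin c.
Proof.
rewrite /plin; elim: (size p) => [|m [c cE]].
  by exists (fun=> 0); rewrite big_ord0 /lin big1 // => i _; rewrite scale0r.
have [d dE] := eta_lin m; exists (fun i => c i + p`_m * d i).
rewrite big_ord_recr /= cE dE /lin scaler_sumr -big_split; apply: eq_bigr => i _ /=.
by rewrite scalerDl scalerA.
Qed.

Lemma xi_etap k : exists p, xi k = etap p.
Proof.
(* The shift by half the total sum turns the action of [dd] into (dd + s_i) T_(i+1) = (dd - s_i)
   T_i, with T_0 = eta(1/2). Inverting dd + s_i puts every T_m into the image of eta, and xi_k =
   T_(k+1) - T_k. *)
pose T m := \sum_(i < n | (i < m)%N) xi i - 2^-1 *: \sum_i xi i.
have TS (i : 'I_n) : T i.+1 = T i + xi i.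
  rewrite /T (bigD1 i) //= [xi i + _]addrC -!addrA [xi i + _]addrC; congr (_ + _).
  apply: eq_bigl => j; by rewrite ltnS (leq_eqVlt j) -val_eqE /=; case: ltngtP.
have TT (i : 'I_n) : dd a (xi i) = - s i *: (T i.+1 + T i).
  rewrite pull_dd ?enum_uniq ?mem_enum // dseq_enum; congr (_ *: _); rewrite TS /T.
  have -> : \sum_i xi i = \sum_(j < n | (j < i)%N) xi j + xi i + \sum_(j < n | (i < j)%N) xi j.
    rewrite (bigID (fun j : 'I_n => (j < i)%N)) /= -addrA; congr (_ + _).
    rewrite (bigD1 i) /= ?ltnn //; congr (_ + _); apply: eq_bigl => j.
    by rewrite -leqNgt ltn_neqAle andbC eq_sym val_eqE.
  set x := \sum_(j < n | _) _; set y := \sum_(j < n | _) _; set z := 2^-1 *: _.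
  have zz : z + z = x + xi i + y by rewrite -scalerDr half2.
  exact: (@sub_of_double R).
have [p0 p00 ep0] := plin_kernel (eta a b).
have etapM p q : etap p = 0 -> etap (p * q) = 0.
  move=> ep; move: q; apply: eq_poly_linear => [d q r|d q r|i].
  - by rewrite mulrDr -scalerAr linearP.
  - by rewrite scaler0 addr0.
  elim: i => [|i IH]; first by rewrite mulr1.
  by rewrite exprS mulrCA etap_XM IH linear0.
have [chi chim chiP] : exists2 chi, chi \is monic & forall p, chi %| p <-> etap p = 0.
  have etapD p q : etap p = 0 -> etap q = 0 -> etap (p + q) = 0.
    by move=> ep eq; rewrite linearD /= ep eq addr0.
  exact: (@poly_ideal_gen F (fun p => etap p = 0) p0 etapD etapM p00 ep0).
have Trange m : (m <= n)%N -> exists q, T m = etap q.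
  elim: m => [_|m IH mn].
    exists (2^-1)%:P; rewrite -[_%:P]mulr1 mul_polyC linearZ /= etap1 /b pullb1 big_enum.
    by rewrite /T big_pred0_eq sub0r scalerN.
  have [q qE] := IH (ltnW mn); pose i := Ordinal mn.
  (* Otherwise chi / (X + s_i) would give an eigenvector of [dd] for -s_i, which is 0, against the
     minimality of chi. *)
  have cop : coprimep chi ('X - (- s i)%:P).
    rewrite coprimep_XsubC; apply/negP => /factor_theorem[chi' cE].
    have ec : etap chi' = 0.
      have [c ce] := etap_lin chi'; rewrite ce; apply: (@eigen_inj _ i); rewrite -ce.
      have /chiP : chi %| chi by exact: dvdpp.
      rewrite {1}cE mulrC mulrBl linearB /= etap_XM mul_polyC linearZ /= => /eqP.
      by rewrite subr_eq0 => /eqP.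
    have c'0 : chi' != 0 by apply: contraTneq (monic_neq0 chim) => h; rewrite cE h mul0r eqxx.
    move/chiP: ec => /(dvdp_leq c'0); rewrite cE size_mul ?polyXsubC_eq0 // size_XsubC addn2 /=.
    by rewrite ltnn.
  have /Bezout_eq1_coprimepP[[u v] /= uv] := cop.
  pose r := ('X - (s i)%:P) * q; pose y := v * r; exists y.
  have ey : dd a (etap y) + s i *: etap y = etap r.
    rewrite -etap_XM -linearZ -linearD /=.
    have -> : 'X * y + s i *: y = r + chi * (- u * r).
      have vX : v * ('X - (- s i)%:P) = 1 - u * chi by rewrite -uv; ring.
      rewrite -mul_polyC /y; transitivity ((v * ('X - (- s i)%:P)) * r).
        by rewrite polyCN; ring.
      by rewrite vX; ring.
    rewrite linearD /= (etapM chi) ?addr0 //; apply/chiP; exact: dvdpp.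
  have eT : dd a (T m.+1) + s i *: T m.+1 = etap r.
    have -> : etap r = dd a (etap q) - s i *: etap q.
      by rewrite /r mulrBl linearB /= etap_XM mul_polyC linearZ.
    rewrite -qE.
    have -> : dd a (T m.+1) = dd a (T m) + dd a (xi i) by rewrite (TS i) linearD.
    rewrite TT scaleNr scalerDr /=; exact: (@subDK R).
  have [c ce] := etap_lin y; pose c' (j : 'I_n) := (j < m.+1)%N%:R - 2^-1 - c j.
  have lE : lin c' = T m.+1 - etap y.
    rewrite /lin /T ce /lin [X in X - _ - _]big_mkcond scaler_sumr -!sumrB.
    by apply: eq_bigr => j _; rewrite /c' !scalerBl; case: (j < m.+1)%N; rewrite ?scale1r ?scale0r.
  apply/eqP; rewrite -subr_eq0 -lE; apply/eqP; apply: (@eigen_inj _ i); rewrite lE linearB /=.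
  have -> : dd a (T m.+1) = etap r - s i *: T m.+1 by rewrite -eT addrK.
  have -> : dd a (etap y) = etap r - s i *: etap y by rewrite -ey addrK.
  by rewrite scaleNr [s i *: (T m.+1 - _)]scalerBr; exact: (@subBB R).
have [q qE] := Trange k (ltnW (ltn_ord k)); have [q' qE'] := Trange k.+1 (ltn_ord k).
by exists (q' - q); rewrite linearB /= -qE -qE' TS addrC addKr.
Qed.

Lemma pull_simple : msimple E (fun X => (exists k, X = a k.*2) \/ X = b 1%N).
Proof.
move=> U U0 UD UZ UE Uab; apply: xi_simple => // X [i ->].
have [p ->] := xi_etap i.
have st : forall p, mstable U (etap p); last exact: st.
apply: (proj1 (@qrel_gen _ _ a b (@mstable _ _ U) rel _ _ _ _ _)).
- by move=> Y Z hY hZ v Uv; rewrite mulmxDl; apply: UD; [exact: hY|exact: hZ].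
- by move=> Y Z hY hZ v Uv; rewrite mulmv; apply/hY/hZ.
- by move=> d Y hY v Uv; rewrite -scalemxAl; apply/UZ/hY.
- by move=> k; apply: Uab; left; exists k.
- by apply: Uab; right.
Qed.

Lemma pull_aC i j : a i.*2 * a j.*2 = a j.*2 * a i.*2.
Proof.
move: {2}(i + j)%N (erefl (i + j)%N) => m; elim/ltn_ind: m i j => m IH i j ij.
pose K := a i.*2 * a j.*2 - a j.*2 * a i.*2.
have Keta q : K * etap q = etap q * K.
  by rewrite /K; apply: qrel_comm_etap => // k l kl; apply: (IH (k + l)%N) => //; rewrite -ij.
have KS : K = (K 0 0)%:A.
  apply: (schur xi_simple) => [|Y [k ->]]; last by have [p ->] := xi_etap k.
  by rewrite mulrBl mulrBr -!mulrA !(pull_even_odd _).1 !mulrA !(pull_even_odd _).1.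
have K0 : K = 0.
  have : \tr K = 0 by rewrite raddfB /= -[a _ * _]/(_ *m _) mxtrace_mulC subrr.
  rewrite KS linearZ /= mxtrace1 => /eqP; rewrite mulf_eq0 pnatr_eq0 orbF => /eqP ->.
  by rewrite scale0r.
by apply/eqP; rewrite -subr_eq0 -/K K0.
Qed.

Lemma pull_mxtrace k : \tr (a k) = (espoly s)`_k * n0.+1%:R.
Proof.
rewrite -mxtrace1; apply: pull_trace => //; last exact: enum_uniq.
- by move=> d X Y; rewrite mxtraceD mxtraceZ.
- by move=> X Y; exact: mxtrace_mulC.
Qed.

End PullSimple.

Lemma sub_flip (R : pzRingType) (x y : R) : x - y - y = - (x - (x - y) - (x - y)).
Proof. by non_commutative_ring. Qed.

Lemma four_blocks (V : zmodType) (x a c d : V) :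
  c + (x - a - (d - c)) + (a - c + (d - c)) = x.
Proof.
have -> : x - a - (d - c) = x - (a + (d - c)) by rewrite (opprD a) addrA.
have -> : a - c + (d - c) = a + (d - c) - c by rewrite addrAC.
by move: (a + (d - c)) => t; rewrite addrC addrA subrK addrC subrK.
Qed.

(** * Permuting the parameters *)

Section Reorder.
Variables (F : numClosedFieldType) (n0 : nat).
Local Notation R := 'M[F]_n0.+1.

Lemma gcoef_odd (f : nat -> F) i : odd i -> gcoef f i = 0.
Proof. by rewrite /gcoef; case: i => //= i ->. Qed.

Lemma gcoef_trace n (s : 'I_n -> F) (xi : 'I_n -> R) (f : nat -> F) m :
  (forall i, xi i * xi i = (s i)%:A) -> (forall i j, i != j -> xi i * xi j = - (xi j * xi i)) ->
  \tr (\sum_(r < m.+1) gcoef f (m - r) *: pulla s xi (enum 'I_n) r) =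
  conv (gcoef f) (fun i => (espoly s)`_i) m * n0.+1%:R.
Proof.
move=> xi2 xiC; rewrite linear_sum conv_rev mulr_suml; apply: eq_bigr => r _.
by rewrite linearZ /= pull_mxtrace // mulrA.
Qed.

Lemma gcoef0E m (V : lmodType F) (g : nat -> V) (f : nat -> F) :
  (forall k, gcoef f k = (k == 0%N)%:R) -> \sum_(r < m.+1) gcoef f (m - r) *: g r = g m.
Proof.
move=> f0; rewrite big_ord_recr /= subnn f0 scale1r big1 ?add0r // => i _.
by rewrite f0 subn_eq0 leqNgt ltn_ord scale0r.
Qed.

(** The structure theorem is applied to V(s) itself: traces show that the roots of N are the -s_i up
    to order, so N also factors along s', which yields generators for s' with the same [a] and
    [b]. *)
Lemma pull_reorder (E : R) n n' (s : 'I_n -> F) (s' : 'I_n' -> F) (xi : 'I_n -> R)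
  (sigma : 'I_n' -> 'I_n) :
  (forall i, s i != 0) -> (forall i j, s i + s j != 0) ->
  (forall i, mxodd E (xi i)) -> (forall i, xi i * xi i = (s i)%:A) ->
  (forall i j, i != j -> xi i * xi j = - (xi j * xi i)) ->
  msimple E (fun X => exists i, X = xi i) ->
  bijective sigma -> (forall i, s' i = s (sigma i)) ->
  exists xi' : 'I_n' -> R,
    [/\ forall i, mxodd E (xi' i), forall i, xi' i * xi' i = (s' i)%:A,
        forall i j, i != j -> xi' i * xi' j = - (xi' j * xi' i),
        forall m, pulla s xi (enum 'I_n) m = pulla s' xi' (enum 'I_n') m /\
                  pullb s xi (enum 'I_n) m = pullb s' xi' (enum 'I_n') m
      & msimple E (fun X => exists i, X = xi' i)].
Proof.
move=> s0 sij xio xi2 xiC xiS sb ss'.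
have rel := pull_enum_qrel xi2 xiC.
have aC := pull_aC s0 sij xio xi2 xiC xiS.
have eo := pull_even_odd s xio.
have [N Nm NP] := qmodule_structure rel aC (fun k => (eo k.*2).1) (eo 1%N).2
  (pull_simple s0 sij xi2 xiC xiS).
have key k (t : 'I_k -> F) : N = \prod_(i < k) ('X + (t i)%:P) ->
    [/\ espoly s = espoly t, forall i, t i != 0 & exists xi' : 'I_k -> R,
    [/\ forall i, mxodd E (xi' i), forall i, xi' i * xi' i = (t i)%:A,
        forall i j, i != j -> xi' i * xi' j = - (xi' j * xi' i),
        forall m, pulla s xi (enum 'I_n) m = pulla t xi' (enum 'I_k) m /\
                  pullb s xi (enum 'I_n) m = pullb t xi' (enum 'I_k) m
      & msimple E (fun X => exists i, X = xi' i)]].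
  move=> NE; have [t0 tij [xi' [f [xo' xi2' xiC' abE xS']]]] := NP _ t NE.
  (* The zero sequence encodes the series 1; the operators of V(s) are read as their own twist by
     it, so that the traces can be compared. *)
  have d0 m : gcoef (fun=> 0 : F) m = (m == 0%N)%:R by rewrite /gcoef if_same; case: eqP.
  have h m : conv (gcoef (fun=> 0)) (fun i => (espoly s)`_i) m =
             conv (gcoef f) (fun i => (espoly t)`_i) m.
    have := congr1 (fun X : R => \tr X) (abE m).1; rewrite gcoef_trace //.
    rewrite -(gcoef0E _ (pulla s xi (enum 'I_n)) d0) gcoef_trace // => /mulIf -> //.
    by rewrite pnatr_eq0.
  have [||||||||est fE] := even_series_factor _ _ _ _ _ _ _ _ h => //; try exact: gcoef_odd.
  - exact: espoly0.
  - exact: espoly0.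
  - exact: espoly_coprime.
  - exact: espoly_coprime.
  split=> //; exists xi'; split=> // m; rewrite (abE m).1 (abE m).2.
  by rewrite !gcoef0E // => j; rewrite -fE.
have [r rE] := closed_field_poly_normal N.
pose t (i : 'I_(size r)) := - r`_i.
have Nt : N = \prod_(i < size r) ('X + (t i)%:P).
  rewrite {1}rE (monicP Nm) scale1r (big_nth 0) big_mkord; apply: eq_bigr => i _.
  by rewrite /t polyCN.
have [est t0 _] := key _ _ Nt.
have [tau taub tE] := espoly_inj s0 t0 est.
have Ns' : N = \prod_(i < n') ('X + (s' i)%:P).
  by rewrite (espoly_prod sb ss') Nt (espoly_prod taub tE).
by have [_ _] := key _ _ Ns'.
Qed.

End Reorder.

(** * Uniqueness of simple graded Clifford modules up to parity *)

Section CliffordUnique.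
Variables (F : numClosedFieldType) (n0 n1 : nat).
Local Notation R := 'M[F]_n0.+1.
Local Notation R1 := 'M[F]_n1.+1.
Variables (E : R) (E1 : R1) (n : nat) (s : 'I_n -> F) (xi : 'I_n -> R) (xi1 : 'I_n -> R1).
Hypothesis EE : E * E = E.
Hypothesis EE1 : E1 * E1 = E1.
Hypothesis s0 : forall i, s i != 0.
Hypothesis xi_odd : forall i, mxodd E (xi i).
Hypothesis xi2 : forall i, xi i * xi i = (s i)%:A.
Hypothesis xiC : forall i j, i != j -> xi i * xi j = - (xi j * xi i).
Hypothesis xi1_odd : forall i, mxodd E1 (xi1 i).
Hypothesis xi12 : forall i, xi1 i * xi1 i = (s i)%:A.
Hypothesis xi1C : forall i j, i != j -> xi1 i * xi1 j = - (xi1 j * xi1 i).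
Hypothesis simple0 : msimple E (fun X => exists i, X = xi i).
Hypothesis simple1 : msimple E1 (fun X => exists i, X = xi1 i).

Definition homhom (Phi : 'M[F]_(n1.+1, n0.+1)) :=
  Phi *m E = E1 *m Phi \/ Phi *m E = (1 - E1) *m Phi.

(** The parity operator up to sign: it commutes with E and anticommutes with odd operators. *)
Let P : R := 1 - E - E.
Let PP : P *m P = 1.
Proof.
rewrite -[P *m P]/(P * P) /P !mulrBr !mulrBl !mul1r !mulr1 !EE.
by rewrite subrr !sub0r !opprK !subrK.
Qed.
Let Pxi i : P *m xi i = - (xi i *m P).
Proof.
rewrite -[P *m _]/(P * xi i) -[_ *m P]/(xi i * P) /P !mulrBr !mulrBl mul1r mulr1 (xi_odd i).
by rewrite mulrBl mul1r; exact: (@sub_flip R).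
Qed.
Let PE : P *m E = E *m P.
Proof. by rewrite -[P *m E]/(P * E) -[E *m P]/(E * P) /P !mulrBr !mulrBl mul1r mulr1 EE. Qed.

Let intertwiner (l : seq 'I_n) : uniq l -> exists Phi : 'M[F]_(n1.+1, n0.+1),
  [/\ Phi != 0, homhom Phi & forall i, i \in l -> Phi *m xi i = xi1 i *m Phi].
Proof.
have xiE i : xi i *m E = (1 - E) *m xi i by exact: xi_odd.
have xi1E i : xi1 i *m E1 = (1 - E1) *m xi1 i by exact: xi1_odd.
have xi1E' i : xi1 i *m (1 - E1) = E1 *m xi1 i.
  by rewrite mulmxBr mulmx1 xi1E mulmxBl mul1mx subKr.
have xiC' i j : i != j -> xi i *m xi j = - (xi j *m xi i) by exact: xiC.
have xi1C' i j : i != j -> xi1 i *m xi1 j = - (xi1 j *m xi1 i) by exact: xi1C.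
have sq i : xi i *m xi i = s i *: 1%:M by exact: xi2.
have sq1 i : xi1 i *m xi1 i = s i *: 1%:M by exact: xi12.
elim: l => [_|j l IH /= /andP[jl ul]].
  have e2 : E *m E = E by exact: EE.
  have e12 : E1 *m E1 = E1 by exact: EE1.
  have f2 : (1 - E) *m E = 0 by rewrite mulmxBl mul1mx e2 subrr.
  have f12 : E1 *m (1 - E1) = 0 by rewrite mulmxBr mulmx1 e12 subrr.
  have g12 : (1 - E1) *m (1 - E1) = 1 - E1 by rewrite mulmxBl mul1mx f12 subr0.
  have h12 : (1 - E1) *m E1 = 0 by rewrite mulmxBl mul1mx e12 subrr.
  (* A and B are the even and odd parts of a nonzero map, so one of them is a nonzero homogeneous
     map. *)
  pose X : 'M[F]_(n1.+1, n0.+1) := delta_mx 0 0.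
  pose A := E1 *m X *m E + (1 - E1) *m X *m (1 - E).
  pose B := E1 *m X *m (1 - E) + (1 - E1) *m X *m E.
  have AB : A + B = X.
    rewrite /A /B !mulmxBr !mulmxBl !mulmx1 !mul1mx.
    set a := E1 *m X; set c := E1 *m X *m E; set d := X *m E.
    exact: (@four_blocks _ X a c d).
  have [A0|A0] := eqVneq A 0; last first.
    exists A; split=> //; left; rewrite /A mulmxDl mulmxDr -!mulmxA e2 f2 !mulmx0 addr0.
    by rewrite !mulmxA e12 f12 !mul0mx addr0.
  exists B; split=> //.
    apply/eqP => B0; move: AB; rewrite A0 B0 addr0 => /matrixP /(_ 0 0) /eqP.
    by rewrite !mxE !eqxx eq_sym oner_eq0.
  right; transitivity ((1 - E1) *m (X *m E)).
    by rewrite /B [LHS]mulmxDl -!mulmxA e2 f2 !mulmx0 add0r.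
  by rewrite /B [RHS]mulmxDr !mulmxA g12 h12 !mul0mx add0r.
have [Phi [P0 hP cP]] := IH ul.
have nji i : i \in l -> i != j by move=> il; apply: contraNneq jl => <-.
(* Averaging over xi_j makes the map intertwine xi_j too. If the average is 0, then Phi
   anti-intertwines xi_j, and xi1_j Phi P is a nonzero map intertwining all generators considered so
   far. *)
pose Psi := s j *: Phi + xi1 j *m Phi *m xi j.
have [Psi0|Psi0] := eqVneq Psi 0.
  have anti : xi1 j *m Phi = - (Phi *m xi j).
    have /(congr1 (mulmx^~ (xi j))) := Psi0; rewrite mul0mx mulmxDl -!mulmxA sq.
    rewrite -!scalemxAr mulmx1 -scalemxAl -scalerDr => /eqP.
    by rewrite scaler_eq0 (negbTE (s0 j)) addrC addr_eq0 => /eqP.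
  exists (xi1 j *m Phi *m P); split.
  - apply: contraNneq P0 => h; have : xi1 j *m (xi1 j *m Phi *m P) *m P = 0.
      by rewrite h mulmx0 mul0mx.
    rewrite -!mulmxA PP mulmx1 mulmxA sq1 -scalemxAl mul1mx => /eqP.
    by rewrite scaler_eq0 (negbTE (s0 j)).
  - case: hP => hP; [right|left].
      by rewrite -mulmxA PE mulmxA -[_ *m Phi *m E]mulmxA hP [xi1 j *m (_ *m _)]mulmxA xi1E -!mulmxA.
    by rewrite -mulmxA PE mulmxA -[_ *m Phi *m E]mulmxA hP [xi1 j *m (_ *m _)]mulmxA xi1E' -!mulmxA.
  move=> i; rewrite inE -!mulmxA Pxi !mulmxN => /predU1P[->|il].
    have anti' : Phi *m xi j = - (xi1 j *m Phi) by rewrite anti opprK.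
    by rewrite [Phi *m (_ *m _)]mulmxA anti' mulNmx mulmxN opprK -mulmxA.
  by rewrite [Phi *m (_ *m _)]mulmxA cP // [RHS]mulmxA xi1C' ?nji // mulNmx -!mulmxA.
exists Psi; split=> //.
- case: hP => hP; [left|right]; rewrite /Psi mulmxDl mulmxDr -scalemxAl hP -scalemxAr; congr (_ + _).
    have X1 : xi1 j *m Phi *m E = (1 - E1) *m (xi1 j *m Phi).
      by rewrite -mulmxA hP mulmxA xi1E -mulmxA.
    have Y : xi1 j *m Phi *m (1 - E) = E1 *m (xi1 j *m Phi).
      by rewrite mulmxBr mulmx1 X1 mulmxBl mul1mx subKr.
    by rewrite -[LHS]mulmxA xiE [LHS]mulmxA Y -!mulmxA.
  have X1 : xi1 j *m Phi *m E = E1 *m (xi1 j *m Phi).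
    by rewrite -mulmxA hP [LHS]mulmxA xi1E' -mulmxA.
  have Y : xi1 j *m Phi *m (1 - E) = (1 - E1) *m (xi1 j *m Phi).
    by rewrite mulmxBr mulmx1 X1 mulmxBl mul1mx.
  by rewrite -[LHS]mulmxA xiE [LHS]mulmxA Y -!mulmxA.
move=> i; rewrite inE /Psi mulmxDl mulmxDr -scalemxAl -scalemxAr => /predU1P[->|il].
  by rewrite -!mulmxA sq -!scalemxAr mulmx1 !mulmxA sq1 -!scalemxAl mul1mx addrC.
rewrite cP //; congr (_ + _); rewrite -mulmxA xiC' 1?eq_sym ?nji //.
rewrite mulmxN (mulmxA _ (xi i)) -(mulmxA (xi1 j)) cP // !mulmxA.
by rewrite (xi1C' _ _ (nji _ il)) !mulNmx.
Qed.

Lemma clifford_unique : exists (Phi : 'M[F]_(n1.+1, n0.+1)) (Psi : 'M[F]_(n0.+1, n1.+1)),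
  [/\ Psi *m Phi = 1%:M, Phi *m Psi = 1%:M, homhom Phi
    & forall i, Phi *m xi i = xi1 i *m Phi].
Proof.
have [Phi [P0 hP cP]] := intertwiner (enum_uniq 'I_n).
have {}cP i : Phi *m xi i = xi1 i *m Phi by apply: cP; rewrite mem_enum.
have inj (v : 'cV[F]_n0.+1) : Phi *m v = 0 -> v = 0.
  case: (simple0 (U := fun v => Phi *m v = 0)) => [|u w hu hw|c w hw|w hw|X [i ->] w hw|h|h].
  - by rewrite mulmx0.
  - by rewrite mulmxDr hu hw addr0.
  - by rewrite -scalemxAr hw scaler0.
  - by rewrite mulmxA; case: hP => ->; rewrite -mulmxA hw mulmx0.
  - by rewrite mulmxA cP -mulmxA hw mulmx0.
  - exact: h.
  case/eqP: P0; apply/matrixP => i j; have := h (delta_mx j 0).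
  by rewrite -colE => /matrixP /(_ i 0); rewrite !mxE.
have surj (w : 'cV[F]_n1.+1) : exists v : 'cV[F]_n0.+1, Phi *m v = w.
  case: (simple1 (U := fun w => exists v : 'cV[F]_n0.+1, Phi *m v = w)) =>
    [|u1 u2 [v1 <-] [v2 <-]|c u1 [v1 <-]|u1 [v1 <-]|X [i ->] u1 [v1 <-]|h|h].
  - by exists 0; rewrite mulmx0.
  - by exists (v1 + v2); rewrite mulmxDr.
  - by exists (c *: v1); rewrite scalemxAr.
  - case: hP => hP; first by exists (E *m v1); rewrite mulmxA hP -mulmxA.
    by exists (v1 - E *m v1); rewrite mulmxBr (mulmxA Phi) hP mulmxBl mul1mx mulmxBl subKr mulmxA.
  - by exists (xi i *m v1); rewrite mulmxA cP -mulmxA.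
  - case/eqP: P0; apply/matrixP => i j.
    have := h (Phi *m delta_mx j 0) (ex_intro _ (delta_mx j 0) erefl).
    by rewrite -colE => /matrixP /(_ i 0); rewrite !mxE.
  exact: h.
have [v vE] := fin_all_exists (fun j : 'I_n1.+1 => surj (delta_mx j 0)).
pose Psi : 'M[F]_(n0.+1, n1.+1) := \matrix_(i, j) v j i 0.
have PP1 : Phi *m Psi = 1%:M.
  apply/matrixP => i j; have /matrixP /(_ i 0) := vE j; rewrite !mxE andbT => <-.
  by apply: eq_bigr => k _; rewrite !mxE.
exists Phi, Psi; split=> //.
suff h : Psi *m Phi - 1%:M = 0 by apply/eqP; rewrite -subr_eq0 h.
apply/matrixP => i j; have := inj (col j (Psi *m Phi - 1%:M)).
rewrite colE mulmxA mulmxBr mulmxA PP1 mul1mx mulmx1 subrr mul0mx => /(_ erefl).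
by rewrite -colE => /matrixP /(_ i 0); rewrite !mxE.
Qed.

Lemma pull_intertwine (Phi : 'M[F]_(n1.+1, n0.+1)) (l : seq 'I_n) :
  (forall i, Phi *m xi i = xi1 i *m Phi) -> forall k,
  Phi *m pulla s xi l k = pulla s xi1 l k *m Phi /\
  Phi *m pullb s xi l k = pullb s xi1 l k *m Phi.
Proof.
move=> cP; elim: l => [|i l IH] k.
  rewrite /pulla /pullb /= mulmx0 mul0mx; split=> //.
  by case: (k == 0%N); rewrite ?mulmx0 ?mul0mx // mulmx1 mul1mx.
case: k => [|k]; first by rewrite !pulla0 !pullb0 mulmx0 mul0mx mulmx1 mul1mx.
have [[ha hb] [ha' hb']] := (IH k, IH k.+1).
have xX (X : R) (X1 : R1) : Phi *m X = X1 *m Phi ->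
    Phi *m asgn k.+1 (xi i * X) = asgn k.+1 (xi1 i * X1) *m Phi.
  move=> h; have e : Phi *m (xi i * X) = (xi1 i * X1) *m Phi.
    by rewrite -[xi i * X]/(_ *m _) -[xi1 i * X1]/(_ *m _) mulmxA cP -mulmxA h mulmxA.
  by rewrite /asgn; case: ifP; rewrite ?mulmxN ?mulNmx e.
rewrite !pulla_cons !pullb_cons !mulmxDr !mulmxDl !mulmxN !mulNmx -!scalemxAr -!scalemxAl.
by rewrite (xX _ _ hb) (xX _ _ ha) ha hb ha' hb'.
Qed.

End CliffordUnique.

(** * Translation between indexed operators and matrices *)

Definition CCC : numClosedFieldType := complex Rdefinitions.R.

Lemma fin_enum (B : finType) : (0 < #|B|)%N ->
  exists (n0 : nat) (f : 'I_n0.+1 -> B) (g : B -> 'I_n0.+1), cancel f g /\ cancel g f.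
Proof.
move=> B0; have e := prednK B0.
exists #|B|.-1, (fun i => enum_val (cast_ord e i)), (fun x => cast_ord (esym e) (enum_rank x)).
by split=> x; rewrite ?enum_valK ?cast_ordK // cast_ordKV enum_rankK.
Qed.

Section ToMatrix.
Variables (B1 B2 B3 : finType) (m1 m2 m3 : nat).
Variables (f1 : 'I_m1 -> B1) (f2 : 'I_m2 -> B2) (f3 : 'I_m3 -> B3).
Variables (g1 : B1 -> 'I_m1) (g2 : B2 -> 'I_m2).
Hypotheses (fK1 : cancel f1 g1) (gK1 : cancel g1 f1).
Hypotheses (fK2 : cancel f2 g2) (gK2 : cancel g2 f2).

Definition toM (h1 : 'I_m1 -> B1) (h2 : 'I_m2 -> B2) (A : mx B1 B2) : 'M[CCC]_(m1, m2) :=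
  \matrix_(i, j) A (h1 i) (h2 j).
Definition ofM (X : 'M[CCC]_(m1, m2)) : mx B1 B2 := fun x y => X (g1 x) (g2 y).

Lemma toM_meq A A' : meq A A' -> toM f1 f2 A = toM f1 f2 A'.
Proof. by move=> h; apply/matrixP => i j; rewrite !mxE h. Qed.
Lemma toM_inj A A' : toM f1 f2 A = toM f1 f2 A' -> meq A A'.
Proof. by move=> /matrixP h x y; have := h (g1 x) (g2 y); rewrite !mxE gK1 gK2. Qed.
Lemma ofMK X : toM f1 f2 (ofM X) = X.
Proof. by apply/matrixP => i j; rewrite mxE /ofM fK1 fK2. Qed.
Lemma toM_madd A A' : toM f1 f2 (madd A A') = toM f1 f2 A + toM f1 f2 A'.
Proof. by apply/matrixP => i j; rewrite !mxE. Qed.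
Lemma toM_msub A A' : toM f1 f2 (msub A A') = toM f1 f2 A - toM f1 f2 A'.
Proof. by apply/matrixP => i j; rewrite !mxE. Qed.
Lemma toM_mscale c A : toM f1 f2 (mscale c A) = (c : CCC) *: toM f1 f2 A.
Proof. by apply/matrixP => i j; rewrite !mxE. Qed.
Lemma toM_mzero : toM f1 f2 mzero = 0.
Proof. by apply/matrixP => i j; rewrite !mxE. Qed.

End ToMatrix.

Lemma toM_mmul (B1 B2 B3 : finType) (m1 m2 m3 : nat) (f1 : 'I_m1 -> B1) (f2 : 'I_m2 -> B2)
    (f3 : 'I_m3 -> B3) (g2 : B2 -> 'I_m2) (A : mx B1 B2) (A' : mx B2 B3) :
  cancel f2 g2 -> cancel g2 f2 ->
  toM f1 f3 (mmul A A') = toM f1 f2 A *m toM f2 f3 A'.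
Proof.
move=> fK gK; apply/matrixP => i j; rewrite !mxE /mmul (reindex f2) /=.
  by apply: eq_bigr => k _; rewrite !mxE.
by apply: onW_bij; exists g2.
Qed.

Lemma toM_mid (B : finType) m (f : 'I_m.+1 -> B) : injective f ->
  toM f f (@mid B) = 1 :> 'M[CCC]_m.+1.
Proof. by move=> fi; apply/matrixP => i j; rewrite !mxE /mid (inj_eq fi). Qed.

Section Graded.
Variables (B : finType) (par : B -> bool) (n0 : nat) (f : 'I_n0.+1 -> B) (g : B -> 'I_n0.+1).
Hypotheses (fK : cancel f g) (gK : cancel g f).

Definition evenM : 'M[CCC]_n0.+1 := diag_mx (\row_i (~~ par (f i))%:R).

Lemma evenM_idem : evenM * evenM = evenM.
Proof.
apply/matrixP => i j; rewrite -[evenM * _]/(evenM *m _) /evenM mul_diag_mx !mxE.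
by case: (par (f i)); rewrite ?mul0r ?mul1r //= mul0rn.
Qed.

Lemma evenM_comm A : homog par false A -> toM f f A * evenM = evenM * toM f f A.
Proof.
move=> h; apply/matrixP => i j.
rewrite -[toM f f A * _]/(_ *m _) -[evenM * _]/(_ *m _) /evenM mul_mx_diag mul_diag_mx !mxE.
have [pp|] := eqVneq (par (f i)) (par (f j)); first by rewrite pp mulrC.
by move=> pp; rewrite h ?mul0r ?mulr0 //; move: pp; case: (par _); case: (par _).
Qed.

Lemma mxoddP (X : 'M[CCC]_n0.+1) :
  mxodd evenM X <-> forall i j, par (f i) = par (f j) -> X i j = 0.
Proof.
have E i j : (X * evenM) i j = X i j * (~~ par (f j))%:R.
  by rewrite -[X * _]/(_ *m _) /evenM mul_mx_diag !mxE.
have E' i j : ((1 - evenM) * X) i j = X i j - (~~ par (f i))%:R * X i j.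
  by rewrite mulrBl mul1r -[evenM * _]/(_ *m _) /evenM mul_diag_mx !mxE.
split=> [h i j pp|h].
  have := congr1 (fun Y : 'M[CCC]_n0.+1 => Y i j) h; rewrite E E' pp.
  case: (par (f j)); rewrite ?mulr0 ?mul0r ?subr0 ?mulr1 ?mul1r ?subrr // => <- //.
apply/matrixP => i j; rewrite E E'.
have [/h ->|] := eqVneq (par (f i)) (par (f j)); first by rewrite mul0r mulr0 subrr.
by case: (par (f i)); case: (par (f j)) => //= _; rewrite ?mulr0 ?mul0r ?subr0 ?mulr1 ?mul1r ?subrr.
Qed.

Lemma homog_mxodd A : homog par true A -> mxodd evenM (toM f f A).
Proof. by move=> h; apply/mxoddP => i j pp; rewrite mxE h // pp addbb. Qed.

Lemma gr_simple_msimple (I : Type) (ops : I -> mx B B) : gr_simple par ops ->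
  msimple evenM (fun X => exists i, X = toM f f (ops i)).
Proof.
move=> [_ h] U U0 UD UZ UE Uo.
pose c (v : B -> CC) : 'cV[CCC]_n0.+1 := \col_i v (f i).
have cK (v : 'cV[CCC]_n0.+1) : c (fun x => v (g x) 0) = v.
  by apply/colP => i; rewrite mxE fK.
have : graded_stable_subspace par ops (fun v => U (c v)).
  split.
  - by rewrite (_ : c _ = 0) //; apply/colP => i; rewrite !mxE.
  - move=> v w Uv Uw; rewrite (_ : c _ = c v + c w); first exact: UD.
    by apply/colP => i; rewrite !mxE.
  - move=> d v Uv; rewrite (_ : c _ = (d : CCC) *: c v); first exact: UZ.
    by apply/colP => i; rewrite !mxE.
  - move=> v Uv; rewrite (_ : c _ = evenM *m c v); first exact: UE.
    apply/colP => i; rewrite /evenM mul_diag_mx !mxE.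
    by case: (par (f i)); rewrite ?mul0r ?mul1r.
  - move=> i v Uv; rewrite (_ : c _ = toM f f (ops i) *m c v).
      by apply: (Uo (toM f f (ops i))) => //; exists i.
    apply/colP => j; rewrite !mxE /mapp (reindex f) /=.
      by apply: eq_bigr => k _; rewrite !mxE.
    by apply: onW_bij; exists g.
case/h => {}h; [left|right] => v.
  rewrite -(cK v) => /h hv; apply/colP => i; rewrite mxE /= hv mxE //.
by rewrite -(cK v); exact: h.
Qed.

Lemma msimple_gr_simple (I : Type) (xi : I -> 'M[CCC]_n0.+1) :
  msimple evenM (fun X => exists i, X = xi i) -> gr_simple par (fun i => ofM g g (xi i)).
Proof.
move=> h; split; first by apply/card_gt0P; exists (f 0).
move=> U [U0 UD UZ UE Uo].
pose c (v : 'cV[CCC]_n0.+1) : B -> CC := fun x => v (g x) 0.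
have cE (v : B -> CC) : c (\col_i v (f i)) = v.
  by apply: functional_extensionality => x; rewrite /c mxE gK.
case: (h (fun v => U (c v))).
- by rewrite (_ : c 0 = fun=> 0) //; apply: functional_extensionality => x; rewrite /c mxE.
- move=> v w Uv Uw; rewrite (_ : c _ = fun x => c v x + c w x); first exact: UD.
  by apply: functional_extensionality => x; rewrite /c mxE.
- move=> d v Uv; rewrite (_ : c _ = fun x => (d : CC) * c v x); first exact: UZ.
  by apply: functional_extensionality => x; rewrite /c mxE.
- move=> v Uv; rewrite (_ : c _ = fun x => if par x then 0 else c v x); first exact: UE.
  apply: functional_extensionality => x; rewrite /c /evenM mul_diag_mx !mxE gK.
  by case: (par x); rewrite ?mul0r ?mul1r.
- move=> X [i ->] v Uv; rewrite (_ : c _ = mapp (ofM g g (xi i)) (c v)); first exact: Uo.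
  apply: functional_extensionality => x; rewrite /c /mapp !mxE [RHS](reindex f) /=.
    by apply: eq_bigr => k _; rewrite /ofM fK.
  by apply: onW_bij; exists g.
- move=> hU; left => v Uv x; rewrite -(cE v) in Uv; have := hU _ Uv.
  by move=> /colP /(_ (g x)); rewrite !mxE gK.
by move=> hU; right => v; rewrite -(cE v); exact: hU.
Qed.

End Graded.

Lemma regroup (R : pzRingType) (p q x y z w : R) :
  p + q - ((x + y) + (z + w)) = (p - x - w) + (q - y - z).
Proof. by non_commutative_ring. Qed.

(** * The sums Sigma_k and the recursive operators *)

Section SigmaPull.
Variables (F : numFieldType) (R : algType F) (n : nat) (s : 'I_n -> F) (xi : 'I_n -> R).

Fixpoint sprod (l : seq 'I_n) : R :=
  if l is i :: l' then ((s i)%:A + (-1) ^+ size l' *: xi i) * sprod l' else 1.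

Let Ssum l k := \sum_(S : {set 'I_n} | (S \subset [set i in l]) && (#|S| == k))
  sprod [seq i <- l | i \in S].

(** Subsets are split by membership of i; when present, i is the first factor and has k factors
    after it, which fixes its sign. *)
Let Ssum_cons i l k : i \notin l -> uniq l -> Ssum (i :: l) k.+1 =
  Ssum l k.+1 + ((s i)%:A + (-1) ^+ k *: xi i) * Ssum l k.
Proof.
move=> il ul; rewrite /Ssum (bigID (fun S : {set 'I_n} => i \in S)) /= addrC; congr (_ + _).
  apply: eq_big => [S|S /andP[_ iS]]; last by rewrite (negbTE iS).
  rewrite -andbA andbC -andbA; case iS: (i \in S); rewrite /= ?andbF ?andbT.
    apply/esym/negP => /andP[/subsetP /(_ _ iS)]; rewrite inE (negbTE il) //.
  rewrite [RHS]andbC; congr (_ && _); apply/subsetP/subsetP => h j jS; have := h j jS; rewrite !inE; last by move=> ->; rewrite orbT.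
  by case/predU1P => // ji; rewrite -ji jS in iS.
rewrite (reindex_onto (fun S : {set 'I_n} => i |: S) (fun S => S :\ i)) /=; last first.
  by move=> S /andP[_ iS]; rewrite setD1K.
rewrite mulr_sumr; apply: eq_big => [S|S].
  rewrite setU11 andbT; have [iS|iS] := boolP (i \in S).
    have -> : (i |: S) :\ i == S = false.
      by apply/eqP => h; move: iS; rewrite -h !inE eqxx.
    rewrite andbF; apply/esym/negP => /andP[/subsetP /(_ _ iS)]; by rewrite inE (negbTE il).
  rewrite setU1K // eqxx andbT cardsU1 iS add1n eqSS; congr (_ && _).
  apply/subsetP/subsetP => h j.
    by move=> jS; have := h j; rewrite !inE jS orbT => /(_ isT) /predU1P[ji|//]; rewrite -ji jS in iS.
  by rewrite !inE => /predU1P[->|/h]; rewrite ?eqxx // inE => ->; rewrite orbT.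
move=> /andP[/andP[/andP[sS /eqP c] _] /eqP h]; rewrite setU11 /=.
have iS : i \notin S by rewrite -h !inE eqxx.
have -> : [seq x <- l | x \in i |: S] = [seq x <- l | x \in S].
  apply: eq_in_filter => x xl; rewrite !inE; case: eqP => // xi'; by rewrite -xi' xl in il.
have -> // : size [seq x <- l | x \in S] = k.
move: c; rewrite cardsU1 iS add1n => -[<-]; rewrite -(card_uniqP (filter_uniq _ ul)).
apply: eq_card => x; rewrite mem_filter; case xS: (x \in S) => //=.
have := subsetP sS x; rewrite !inE xS orbT => /(_ isT) /predU1P[xi'|//].
by rewrite -xi' xS in iS.
Qed.

Let Ssum0 l : Ssum l 0 = 1.
Proof.
rewrite /Ssum (big_pred1 set0) => [|S /=].
  by rewrite (eq_filter (a2 := pred0)) ?filter_pred0 // => x; rewrite inE.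
by rewrite cards_eq0 andbC; case: eqP => // ->; rewrite sub0set.
Qed.

Lemma Ssum_pull l k : uniq l -> (-1) ^+ k *: Ssum l k = pulla s xi l k + pullb s xi l k.
Proof.
elim: l k => [|i l IH] [|k] ul; rewrite ?Ssum0 ?expr0 ?scale1r ?pulla0 ?pullb0 ?addr0 //.
  rewrite /Ssum big_pred0 ?scaler0 => [|S]; first by [].
  apply/negP => /andP[/subset_leq_card h /eqP c]; move: h; rewrite c leqNgt.
  by rewrite (_ : [set i0 in [::]] = set0) ?cards0 //; apply/setP => x; rewrite !inE.
have /andP[il ul'] := ul; rewrite Ssum_cons // pulla_cons pullb_cons scalerDr IH //.
rewrite [X in _ + X](_ : _ =
    - (s i *: (pulla s xi l k + pullb s xi l k) +
       (-1) ^+ k *: (xi i * (pulla s xi l k + pullb s xi l k)))); last first.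
  rewrite -IH // mulrDl -!scalerAl mul1r -scalerAr exprS mulN1r scaleNr; congr (- _).
  by rewrite scalerDr !scalerA mulrC.
have asE X : asgn k.+1 X = - ((-1) ^+ k *: X) :> R.
  rewrite /asgn /= -signr_odd; case: (odd k); rewrite ?expr0 ?expr1 ?scale1r //.
  by rewrite scaleN1r opprK.
by rewrite !asE mulrDr !scalerDr; exact: (@regroup R).
Qed.

Lemma sum_sprod k : (-1) ^+ k *: (\sum_(S : {set 'I_n} | #|S| == k) sprod (enum S)) =
  pulla s xi (enum 'I_n) k + pullb s xi (enum 'I_n) k.
Proof.
rewrite -Ssum_pull ?enum_uniq //; congr (_ *: _); rewrite /Ssum; apply: eq_big => S.
  by rewrite (_ : S \subset _) //; apply/subsetP => x _; rewrite inE mem_enum.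
by move=> _; rewrite {1}/enum_mem enumT.
Qed.

End SigmaPull.

Lemma evenM_comm_entry (B : finType) (par : B -> bool) n0 (f : 'I_n0.+1 -> B)
    (X : 'M[CCC]_n0.+1) i j :
  X * evenM par f = evenM par f * X -> par (f i) != par (f j) -> X i j = 0.
Proof.
move=> /(congr1 (fun Y : 'M[CCC]_n0.+1 => Y i j)).
rewrite -[X * _]/(_ *m _) -[evenM _ _ * _]/(_ *m _) /evenM mul_mx_diag mul_diag_mx !mxE.
case: (par (f i)); case: (par (f j)) => //=; rewrite ?mulr1 ?mul0r ?mul1r ?mulr0 // => ->.
Qed.

Section PullV.
Variables (n : nat) (s : 'I_n -> CC) (M : hmod n) (n0 : nat).
Variables (f : 'I_n0.+1 -> hbase n M) (g : hbase n M -> 'I_n0.+1).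
Hypotheses (fK : cancel f g) (gK : cancel g f).
Hypothesis odd_xi : forall i, homog (hpar n M) true (hxi n M i).

Let xi (i : 'I_n) : 'M[CCC]_n0.+1 := toM f f (hxi n M i).
Let E := evenM (hpar n M) f.
Let sC : 'I_n -> CCC := s.

Lemma toM_sigma_prod l : toM f f (sigma_prod s M l) = sprod sC xi l.
Proof.
elim: l => [|i l IH]; first exact: (toM_mid (can_inj fK)).
rewrite /= (toM_mmul _ _ _ _ fK gK) IH toM_madd !toM_mscale toM_mid //.
exact: (can_inj fK).
Qed.

Lemma toM_Sigma k : toM f f (Sigma s M k) =
  \sum_(S : {set 'I_n} | #|S| == k) sprod sC xi (enum S).
Proof.
apply/matrixP => i j; rewrite mxE summxE /Sigma; apply: eq_bigr => S _.
by rewrite -toM_sigma_prod mxE.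
Qed.

Lemma toM_phi k : toM f f (phi11 s M k) = pulla sC xi (enum 'I_n) k /\
  toM f f (phim11 s M k) = pullb sC xi (enum 'I_n) k.
Proof.
have xo i : mxodd E (xi i) by apply: homog_mxodd.
have [ea ob] := pull_even_odd sC xo k.
have := sum_sprod sC xi k; rewrite -toM_Sigma => /matrixP h.
have o := (mxoddP _ _ _).1 ob; have e i j := evenM_comm_entry (i := i) (j := j) ea.
split; apply/matrixP => i j; have := h i j; rewrite !mxE /phi11 /phim11 /mscale /even_part /odd_part;
  have [pp|pp] := eqVneq (hpar n M (f i)) (hpar n M (f j)).
- by rewrite o // addr0.
- by rewrite e // mulr0.
- by rewrite o // mulr0.
- by rewrite e // add0r.
Qed.

Lemma toM_pullV i j k : toM f f (Tn (pullV s M) i j k) =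
  (if j then (-1) ^+ k else 1) *:
    (if i == j then pulla sC xi (enum 'I_n) k else pullb sC xi (enum 'I_n) k).
Proof.
have [ha hb] := toM_phi k; case: k ha hb => [|k] ha hb.
  rewrite /Tn /= expr0 if_same scale1r pulla0 pullb0; case: (i == j); last exact: toM_mzero.
  exact: (toM_mid (can_inj fK)).
case: i; case: j; rewrite /= ?scale1r.
- by transitivity ((-1) ^+ k.+1 *: toM f f (phi11 s M k.+1)); [exact: toM_mscale|rewrite ha].
- exact: hb.
- by transitivity ((-1) ^+ k.+1 *: toM f f (phim11 s M k.+1)); [exact: toM_mscale|rewrite hb].
- exact: ha.
Qed.

End PullV.

Section TensGamma.
Variables (W : smod) (fc : nat -> CC) (n0 : nat) (f : 'I_n0.+1 -> sbase W).

(** Odd generators vanish on Gamma_f, so only k = j survives in the coproduct, and both of its signs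
    are then 1. *)
Lemma toM_tens_Gamma i j m :
  toM (fun k => (f k, tt)) (fun k => (f k, tt)) (Tn (tens W (Gamma fc)) i j m) =
  \sum_(r < m.+1) gcoef (fc : nat -> CCC) (m - r) *: toM f f (Tn W i j r).
Proof.
have G k j' r : Tn (Gamma fc) k j' r tt tt = if k == j' then gcoef (fc : nat -> CCC) r else 0.
  by case: r => [|r]; rewrite /Tn /gcoef /=; case: (k == j') => //; case: (odd r).
apply/matrixP => x y; rewrite summxE mxE; case: m => [|m].
  rewrite big_ord1 !mxE /Tn /gcoef /= mul1r; case: (i == j) => //.
  by rewrite /mid xpair_eqE andbT.
rewrite [LHS]/=; apply: eq_bigr => r _; rewrite !mxE big_bool /= !G.
case: j => /=; rewrite ?addbF ?addbT ?andbF /= ?mulr0 ?addr0 ?add0r ?negbK ?andbN /=;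
  by case: i => /=; rewrite /sgn /= ?mul1r mulrC.
Qed.

End TensGamma.

Lemma YQ_iso_of_mx (V W : smod) m0 m1 (f0 : 'I_m0.+1 -> sbase V) (g0 : sbase V -> 'I_m0.+1)
    (f1 : 'I_m1.+1 -> sbase W) (g1 : sbase W -> 'I_m1.+1)
    (Phi : 'M[CCC]_(m1.+1, m0.+1)) (Psi : 'M[CCC]_(m0.+1, m1.+1)) :
  cancel f0 g0 -> cancel g0 f0 -> cancel f1 g1 -> cancel g1 f1 ->
  Psi *m Phi = 1%:M -> Phi *m Psi = 1%:M ->
  (forall i j, spar W (f1 i) != spar V (f0 j) -> Phi i j = 0) ->
  (forall i j m, Phi *m toM f0 f0 (Tn V i j m) = toM f1 f1 (Tn W i j m) *m Phi) ->
  YQ_iso V W.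
Proof.
move=> fK0 gK0 fK1 gK1 h1 h2 hp hT; exists (ofM g1 g0 Phi), (ofM g0 g1 Psi); split.
- by move=> y x; rewrite -{1}(gK1 y) -{1}(gK0 x) => /hp.
- apply: (toM_inj (f1 := f0) (f2 := f0) gK0 gK0).
  by rewrite (toM_mmul _ _ _ _ fK1 gK1) !ofMK // h1 toM_mid //; exact: (can_inj fK0).
- apply: (toM_inj (f1 := f1) (f2 := f1) gK1 gK1).
  by rewrite (toM_mmul _ _ _ _ fK0 gK0) !ofMK // h2 toM_mid //; exact: (can_inj fK1).
move=> i j m; apply: (toM_inj (f1 := f1) (f2 := f0) gK1 gK0).
by rewrite (toM_mmul _ _ _ _ fK0 gK0) (toM_mmul _ _ _ _ fK1 gK1) !ofMK.
Qed.

Lemma YQ_iso_trace (V W : smod) m0 m1 (f0 : 'I_m0.+1 -> sbase V) (g0 : sbase V -> 'I_m0.+1)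
    (f1 : 'I_m1.+1 -> sbase W) (g1 : sbase W -> 'I_m1.+1) i j m :
  cancel f0 g0 -> cancel g0 f0 -> cancel f1 g1 -> cancel g1 f1 ->
  YQ_iso V W \/ YQ_iso V (Pi W) ->
  \tr (toM f0 f0 (Tn V i j m)) = \tr (toM f1 f1 (Tn W i j m)).
Proof.
move=> fK0 gK0 fK1 gK1 iso.
have [Phi [Psi [h1 h2]]] : exists Phi Psi, [/\ meq (mmul Psi Phi) (@mid (sbase V)),
    meq (mmul Phi Psi) (@mid (sbase W)) & meq (mmul Phi (Tn V i j m)) (mmul (Tn W i j m) Phi)].
  by case: iso => -[Phi [Psi [_ ? ? h]]]; exists Phi, Psi; split=> //; exact: h.
move=> /(toM_meq f1 f0); rewrite (toM_mmul _ _ _ _ fK0 gK0) (toM_mmul _ _ _ _ fK1 gK1) => h.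
move/(toM_meq f0 f0): h1; rewrite (toM_mmul _ _ _ _ fK1 gK1) (toM_mid (can_inj fK0)) => h1.
move/(toM_meq f1 f1): h2; rewrite (toM_mmul _ _ _ _ fK0 gK0) (toM_mid (can_inj fK1)) => h2.
have {}h1 : toM f0 f1 Psi *m toM f1 f0 Phi = 1%:M := h1.
have {}h2 : toM f1 f0 Phi *m toM f0 f1 Psi = 1%:M := h2.
by rewrite -[toM f0 f0 (Tn V i j m)]mul1mx -h1 -mulmxA h mxtrace_mulC -mulmxA h2 mulmx1.
Qed.

(** * Extracting [qrel] from the relations of YQ(1) *)

Section YQAbstract.
Variables (F : numFieldType) (R : algType F) (T : bool -> bool -> int -> R).
Let sg (c : bool) : F := if c then -1 else 1.
Hypothesis H : forall i j k l (r s : int),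
  sg ((i && k) (+) (i && l) (+) (k && l)) *:
    ((T i j (r + 2) * T k l s - sg ((i (+) j) && (k (+) l)) *: (T k l s * T i j (r + 2))) -
     (T i j r * T k l (s + 2) - sg ((i (+) j) && (k (+) l)) *: (T k l (s + 2) * T i j r))) =
  (T k j (r + 1) * T i l s - T k j s * T i l (r + 1)) +
  (T k j r * T i l (s + 1) - T k j (s + 1) * T i l r) -
  sg (k (+) l) *: ((T (~~ k) j (r + 1) * T (~~ i) l s - T k (~~ j) s * T i (~~ l) (r + 1)) -
     (T (~~ k) j r * T (~~ i) l (s + 1) - T k (~~ j) (s + 1) * T i (~~ l) r)).
Variables (a b : nat -> R).
Hypothesis Tff : forall m, T false false (Posz m) = a m.
Hypothesis Ttf : forall m, T true false (Posz m) = b m.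
Hypothesis Ttt : forall m, T true true (Posz m) = asgn m (a m).
Hypothesis Tft : forall m, T false true (Posz m) = asgn m (b m).
Hypothesis Tneg : forall i j, T i j (-1) = 0.
Hypotheses (a0 : a 0%N = 1) (b0 : b 0%N = 0).
Let P2 (m : nat) : (Posz m + 2)%R = Posz m.+2. Proof. by rewrite -PoszD addn2. Qed.
Let P1 (m : nat) : (Posz m + 1)%R = Posz m.+1. Proof. by rewrite -PoszD addn1. Qed.
Let N2 : (-1 + 2 : int)%R = Posz 1. Proof. by []. Qed.
Let N1 : (-1 + 1 : int)%R = Posz 0. Proof. by []. Qed.
#[local] Instance alg_ring_ops14 : @Ring_ops R 0 1 (fun x y => x + y) (fun x y => x * y)
  (fun x y => x - y) (fun x => - x) (@eq R) := nc_ring_ops R.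
#[local] Instance alg_ring14 : @Ring R _ _ _ _ _ _ _ alg_ring_ops14 := nc_ring R.

Let eq_of_sub (x y z w : R) : z = w -> x - y = z - w -> x = y.
Proof. by move=> -> ; rewrite subrr => /eqP; rewrite subr_eq0 => /eqP. Qed.

(** With one index equal to -1, the negative coefficients vanish and the coefficients of index 0 are
    scalars, so the defining relation becomes one for T^(1). *)
Let aa1 s : a 1%N * a s = a s * a 1%N.
Proof.
have := H false false false false (-1) (Posz s).
rewrite /sg /= N2 N1 !Tneg !(Tff, Ttf, Ttt, Tft) a0 b0 !scale1r /asgn /= => h.
by apply: (eq_of_sub h); case: (odd s); non_commutative_ring.
Qed.
Let ba1 s : b s * a 1%N = a 1%N * b s.
Proof.
have := H true false false false (Posz s) (-1).
rewrite /sg /= N2 N1 !Tneg P2 P1 !(Tff, Ttf, Ttt, Tft) a0 b0 !scale1r /asgn /= => h.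
by apply: (eq_of_sub (esym h)); case: (odd s); non_commutative_ring.
Qed.
Let qba s : b 1%N * a s - a s * b 1%N = if odd s then 0 else b s + b s.
Proof.
have := H true false false false (-1) (Posz s).
rewrite /sg /= N2 N1 !Tneg !(Tff, Ttf, Ttt, Tft) a0 b0 !scale1r /asgn /= => h.
by apply: (eq_of_sub h); case: (odd s); non_commutative_ring.
Qed.
Let qbb s : b 1%N * b s + b s * b 1%N = if odd s then - (a s + a s) else 0.
Proof.
have := H true false true false (-1) (Posz s).
rewrite /sg /= N2 N1 !Tneg !(Tff, Ttf, Ttt, Tft) a0 b0 !scaleN1r /asgn /= => h.
by apply: (eq_of_sub (esym h)); case: (odd s); non_commutative_ring.
Qed.
(** With second index 0 the commutator with T^(0) drops out and the one with T^(2) remains; the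
    centrality of T^(1) reorders the right-hand side. *)
Let qab s : a 2%N * b s - b s * a 2%N = - (b s.+1 + b s.+1) + a s * b 1%N +
   (if odd s then - (b 1%N * a s) else b 1%N * a s).
Proof.
have := H true false false false (Posz s) (Posz 0).
rewrite /sg !P2 !P1 !(Tff, Ttf, Ttt, Tft) a0 b0 !scale1r /asgn /= => h.
have k := ba1 s; apply: (eq_of_sub (f_equal2 (fun x y => x + y) h k)).
by case: (odd s) => /=; non_commutative_ring.
Qed.
Let qaa s : a 2%N * a s - a s * a 2%N = b s * b 1%N +
   (if odd s then - (b 1%N * b s) else b 1%N * b s).
Proof.
have := H false false false false (Posz s) (Posz 0).
rewrite /sg !P2 !P1 !(Tff, Ttf, Ttt, Tft) a0 b0 !scale1r /asgn /= => h.
have k := aa1 s; apply: (eq_of_sub (f_equal2 (fun x y => x + y) h (esym k))).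
by case: (odd s) => /=; non_commutative_ring.
Qed.

Lemma YQ_abstract_qrel : qrel a b.
Proof. exact: (QRel a0 b0 qba qbb qab qaa). Qed.

Lemma YQ_abstract_aC i j : a i.*2 * a j.*2 = a j.*2 * a i.*2.
Proof.
pose c r s := a r * a s - a s * a r.
(* Adding the relations for (r, s) and (s, r) cancels the right-hand sides when the parities agree.
   Shifting by two then moves a commutator of even indices to one with a_0 = 1. *)
have step r s : odd r = odd s -> c r.+2 s = c r s.+2.
  move=> rs; have := H false false false false (Posz r) (Posz s).
  have := H false false false false (Posz s) (Posz r).
  rewrite /sg !P2 !P1 !(Tff, Ttf, Ttt, Tft) !scale1r /asgn /= rs => h1 h2.
  apply: (@eq_double F); apply: (eq_of_sub (f_equal2 (fun x y => x + y) h2 h1)).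
  by rewrite /c; case: (odd s) => /=; non_commutative_ring.
have h k l : c k.*2 l.*2 = 0.
  elim: l k => [|l IH] k; first by rewrite /c a0 mul1r mulr1 subrr.
  by rewrite doubleS -step ?odd_double // -doubleS IH.
by have := h i j; rewrite /c => /eqP; rewrite subr_eq0 => /eqP.
Qed.

End YQAbstract.

Section YQModule.
Variables (V : smod) (n0 : nat) (f : 'I_n0.+1 -> sbase V) (g : sbase V -> 'I_n0.+1).
Hypotheses (fK : cancel f g) (gK : cancel g f) (hV : is_YQmod V).

Let T i j (z : int) : 'M[CCC]_n0.+1 := toM f f (Tz V i j z).
Definition YQa k := toM f f (Tn V false false k).
Definition YQb k := toM f f (Tn V true false k).
Local Notation a := YQa.
Local Notation b := YQb.

Lemma YQ_sym i j m : toM f f (Tn V (~~ i) (~~ j) m) = (-1) ^+ m *: toM f f (Tn V i j m).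
Proof.
case: m => [|m]; first by rewrite expr0 scale1r; case: i; case: j.
have [_ h _] := hV; rewrite -toM_mscale; apply: toM_meq; exact: (h i j m.+1 isT).
Qed.

Let YQm i j k l (r s : int) :
  let C0 (x y : int) := T i j x * T k l y -
    (sgn ((i (+) j) && (k (+) l)) : CCC) *: (T k l y * T i j x) in
  let Y (x y : int) := T k j x * T i l y - T k j y * T i l x in
  let Z (x y : int) := T (~~ k) j x * T (~~ i) l y - T k (~~ j) y * T i (~~ l) x in
  (sgn ((i && k) (+) (i && l) (+) (k && l)) : CCC) *: (C0 (r + 2) s - C0 r (s + 2)) =
  Y (r + 1) s + Y r (s + 1) - (sgn (k (+) l) : CCC) *: (Z (r + 1) s - Z r (s + 1)).
Proof.
have [_ _ /(_ i j k l r s) /(toM_meq f f)] := hV.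
rewrite /scomm !(toM_msub, toM_madd, toM_mscale).
by rewrite !(toM_mmul _ _ _ _ fK gK).
Qed.

Let asgnZ m (X : 'M[CCC]_n0.+1) : asgn m X = (-1) ^+ m *: X.
Proof.
by rewrite /asgn -signr_odd; case: (odd m); rewrite ?expr1 ?expr0 ?scale1r ?scaleN1r.
Qed.

Lemma YQ_qrel_aC : qrel a b /\ forall i j, a i.*2 * a j.*2 = a j.*2 * a i.*2.
Proof.
have tt m : T true true (Posz m) = asgn m (a m) by rewrite asgnZ; exact: (YQ_sym false false).
have ft m : T false true (Posz m) = asgn m (b m) by rewrite asgnZ; exact: (YQ_sym true false).
have ng i j : T i j (-1) = 0 by exact: toM_mzero.
have e0 : a 0%N = 1 by exact: (toM_mid (can_inj fK)).
have f0 : b 0%N = 0 by exact: toM_mzero.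
have ff m : T false false (Posz m) = a m by [].
have tf m : T true false (Posz m) = b m by [].
split; first exact: (@YQ_abstract_qrel _ _ T YQm a b ff tf tt ft ng e0 f0).
exact: (@YQ_abstract_aC _ _ T YQm a b ff tf ft e0).
Qed.

End YQModule.

Lemma gcoef_sign (V : lmodType CCC) (fc : nat -> CCC) (x : nat -> V) m :
  \sum_(r < m.+1) gcoef fc (m - r) *: ((-1) ^+ r *: x r) =
  (-1) ^+ m *: \sum_(r < m.+1) gcoef fc (m - r) *: x r.
Proof.
rewrite scaler_sumr; apply: eq_bigr => r _; rewrite !scalerA.
have [o|o] := boolP (odd (m - r)); first by rewrite gcoef_odd // !(mul0r, mulr0).
rewrite mulrC; congr (_ * _ *: _); rewrite -signr_odd -[in RHS]signr_odd.
by move: o; rewrite (oddB (leq_ord r)) negb_add => /eqP ->.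
Qed.

Lemma entry_even0 (K : nzRingType) (x : K) (p q : bool) :
  x * (~~ p)%:R = (~~ q)%:R * x -> q != p -> x = 0.
Proof.
by case: p; case: q => //= + _; rewrite !(mulr0n, mulr1n, mulr0, mulr1, mul0r, mul1r).
Qed.

Lemma entry_odd0 (K : nzRingType) (x : K) (p q : bool) :
  x * (~~ p)%:R = x - (~~ q)%:R * x -> ~~ q != p -> x = 0.
Proof.
by case: p; case: q => //= + _;
  rewrite !(mulr0n, mulr1n, mulr0, mulr1, mul0r, mul1r, subr0, subrr).
Qed.

Lemma homhom_entry (B B1 : finType) (par : B -> bool) (par1 : B1 -> bool) n0 n1
    (f : 'I_n0.+1 -> B) (f1 : 'I_n1.+1 -> B1) (Phi : 'M[CCC]_(n1.+1, n0.+1)) :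
  homhom (evenM par f) (evenM par1 f1) Phi ->
  (forall i j, par1 (f1 i) != par (f j) -> Phi i j = 0) \/
  (forall i j, ~~ par1 (f1 i) != par (f j) -> Phi i j = 0).
Proof.
have E i j : (Phi *m evenM par f) i j = Phi i j * (~~ par (f j))%:R.
  by rewrite /evenM mul_mx_diag !mxE.
have E1 i j : (evenM par1 f1 *m Phi) i j = (~~ par1 (f1 i))%:R * Phi i j.
  by rewrite /evenM mul_diag_mx !mxE.
case=> /matrixP h; [left|right] => i j; move: (h i j).
  by rewrite E E1; exact: entry_even0.
rewrite mulmxBl mul1mx E.
have -> : (Phi - evenM par1 f1 *m Phi) i j = Phi i j - (~~ par1 (f1 i))%:R * Phi i j.
  by rewrite -E1 !mxE.
exact: entry_odd0.
Qed.

Lemma Vs_mx n (s : 'I_n -> CC) (M : hmod n) : is_Vs s M ->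
  exists n0 (f : 'I_n0.+1 -> hbase n M) (g : hbase n M -> 'I_n0.+1),
  let xi i : 'M[CCC]_n0.+1 := toM f f (hxi n M i) in
  [/\ cancel f g /\ cancel g f, forall i, mxodd (evenM (hpar n M) f) (xi i),
      forall i, xi i * xi i = (s i : CCC)%:A,
      forall i j, i != j -> xi i * xi j = - (xi j * xi i)
    & msimple (evenM (hpar n M) f) (fun X => exists i, X = xi i)].
Proof.
move=> [ho ha h2 hs]; have [n0 [f [g [fK gK]]]] := fin_enum hs.1.
exists n0, f, g; split=> // [i|i|i j ij|].
- exact: homog_mxodd.
- have := toM_meq f f (h2 i); rewrite (toM_mmul _ _ _ _ fK gK) toM_mscale (toM_mid (can_inj fK)) => h.
  exact: h.
- have := toM_meq f f (ha i j ij); rewrite toM_madd !(toM_mmul _ _ _ _ fK gK) toM_mzero.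
  by move/eqP; rewrite addr_eq0 => /eqP h; exact: h.
exact: gr_simple_msimple.
Qed.

Lemma mx_Vs n (s : 'I_n -> CC) (B : finType) (par : B -> bool) n0 (f : 'I_n0.+1 -> B)
    (g : B -> 'I_n0.+1) (xi : 'I_n -> 'M[CCC]_n0.+1) :
  cancel f g -> cancel g f -> (forall i, mxodd (evenM par f) (xi i)) ->
  (forall i, xi i * xi i = (s i : CCC)%:A) ->
  (forall i j, i != j -> xi i * xi j = - (xi j * xi i)) ->
  msimple (evenM par f) (fun X => exists i, X = xi i) ->
  is_Vs s (HMod n B par (fun i => ofM g g (xi i))).
Proof.
move=> fK gK xo xi2 xiC xS; split=> [i x y pxy|i j ij|i|] /=.
- apply: ((mxoddP par f (xi i)).1 (xo i)); rewrite !gK.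
  by move: pxy => /=; case: (par x); case: (par y).
- apply: (toM_inj (f1 := f) (f2 := f) gK gK).
  rewrite toM_madd !(toM_mmul _ _ _ _ fK gK) !ofMK // toM_mzero -[_ *m _]/(xi i * xi j) xiC //.
  by rewrite addNr.
- apply: (toM_inj (f1 := f) (f2 := f) gK gK).
  rewrite (toM_mmul _ _ _ _ fK gK) !ofMK // toM_mscale (toM_mid (can_inj fK)); exact: xi2.
exact: msimple_gr_simple.
Qed.

(** * Classification and isomorphism criterion *)

Lemma YQ_classification (V : smod) : is_YQmod V -> YQ_simple V ->
  exists (n : nat) (s : 'I_n -> CC) (fc : nat -> CC), [/\ regular s, typical s &
    exists M : hmod n, is_Vs s M /\
      (YQ_iso V (tens (pullV s M) (Gamma fc)) \/ YQ_iso V (tens (Pi (pullV s M)) (Gamma fc)))].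
Proof.
move=> hV sV; have [n0 [f [g [fK gK]]]] := fin_enum sV.1.
pose E := evenM (spar V) f; pose a := YQa f; pose b := YQb f.
have [rel aC] := YQ_qrel_aC fK gK hV.
have [hom _ _] := hV.
have aE k : a k.*2 * E = E * a k.*2.
  apply: evenM_comm; case: k => [|k]; last exact: (hom false false).
  by move=> x y pxy; rewrite /Tn /= /mid; case: (x =P y) pxy => [->|//]; rewrite addbb.
have bE : mxodd E (b 1%N) by apply: homog_mxodd; exact: (hom true false).
have TE i j m : toM f f (Tn V i j m) = (if j then (-1) ^+ m else 1) *: (if i == j then a m else b m).
  case: i; case: j; rewrite /= ?scale1r //; first exact: (YQ_sym f hV false false).
  exact: (YQ_sym f hV true false).
have simp : msimple E (fun X => (exists k, X = a k.*2) \/ X = b 1%N).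
  move=> U U0 UD UZ UE Uab; apply: (gr_simple_msimple fK gK sV) => // X [[[i j] m] ->] /=.
  have st : forall m, mstable U (a m) /\ mstable U (b m).
    apply: (proj2 (@qrel_gen _ _ a b (@mstable _ _ U) rel _ _ _ _ _)).
    - by move=> Y Z hY hZ v Uv; rewrite mulmxDl; apply: UD; [exact: hY|exact: hZ].
    - by move=> Y Z hY hZ v Uv; rewrite mulmv; apply/hY/hZ.
    - by move=> d Y hY v Uv; rewrite -scalemxAl; apply/UZ/hY.
    - by move=> k; apply: Uab; left; exists k.
    - by apply: Uab; right.
  rewrite TE => v Uv; rewrite -scalemxAl; apply: UZ.
  by case: (i == j); [exact: (st m).1|exact: (st m).2].
have [N Nm NP] := qmodule_structure rel aC aE bE simp.
have [r rE] := closed_field_poly_normal N.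
pose s (i : 'I_(size r)) : CCC := - r`_i.
have Nt : N = \prod_(i < size r) ('X + (s i)%:P).
  rewrite {1}rE (monicP Nm) scale1r (big_nth 0) big_mkord; apply: eq_bigr => i _.
  by rewrite /s polyCN.
have [s0 sij [xi [fc [xo xi2 xiC abE xS]]]] := NP _ _ Nt.
exists (size r), s, fc; split=> [i|i j _|]; [exact: s0|exact: sij|].
pose M := HMod (size r) (sbase V) (spar V) (fun i => ofM g g (xi i)).
have hM : is_Vs s M by exact: mx_Vs.
(* M lives on the space of V with its own grading, and [is_Vs] leaves the parity free, so the
   identity matrix is the isomorphism and no parity change occurs. *)
exists M; split=> //; left.
have c1 : @cancel (sbase (tens (pullV s M) (Gamma fc))) 'I_n0.+1
    (fun k => (f k, tt)) (fun p : sbase V * unit => g p.1) by move=> k /=.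
have c2 : @cancel 'I_n0.+1 (sbase (tens (pullV s M) (Gamma fc)))
    (fun p : sbase V * unit => g p.1) (fun k => (f k, tt)) by case=> x [] /=; rewrite gK.
have par1 i j : spar (tens (pullV s M) (Gamma fc)) (f i, tt) != spar V (f j) ->
    (1%:M : 'M[CCC]_n0.+1) i j = 0.
  by rewrite /= addbF mxE; case: (i =P j) => [->|//]; rewrite eqxx.
have [mo _ _ _] := hM.
have xiE : (fun i => toM f f (hxi (size r) M i)) = xi.
  by apply: functional_extensionality => k; rewrite /= ofMK.
have pullE i j k : toM f f (Tn (pullV s M) i j k) = (if j then (-1) ^+ k else 1) *:
    (if i == j then pulla s xi (enum 'I_(size r)) k else pullb s xi (enum 'I_(size r)) k).
  by rewrite -xiE; exact: (@toM_pullV _ s M n0 f g fK gK mo i j k).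
have inter i j m : 1%:M *m toM f f (Tn V i j m) =
    toM (fun k => (f k, tt)) (fun k => (f k, tt)) (Tn (tens (pullV s M) (Gamma fc)) i j m) *m 1%:M.
  rewrite mulmx1 mul1mx TE (@toM_tens_Gamma (pullV s M) fc n0 f).
  have [am bm] := abE m; have am' : a m = _ := am; have bm' : b m = _ := bm.
  transitivity (\sum_(k < m.+1) gcoef fc (m - k) *: ((if j then (-1) ^+ k else 1) *:
    (if i == j then pulla s xi (enum 'I_(size r)) k else pullb s xi (enum 'I_(size r)) k))); last first.
    by apply: eq_bigr => k _; rewrite -pullE.
  rewrite am' bm'; move: (i == j) => e; case: e; case: j.
  - exact: (esym (gcoef_sign fc (fun k => pulla s xi (enum 'I_(size r)) k) m)).
  - by rewrite scale1r; apply: eq_bigr => k _; rewrite scale1r.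
  - exact: (esym (gcoef_sign fc (fun k => pullb s xi (enum 'I_(size r)) k) m)).
  by rewrite scale1r; apply: eq_bigr => k _; rewrite scale1r.
exact: (YQ_iso_of_mx fK gK c1 c2 (mulmx1 _) (mulmx1 _) par1 inter).
Qed.

Lemma tens_trace n (s : 'I_n -> CC) (M : hmod n) n0 (f : 'I_n0.+1 -> hbase n M)
    (g : hbase n M -> 'I_n0.+1) (fc : nat -> CC) m : cancel f g -> cancel g f -> is_Vs s M ->
  \tr (toM (fun k => (f k, tt)) (fun k => (f k, tt))
         (Tn (tens (pullV s M) (Gamma fc)) false false m)) =
  conv (gcoef (fc : nat -> CCC)) (fun i => (espoly (s : 'I_n -> CCC))`_i) m * n0.+1%:R.
Proof.
move=> fK gK [ho ha h2 _]; rewrite (@toM_tens_Gamma (pullV s M) fc n0 f).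
under eq_bigr => k _ do rewrite (@toM_pullV _ s M n0 f g fK gK ho) scale1r /=.
apply: gcoef_trace => [i|i j ij].
  have := toM_meq f f (h2 i); rewrite (toM_mmul _ _ _ _ fK gK) toM_mscale (toM_mid (can_inj fK)) => h.
  exact: h.
have := toM_meq f f (ha i j ij); rewrite toM_madd !(toM_mmul _ _ _ _ fK gK) toM_mzero.
by move/eqP; rewrite addr_eq0 => /eqP h; exact: h.
Qed.

Lemma YQ_iso_criterion (n n' : nat) (s : 'I_n -> CC) (s' : 'I_n' -> CC)
    (fc gc : nat -> CC) (M : hmod n) (M' : hmod n') :
  regular s -> typical s -> regular s' -> typical s' -> is_Vs s M -> is_Vs s' M' ->
  ((YQ_iso (tens (pullV s M) (Gamma fc)) (tens (pullV s' M') (Gamma gc)) \/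
    YQ_iso (tens (pullV s M) (Gamma fc)) (Pi (tens (pullV s' M') (Gamma gc)))) <->
   ((exists sigma : 'I_n' -> 'I_n, bijective sigma /\ forall i, s' i = s (sigma i)) /\
    (forall k, (0 < k)%N -> fc k = gc k))).
Proof.
move=> rs ts rs' ts' hM hM'.
have nz2 m (t : 'I_m -> CCC) : (forall i, t i != 0) -> (forall i j, i != j -> t i + t j != 0) ->
    forall i j, t i + t j != 0.
  move=> t0 tij i j; have [->|] := eqVneq i j; last exact: tij.
  by rewrite -mulr2n mulrn_eq0 /= t0.
have {}ts := nz2 _ _ rs ts; have {}ts' := nz2 _ _ rs' ts'.
have [n0 [f [g [[fK gK] xo xi2 xiC xS]]]] := Vs_mx hM.
have [n1 [f1 [g1 [[fK1 gK1] xo1 xi21 xiC1 xS1]]]] := Vs_mx hM'.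
have F0 : @cancel (sbase (tens (pullV s M) (Gamma fc))) 'I_n0.+1
      (fun k => (f k, tt)) (fun p : hbase n M * unit => g p.1) by move=> k /=.
have G0 : @cancel 'I_n0.+1 (sbase (tens (pullV s M) (Gamma fc)))
      (fun p : hbase n M * unit => g p.1) (fun k => (f k, tt)).
  by case=> x [] /=; rewrite gK.
have F1 : @cancel (sbase (tens (pullV s' M') (Gamma gc))) 'I_n1.+1
      (fun k => (f1 k, tt)) (fun p : hbase n' M' * unit => g1 p.1) by move=> k /=.
have G1 : @cancel 'I_n1.+1 (sbase (tens (pullV s' M') (Gamma gc)))
      (fun p : hbase n' M' * unit => g1 p.1) (fun k => (f1 k, tt)).
  by case=> x [] /=; rewrite gK1.
split=> [iso|[[sigma [sb ss]] fg]].
  have tr m := YQ_iso_trace false false m F0 G0 F1 G1 iso.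
  have {}tr m := etrans (esym (tens_trace fc m fK gK hM)) (etrans (tr m) (tens_trace gc m fK1 gK1 hM')).
  have e0 k (t : 'I_k -> CCC) (h : nat -> CCC) : conv (gcoef h) (fun i => (espoly t)`_i) 0%N = 1.
    by rewrite /conv big_ord1 /gcoef /= espoly0 mulr1.
  (* Degree 0 compares the dimensions; dividing by them leaves the normalised traces. *)
  have nn : n0.+1%:R = n1.+1%:R :> CCC by have := tr 0%N; rewrite !e0 !mul1r.
  have h m : conv (gcoef (fc : nat -> CCC)) (fun i => (espoly (s : 'I_n -> CCC))`_i) m =
      conv (gcoef (gc : nat -> CCC)) (fun i => (espoly (s' : 'I_n' -> CCC))`_i) m.
    by have := tr m; rewrite nn => /mulIf -> //; rewrite pnatr_eq0.
  have [||||||||est fE] := even_series_factor _ _ _ _ _ _ _ _ h => //; try exact: gcoef_odd.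
  - exact: espoly0.
  - exact: espoly0.
  - exact: espoly_coprime.
  - exact: espoly_coprime.
  split; first by have [sigma sb sE] := espoly_inj rs rs' est; exists sigma.
  move=> k k0; have := fE k.*2; rewrite /gcoef double_eq0 odd_double doubleK.
  by rewrite (negbTE (lt0n_neq0 k0)).
(* The space of M receives generators for s' with unchanged [a] and [b]; an intertwiner with M' for
   these generators is then one of YQ(1)-modules. *)
have [xi' [xo' xi2' xiC' abE xS']] := pull_reorder (s' := s') rs ts xo xi2 xiC xS sb ss.
have idem := evenM_idem (hpar n M) f; have idem1 := evenM_idem (hpar n' M') f1.
have [Phi [Psi [h1 h2 hh cP]]] := clifford_unique idem idem1 rs' xo' xi2' xiC' xo1 xi21 xiC1 xS' xS1.
have [ho _ _ _] := hM; have [ho1 _ _ _] := hM'.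
have gfg m : gcoef (fc : nat -> CCC) m = gcoef (gc : nat -> CCC) m.
  rewrite /gcoef; case: m => // m /=; case: ifP => //= om; apply: fg.
  by move: om; case: m.
have inter i j m : Phi *m toM (fun k => (f k, tt)) (fun k => (f k, tt))
      (Tn (tens (pullV s M) (Gamma fc)) i j m) =
    toM (fun k => (f1 k, tt)) (fun k => (f1 k, tt)) (Tn (tens (pullV s' M') (Gamma gc)) i j m) *m Phi.
  rewrite (@toM_tens_Gamma (pullV s M) fc n0 f) (@toM_tens_Gamma (pullV s' M') gc n1 f1).
  rewrite mulmx_sumr mulmx_suml; apply: eq_bigr => k _.
  rewrite (@toM_pullV _ s M n0 f g fK gK ho) (@toM_pullV _ s' M' n1 f1 g1 fK1 gK1 ho1).
  rewrite -!scalemxAr -!scalemxAl gfg; congr (_ *: (_ *: _)).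
  have [pa pb] := pull_intertwine s' (enum 'I_n') cP k; have [ea eb] := abE k.
  by case: (i == j); rewrite ?ea ?eb.
case: (homhom_entry hh) => hp; [left|right].
  apply: (@YQ_iso_of_mx _ _ _ _ _ _ _ _ Phi Psi F0 G0 F1 G1 h1 h2) => // i j /=.
  by rewrite !addbF; exact: hp.
apply: (@YQ_iso_of_mx _ (Pi _) _ _ _ _ _ _ Phi Psi F0 G0 F1 G1 h1 h2) => // i j /=.
by rewrite !addbF; exact: hp.
Qed.

Theorem theorem5p14 :
  (forall V : smod, is_YQmod V -> YQ_simple V ->
     exists (n : nat) (s : 'I_n -> CC) (fc : nat -> CC),
       [/\ regular s, typical s &
         exists M : hmod n, is_Vs s M /\
           (YQ_iso V (tens (pullV s M) (Gamma fc)) \/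
            YQ_iso V (tens (Pi (pullV s M)) (Gamma fc)))])
  /\
  (forall (n n' : nat) (s : 'I_n -> CC) (s' : 'I_n' -> CC)
          (fc gc : nat -> CC) (M : hmod n) (M' : hmod n'),
     regular s -> typical s -> regular s' -> typical s' ->
     is_Vs s M -> is_Vs s' M' ->
     ((YQ_iso (tens (pullV s M) (Gamma fc)) (tens (pullV s' M') (Gamma gc)) \/
       YQ_iso (tens (pullV s M) (Gamma fc)) (Pi (tens (pullV s' M') (Gamma gc))))
      <->
      ((exists sigma : 'I_n' -> 'I_n, bijective sigma /\ forall i, s' i = s (sigma i))
       /\ (forall k, (0 < k)%N -> fc k = gc k)))).
Proof. by split; [exact: YQ_classification | exact: YQ_iso_criterion]. Qed.
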